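(* Let $a\in[0,1/2]$, $p>2$, $q=p/(p-2)$, and $\mathbf A(x)=\frac a{\rho^2}(x_2,-x_1,0)$ on $\mathbb R^3$ with $\rho=\sqrt{x_1^2+x_2^2}$. Let $\mu_{a,p}(0)$ be the optimal constant in \[ \|\psi'-i\,a\,\psi\|_{\mathrm L^2(\mathbb S^1)}^2\ge\mu_{a,p}(0)\,\|\psi\|_{\mathrm L^p(\mathbb S^1)}^2\quad\forall\,\psi\in\mathrm H^1(\mathbb S^1,\mathbb C). \] Let $\phi\in\mathrm L^q(\mathbb S^1)$ be non-trivial. Then for any $\psi\in\mathrm H^1_{\mathbf A}(\mathbb R^3)$, \[ \int_{\mathbb R^3}|\nabla_{\mathbf A}\psi|^2\,dx\ge\frac14\int_{\mathbb R^3}\frac{|\psi|^2}{|x|^2}\,dx+\frac{\mu_{a,p}(0)}{\|\phi\|_{\mathrm L^q(\mathbb S^1)}}\int_{\mathbb R^3}\frac{\phi(\theta)}{\rho^2}\,|\psi|^2\,dx, \] where $(\rho,\theta,z)$ are cylindrical coordinates of $x$.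
   Context: Cylindrical coordinates: $\rho e^{i\theta}=x_1+ix_2$, $z=x_3$. $\nabla_{\mathbf A}=\nabla+i\mathbf A$, and $\mathrm H^1_{\mathbf A}(\mathbb R^3)$ is the space of complex-valued $\psi\in\mathrm L^2(\mathbb R^3)$ with $\nabla_{\mathbf A}\psi\in\mathrm L^2(\mathbb R^3)$. $\mathbb S^1\approx[0,2\pi)$ carries the uniform probability measure $d\theta/(2\pi)$, with respect to which norms on $\mathbb S^1$ are taken; $\mathrm H^1(\mathbb S^1,\mathbb C)$ is the space of $2\pi$-periodic complex functions with derivative in $\mathrm L^2$. *)

(* Defs.v *)
From HB Require Import structures.
From mathcomp Require Import all_boot all_order all_algebra.
From mathcomp Require Import all_classical all_reals all_analysis.
Set Implicit Arguments. Unset Strict Implicit. Unset Printing Implicit Defensive.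
Import Order.TTheory GRing.Theory Num.Theory.
Import numFieldNormedType.Exports.
Local Open Scope classical_set_scope.
Local Open Scope ring_scope.

Definition leb3 (R : realType) :=
  ((@lebesgue_measure R \x lebesgue_measure) \x lebesgue_measure)%E.

Definition x1 {R : realType} (x : R * R * R) : R := x.1.1.
Definition x2 {R : realType} (x : R * R * R) : R := x.1.2.
Definition x3 {R : realType} (x : R * R * R) : R := x.2.

Definition rho2 {R : realType} (x : R * R * R) : R := x1 x ^+ 2 + x2 x ^+ 2.
Definition norm2 {R : realType} (x : R * R * R) : R := rho2 x + x3 x ^+ 2.

Definition ej {R : realType} (j : 'I_3) : R * R * R :=
  ((if (j == 0 :> nat) then 1 else 0, if (j == 1 :> nat) then 1 else 0),
    if (j == 2 :> nat) then 1 else 0).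

Definition partial {R : realType} (j : 'I_3) (f : R * R * R -> R) :
  R * R * R -> R := fun x => 'D_(ej j) f x.

Definition iter_partial {R : realType} (js : seq 'I_3) (f : R * R * R -> R) :=
  foldr (fun j g => partial j g) f js.

Definition smooth3 {R : realType} (f : R * R * R -> R) : Prop :=
  forall js : seq 'I_3, continuous (iter_partial js f) /\
    forall (j : 'I_3) (x : R * R * R), derivable (iter_partial js f) x (ej j).

(* Omega = R^3 minus the x3-axis, where the potential A is smooth *)
Definition Omega {R : realType} : set (R * R * R) := [set x | rho2 x != 0].

Definition testfun3 {R : realType} (chi : R * R * R -> R) : Prop :=
  smooth3 chi /\
  exists K : set (R * R * R), [/\ compact K, K `<=` Omega &
     forall x, ~ K x -> chi x = 0].

Definition locint3 {R : realType} (g : R * R * R -> R) : Prop :=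
  forall K : set (R * R * R), compact K -> K `<=` Omega ->
    (@leb3 R).-integrable K (EFin \o g).

Definition weak_partial3 {R : realType} (j : 'I_3) (u g : R * R * R -> R) :
  Prop :=
  measurable_fun setT g /\ locint3 g /\
  forall chi, testfun3 chi ->
    (\int[@leb3 R]_x (u x * partial j chi x)%:E =
     - \int[@leb3 R]_x (g x * chi x)%:E)%E.

Definition Apot {R : realType} (a : R) (j : 'I_3) (x : R * R * R) : R :=
  if (j == 0 :> nat) then a / rho2 x * x2 x
  else if (j == 1 :> nat) then - (a / rho2 x * x1 x)
  else 0.

(* psi = u + i v, grad psi = gu + i gv (componentwise);
   |grad_A psi|^2 = sum_j |(gu_j - A_j v) + i (gv_j + A_j u)|^2 *)
Definition magn_density {R : realType} (a : R) (u v : R * R * R -> R)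
  (gu gv : 'I_3 -> R * R * R -> R) (x : R * R * R) : R :=
  \sum_(j < 3) ((gu j x - Apot a j x * v x) ^+ 2
              + (gv j x + Apot a j x * u x) ^+ 2).

Definition H1A {R : realType} (a : R) (u v : R * R * R -> R)
  (gu gv : 'I_3 -> R * R * R -> R) : Prop :=
  [/\ measurable_fun setT u, measurable_fun setT v,
      (\int[@leb3 R]_x (u x ^+ 2 + v x ^+ 2)%:E < +oo)%E,
      forall j, weak_partial3 j u (gu j) /\ weak_partial3 j v (gv j) &
      (\int[@leb3 R]_x (magn_density a u v gu gv x)%:E < +oo)%E].

(* The circle S^1 ~ [0, 2 pi) with the uniform probability measure     *)

(* the period interval [0, 2 pi] (the endpoint is a null set) *)
Definition per {R : realType} : set R := `[0, 2 * pi]%classic.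

Definition smooth1 {R : realType} (f : R -> R) : Prop :=
  forall n : nat, continuous (iter n (@derive1 R R) f) /\
    forall t : R, derivable (iter n (@derive1 R R) f) t 1.

Definition testfun1 {R : realType} (chi : R -> R) : Prop :=
  smooth1 chi /\
  exists K : set R, compact K /\ forall t, ~ K t -> chi t = 0.

Definition periodic2pi {R : realType} (f : R -> R) : Prop :=
  forall t, f (t + 2 * pi) = f t.

Definition H1circ {R : realType} (f f' : R -> R) : Prop :=
  [/\ periodic2pi f /\ periodic2pi f',
      measurable_fun setT f /\ measurable_fun setT f',
      (forall K : set R, compact K ->
         (@lebesgue_measure R).-integrable K (EFin \o f) /\
         (@lebesgue_measure R).-integrable K (EFin \o f')),
      (forall chi, testfun1 chi ->
         (\int[lebesgue_measure]_t (f t * derive1 chi t)%:E =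
          - \int[lebesgue_measure]_t (f' t * chi t)%:E)%E) &
      (\int[lebesgue_measure]_(t in @per R) (f' t ^+ 2)%:E < +oo)%E].

Definition L2circ_sq {R : realType} (f g : R -> R) : \bar R :=
  ((2 * pi)^-1%:E *
    \int[lebesgue_measure]_(t in @per R) (f t ^+ 2 + g t ^+ 2)%:E)%E.

Definition Lpcirc_sq {R : realType} (p : R) (f g : R -> R) : \bar R :=
  (((2 * pi)^-1%:E *
    \int[lebesgue_measure]_(t in @per R)
        (powR (f t ^+ 2 + g t ^+ 2) (p / 2))%:E) `^ (2 / p))%E.

Definition Lqcirc {R : realType} (q : R) (phi : R -> R) : \bar R :=
  (((2 * pi)^-1%:E *
    \int[lebesgue_measure]_(t in @per R) (powR `|phi t| q)%:E)
      `^ (q^-1))%E.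

(* mu_{a,p}(0): the optimal (largest) constant m such that
   || psi' - i a psi ||_2^2 >= m || psi ||_p^2 for all psi in H^1(S^1,C).
   With psi = f + i g: psi' - i a psi = (f' + a g) + i (g' - a f). *)
Definition mu_ap {R : realType} (a p : R) : \bar R :=
  ereal_sup [set m%:E | m in [set m : R |
    forall f f' g g' : R -> R, H1circ f f' -> H1circ g g' ->
      (m%:E * Lpcirc_sq p f g <=
       L2circ_sq (fun t => f' t + a * g t)%R (fun t => g' t - a * f t)%R)%E]].

Definition angle {R : realType} (y1 y2 : R) : R :=
  xget 0 [set t : R | [/\ 0 <= t, t < 2 * pi,
                          cos t * Num.sqrt (y1 ^+ 2 + y2 ^+ 2) = y1 &
                          sin t * Num.sqrt (y1 ^+ 2 + y2 ^+ 2) = y2]].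

(* Main.v *)
Require Import Defs.
From HB Require Import structures.
From mathcomp Require Import all_boot all_order all_algebra.
From mathcomp Require Import all_classical all_reals all_analysis.
From mathcomp Require Import measurable_realfun lebesgue_integral_fubini ring lra.
Import Order.TTheory GRing.Theory Num.Theory.
Import numFieldNormedType.Exports.
Local Open Scope classical_set_scope.
Local Open Scope ring_scope.
Set Implicit Arguments.
Unset Strict Implicit.
Unset Printing Implicit Defensive.

(* Along the dilations or the rotations [T_t] about the third axis, testing the
   weak gradient of u with transported test functions shows that
   u (T_t x) - u x is the integral over [0, t] of the derivative of u along the
   flow, for almost every x. For the dilations, Cauchy-Schwarz with an
   exponential weight turns this into the radial Hardy inequality
   int u^2 / |x|^2 <= 4 int (x . grad u)^2 / |x|^2. For the rotations, it shows
   that psi restricted to almost every orbit is in H^1 of the circle, where the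
   definition of mu and Hoelder's inequality apply; averaging over the rotations
   gives the angular part. Since x . A = 0 and x1 A2 - x2 A1 = - a,
   |grad_A psi|^2 dominates pointwise the sum of the radial and the angular
   terms. *)

(** No change to cylindrical or spherical coordinates is made. Both flows consist of linear maps
    with constant Jacobian e^(3ct); they preserve [Omega] and multiply [rho2] and [norm2] by
    scalars. One family [flow b c] with c >= 0 thus serves both purposes and keeps compact subsets
    of [Omega] under control. The test functions must be stable under the flows and under partial
    derivatives, and rich enough to detect a nonzero function; hence a small expression language
    built on one smooth bump. The sharp constant 1/4 comes from a single time step of length 1:
    |x|^(-1/2), the formal extremal of Hardy's inequality, decays like e^(-t/2) along the dilations,
    and the weight is the one that makes Cauchy-Schwarz an equality for it. Truncating 1/|x|^2 makes
    the left side finite, so that part of it can be absorbed. On the angular side, the flow identity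
    holds for each time off a null set depending on that time, whereas an orbit needs it for almost
    all times at once; Tonelli applied to the defect exchanges the two. Since mu is a supremum, each
    admissible real m >= 0 is treated separately. *)

(* The library declares products of measures sigma-finite only for
   subprobability factors. *)
Section product_sigma_finite.
Context d1 d2 (T1 : measurableType d1) (T2 : measurableType d2) (R : realType).
Variable m1 : {sigma_finite_measure set T1 -> \bar R}.
Variable m2 : {sigma_finite_measure set T2 -> \bar R}.

Lemma product_measure1_sigma_finite : sigma_finite setT (m1 \x m2)%E.
Proof.
have /sigma_finiteP[F [TF ndF Foo]] := sigma_finiteT m1.
have /sigma_finiteP[G [TG ndG Goo]] := sigma_finiteT m2.
exists (fun n => F n `*` G n) => [|k].
  apply/seteqP; split => // -[x y] _.
  have [n _ Fnx] : (\bigcup_n F n) x by rewrite -TF.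
  have [k _ Gky] : (\bigcup_n G n) y by rewrite -TG.
  exists (maxn n k) => //; split.
  - by move: x Fnx; exact/subsetPset/ndF/leq_maxl.
  - by move: y Gky; exact/subsetPset/ndG/leq_maxr.
have [? ?] := Foo k; have [? ?] := Goo k.
split; first exact: measurableX.
by rewrite product_measure1E// lte_mul_pinfty// ge0_fin_numE.
Qed.

Definition product_sf : {sigma_finite_measure set (T1 * T2)%type -> \bar R} :=
  HB.pack (m1 \x m2)%E (Measure_isSigmaFinite.Build _ _ _ (m1 \x m2)%E
    product_measure1_sigma_finite).

End product_sigma_finite.

Definition lebesgue3 (R : realType) :
    {sigma_finite_measure set _ -> \bar R} :=
  product_sf (product_sf (@lebesgue_measure R) (@lebesgue_measure R))
             (@lebesgue_measure R).

(** * Tonelli's theorem and linear changes of variables in R^3 *)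

Section linear_change_of_variables.
Context {R : realType}.
Local Notation mu := (@lebesgue_measure R).
Local Notation leb := (lebesgue3 R).

(** Multiplied by [k], the image of Lebesgue measure under the affine map gives every half-open
    interval its length, so uniqueness of Lebesgue measure identifies the two. *)
Lemma ge0_integral_affine (k b : R) (f : R -> \bar R) : 0 < k ->
  measurable_fun [set: R] f -> (forall x, 0 <= f x)%E ->
  (\int[mu]_x f (k * x + b)%R = k^-1%:E * \int[mu]_x f x)%E.
Proof.
move=> k0 mf f0.
pose T : measurableTypeR R -> measurableTypeR R := fun x => k * x + b.
have mT : measurable_fun setT T.
  by apply: measurable_funD => //; exact: measurable_funM.
pose nu0 := mscale (NngNum (ltW k0)) (pushforward mu T); pose nu := nu0 mT.
have nuE A : measurable A -> mu A = nu A.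
  apply: lebesgue_measure_unique => _ [[u v]] _ <-.
  have pre : T @^-1` `]u, v] = `](u - b) / k, (v - b) / k]%classic.
    apply/seteqP; split => x /=; rewrite !in_itv/= /T;
    by rewrite ltr_pdivrMr// ler_pdivlMr// ltrBlDr lerBrDr (mulrC x).
  transitivity (k%:E * mu `]((u - b) / k)%R, ((v - b) / k)%R])%E; last by rewrite -pre.
  rewrite !lebesgue_measure_itv/= !lte_fin ltr_pM2r ?invr_gt0// ltrD2r.
  case: ifPn => _; last by rewrite mule0.
  by rewrite -!EFinD -EFinM; congr (_%:E); field; exact: lt0r_neq0.
have -> : (\int[mu]_x f x = \int[nu]_x f x)%E.
  by apply: eq_measure_integral => A mA _; exact: nuE.
rewrite /nu /nu0 ge0_integral_mscale//= ge0_integral_pushforward//= muleA.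
by rewrite -EFinM mulVf ?mul1e// gt_eqF.
Qed.

(** The prefactor [c] collects one factor [k^-1] per coordinate when the lemma is iterated for the
    dilations of R^3. *)
Lemma ge0_integral_scaleZ (k c : R) (h : R -> \bar R) : 0 < k -> 0 <= c ->
  measurable_fun [set: R] h -> (forall x, 0 <= h x)%E ->
  (\int[mu]_x (c%:E * h (k * x)%R) = (c * k^-1)%:E * \int[mu]_x h x)%E.
Proof.
move=> k0 c0 mh h0; rewrite ge0_integralZl_EFin//; last first.
  by apply: (measurableT_comp mh); exact: measurable_funM.
rewrite EFinM -muleA; congr (_ * _)%E.
rewrite -(@ge0_integral_affine k 0 _ k0 mh h0).
by apply: eq_integral => x _; rewrite addr0.
Qed.

Let T3 := (R * R * R)%type.

Lemma ge0_integral_leb3E (f : T3 -> \bar R) :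
  measurable_fun [set: T3] f -> (forall x, 0 <= f x)%E ->
  (\int[leb]_x f x = \int[mu]_z \int[mu]_y \int[mu]_x f (x, y, z))%E.
Proof.
move=> mf f0; transitivity (\int[mu]_z \int[product_sf mu mu]_xy f (xy, z))%E.
  exact: (fubini_tonelli2 (m1 := product_sf mu mu) (m2 := mu) f).
apply: eq_integral => z _.
apply: (fubini_tonelli2 (m1 := mu) (m2 := mu) (fun xy => f (xy, z))) => //.
by apply: (measurableT_comp mf); apply: measurable_fun_pair.
Qed.

Lemma measurable_shear1 (k : R) :
  measurable_fun [set: T3] (fun x : T3 => (x.1.1 + k * x.1.2, x.1.2, x.2) : T3).
Proof.
apply: measurable_fun_pair => //; apply: measurable_fun_pair => //.
- apply: measurable_funD; first exact: measurableT_comp.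
  by apply: measurable_funM => //; exact: measurableT_comp.
- exact: measurableT_comp.
Qed.

Lemma measurable_shear2 (k : R) :
  measurable_fun [set: T3] (fun x : T3 => (x.1.1, x.1.2 + k * x.1.1, x.2) : T3).
Proof.
apply: measurable_fun_pair => //; apply: measurable_fun_pair => //.
- exact: measurableT_comp.
- apply: measurable_funD; first exact: measurableT_comp.
  by apply: measurable_funM => //; exact: measurableT_comp.
Qed.

Lemma measurable_dilation (k : R) :
  measurable_fun [set: T3] (fun x : T3 => (k * x.1.1, k * x.1.2, k * x.2) : T3).
Proof.
apply: measurable_fun_pair => //; last exact: measurable_funM.
by apply: measurable_fun_pair => //; apply: measurable_funM => //;
  exact: measurableT_comp.
Qed.

Lemma measurable_pair2 (f : T3 -> \bar R) y z : measurable_fun [set: T3] f ->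
  measurable_fun [set: R] (fun x : R => f (x, y, z)).
Proof.
move=> mf; apply: (measurableT_comp mf).
by apply: measurable_fun_pair => //; apply: measurable_fun_pair.
Qed.

Lemma measurable_integral1 (f : T3 -> \bar R) z : measurable_fun [set: T3] f ->
  (forall x, 0 <= f x)%E ->
  measurable_fun [set: R] (fun y : R => \int[mu]_x f (x, y, z))%E.
Proof.
move=> mf f0.
apply: (measurable_fun_fubini_tonelli_G (m1 := mu) (fun xy => f (xy, z))) => //.
by apply: (measurableT_comp mf); apply: measurable_fun_pair.
Qed.

Lemma measurable_integral2 (f : T3 -> \bar R) : measurable_fun [set: T3] f ->
  (forall x, 0 <= f x)%E ->
  measurable_fun [set: R] (fun z : R => \int[mu]_y \int[mu]_x f (x, y, z))%E.
Proof.
move=> mf f0.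
rewrite (_ : (fun z => _) = fun z => \int[product_sf mu mu]_xy f (xy, z))%E.
  exact: (measurable_fun_fubini_tonelli_G (m1 := product_sf mu mu) f).
apply/funext => z; apply/esym.
apply: (fubini_tonelli2 (m1 := mu) (m2 := mu) (fun xy => f (xy, z))) => //.
by apply: (measurableT_comp mf); apply: measurable_fun_pair.
Qed.

Lemma ge0_integral_shear1 (k : R) (f : T3 -> \bar R) :
  measurable_fun [set: T3] f -> (forall x, 0 <= f x)%E ->
  (\int[leb]_x f (x.1.1 + k * x.1.2, x.1.2, x.2)%R = \int[leb]_x f x)%E.
Proof.
move=> mf f0; rewrite [RHS]ge0_integral_leb3E//.
rewrite [LHS]ge0_integral_leb3E; first last.
- by move=> x.
- exact: (measurableT_comp mf (measurable_shear1 k)).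
apply: eq_integral => z _; apply: eq_integral => y _ /=.
rewrite -[RHS]mul1e -[in RHS]invr1.
rewrite -(@ge0_integral_affine 1 (k * y) (fun x => f (x, y, z))) //=.
  by under [RHS]eq_integral do rewrite mul1r.
exact: measurable_pair2.
Qed.

Lemma ge0_integral_shear2 (k : R) (f : T3 -> \bar R) :
  measurable_fun [set: T3] f -> (forall x, 0 <= f x)%E ->
  (\int[leb]_x f (x.1.1, x.1.2 + k * x.1.1, x.2)%R = \int[leb]_x f x)%E.
Proof.
have sw : measurable_fun [set: T3] (fun x : T3 => (x.1.2, x.1.1, x.2) : T3).
  by do 2!apply: measurable_fun_pair => //; exact: measurableT_comp.
(* Exchanging the first two coordinates preserves the integral by Tonelli and conjugates this shear
   to the previous one. *)
have E (g : T3 -> \bar R) : measurable_fun [set: T3] g -> (forall x, 0 <= g x)%E ->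
    (\int[leb]_x g x = \int[leb]_x g (x.1.2, x.1.1, x.2))%E.
  move=> mg g0; rewrite [LHS]ge0_integral_leb3E//.
  rewrite [RHS]ge0_integral_leb3E; first last.
  - by move=> x.
  - exact: (measurableT_comp mg sw).
  apply: eq_integral => z _ /=.
  apply/esym/(@fubini_tonelli _ _ _ _ R mu mu (fun xy => g (xy, z))) => //.
  by apply: (measurableT_comp mg); apply: measurable_fun_pair.
move=> mf f0; rewrite [RHS]E// [LHS]E; first last.
- by move=> x.
- exact: (measurableT_comp mf (measurable_shear2 k)).
apply: (@ge0_integral_shear1 k (fun x => f (x.1.2, x.1.1, x.2))) => [|x //].
exact: (measurableT_comp mf sw).
Qed.

Lemma ge0_integral_dilation (k : R) (f : T3 -> \bar R) : 0 < k ->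
  measurable_fun [set: T3] f -> (forall x, 0 <= f x)%E ->
  (\int[leb]_x f (k * x.1.1, k * x.1.2, k * x.2)%R
   = ((k ^+ 3)^-1)%:E * \int[leb]_x f x)%E.
Proof.
move=> k0 mf f0; rewrite [in RHS]ge0_integral_leb3E//.
rewrite [LHS]ge0_integral_leb3E; first last.
- by move=> x.
- exact: (measurableT_comp mf (measurable_dilation k)).
rewrite /=.
have kv : (0 <= k^-1)%R by rewrite invr_ge0 ltW.
have I1 y z : (\int[mu]_x f (k * x, y, z)%R = (1 * k^-1)%:E * \int[mu]_x f (x, y, z))%E.
  rewrite -(@ge0_integral_scaleZ k 1 (fun x => f (x, y, z)) k0 ler01).
  - by apply: eq_integral => x _; rewrite mul1e.
  - exact: measurable_pair2.
  - by move=> x.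
under eq_integral do under eq_integral do rewrite I1 mul1r.
have I2 z := ge0_integral_scaleZ k0 kv (measurable_integral1 z mf f0)
  (fun y => integral_ge0 mu (fun x _ => f0 (x, y, z))).
under eq_integral do rewrite I2.
have kv2 : 0 <= k^-1 * k^-1 by exact: mulr_ge0.
rewrite (ge0_integral_scaleZ k0 kv2 (measurable_integral2 mf f0)); last first.
  by move=> z; apply: integral_ge0 => y _; exact: integral_ge0.
by congr (_%:E * _)%E; rewrite -!invfM !exprS expr0 mulr1 mulrA.
Qed.

End linear_change_of_variables.

(** * Rotations and dilations as one family of flows, and their Jacobian *)

Section flow.
Context {R : realType}.
Local Notation leb := (lebesgue3 R).
Let T3 := (R * R * R)%type.

(* [b = 1, c = 0] is the rotation about the third axis,
   [b = 0, c = 1] the dilation *)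
Definition flow (b c t : R) (x : T3) : T3 :=
  (expR (c * t) * (cos (b * t) * x.1.1 - sin (b * t) * x.1.2),
   expR (c * t) * (sin (b * t) * x.1.1 + cos (b * t) * x.1.2),
   expR (c * t) * x.2).

Lemma flow0 b c x : flow b c 0 x = x.
Proof.
by case: x => [[x y] z]; rewrite /flow/= !mulr0 expR0 cos0 sin0; congr (_, _, _); ring.
Qed.

Lemma flowD b c s t x : flow b c s (flow b c t x) = flow b c (s + t) x.
Proof.
by rewrite /flow/= !mulrDr expRD cosD sinD; congr (_, _, _); ring.
Qed.

Lemma flowK b c t : cancel (flow b c t) (flow b c (- t)).
Proof. by move=> x; rewrite flowD addNr flow0. Qed.

Lemma rho2_flow b c t x : rho2 (flow b c t x) = expR (c * t) ^+ 2 * rho2 x.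
Proof.
rewrite /rho2 /x1 /x2/=; have := cos2Dsin2 (b * t).
set C := cos _; set S := sin _; set e := expR _ => H.
transitivity ((C ^+ 2 + S ^+ 2) * (e ^+ 2 * (x.1.1 ^+ 2 + x.1.2 ^+ 2))); first by ring.
by rewrite H mul1r.
Qed.

Lemma norm2_flow b c t x : norm2 (flow b c t x) = expR (c * t) ^+ 2 * norm2 x.
Proof. by rewrite /norm2 rho2_flow [RHS]mulrDr; congr (_ + _); rewrite /x3 -exprMn. Qed.

Lemma measurable_flow2 b c :
  measurable_fun [set: R * T3] (fun p : R * T3 => flow b c p.1 p.2).
Proof.
have m1 : measurable_fun [set: R * T3] (fun p : R * T3 => p.2.1.1).
  by apply: measurableT_comp => //; apply: measurableT_comp.
have m2 : measurable_fun [set: R * T3] (fun p : R * T3 => p.2.1.2).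
  by apply: measurableT_comp => //; apply: measurableT_comp.
have m3 : measurable_fun [set: R * T3] (fun p : R * T3 => p.2.2).
  by apply: measurableT_comp => //; apply: measurableT_comp.
have ml k : measurable_fun [set: R * T3] (fun p : R * T3 => k * p.1).
  exact: measurable_funM.
have mE : measurable_fun [set: R * T3] (fun p : R * T3 => expR (c * p.1)).
  by apply: measurableT_comp => //; exact: measurable_expR.
have mC : measurable_fun [set: R * T3] (fun p : R * T3 => cos (b * p.1)).
  by apply: (@measurableT_comp _ _ _ _ _ _ cos) => //; apply: continuous_measurable_fun => ?; exact: continuous_cos.
have mS : measurable_fun [set: R * T3] (fun p : R * T3 => sin (b * p.1)).
  by apply: (@measurableT_comp _ _ _ _ _ _ sin) => //; apply: continuous_measurable_fun => ?; exact: continuous_sin.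
apply: measurable_fun_pair; last exact: measurable_funM.
apply: measurable_fun_pair; apply: measurable_funM => //.
  by apply: measurable_funB; exact: measurable_funM.
by apply: measurable_funD; exact: measurable_funM.
Qed.

Lemma measurable_flow b c t : measurable_fun [set: T3] (flow b c t).
Proof.
have mp : measurable_fun [set: T3] (fun x => (t, x)) by exact: measurable_fun_pair.
exact: (measurableT_comp (measurable_flow2 b c) mp).
Qed.

(** A rotation by [t] is a product of three shears, with slopes -tan(t/2), sin t and -tan(t/2), each
    of which is a translation on lines. The tangent requires the condition on the cosine. *)
Let ge0_integral_rot_half (t : R) (f : T3 -> \bar R) : cos (t / 2) != 0 ->
  measurable_fun [set: T3] f -> (forall x, 0 <= f x)%E ->
  (\int[leb]_x f (flow 1 0 t x) = \int[leb]_x f x)%E.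
Proof.
move=> c0 mf f0.
pose k := - (sin (t / 2) / cos (t / 2)); pose s := sin t.
pose S1 x : T3 := (x.1.1 + k * x.1.2, x.1.2, x.2).
pose S2 x : T3 := (x.1.1, x.1.2 + s * x.1.1, x.2).
have E x : flow 1 0 t x = S1 (S2 (S1 x)).
  rewrite /flow/= /S1 /S2/= /k /s mul0r expR0 !mul1r.
  have -> : cos t = cos (t / 2 + t / 2) by congr cos; field.
  have -> : sin t = sin (t / 2 + t / 2) by congr sin; field.
  have := cos2Dsin2 (t / 2); rewrite cosD sinD.
  move: c0; set C := cos _; set S := sin _ => c0 H.
  (* The entries agree only modulo sin^2 + cos^2 = 1; each difference is exhibited as a multiple of
     this relation. *)
  have K : S * S + C * C - 1 = 0 by rewrite -H; ring.
  congr (_, _, _).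
  - apply/eqP; rewrite -subr_eq0; apply/eqP.
    transitivity ((S * S + C * C - 1) * (x.1.1 - 2 * S / C * x.1.2)); last by rewrite K mul0r.
    by field.
  - apply/eqP; rewrite -subr_eq0; apply/eqP.
    transitivity ((S * S + C * C - 1) * x.1.2); last by rewrite K mul0r.
    by field.
under eq_integral do rewrite E.
have m1 : measurable_fun [set: T3] (f \o S1).
  exact: (measurableT_comp mf (measurable_shear1 k)).
have m2 : measurable_fun [set: T3] (f \o S1 \o S2).
  exact: (measurableT_comp m1 (measurable_shear2 s)).
rewrite (@ge0_integral_shear1 _ k (f \o S1 \o S2) m2 (fun=> f0 _)).
rewrite (@ge0_integral_shear2 _ s (f \o S1) m1 (fun=> f0 _)).
exact: (@ge0_integral_shear1 _ k f mf f0).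
Qed.

Let ge0_integral_rot (t : R) (f : T3 -> \bar R) :
  measurable_fun [set: T3] f -> (forall x, 0 <= f x)%E ->
  (\int[leb]_x f (flow 1 0 t x) = \int[leb]_x f x)%E.
Proof.
move=> mf f0; have [c0|] := eqVneq (cos (t / 2)) 0; last first.
  by move=> c0; exact: ge0_integral_rot_half.
(* In the exceptional case the rotation is done in two halves: cos(t/2) and cos(t/4) cannot vanish
   together. *)
have c1 : cos (t / 2 / 2) != 0.
  apply/eqP => c1; move: c0; rewrite (_ : t / 2 = t / 2 / 2 + t / 2 / 2); last by field.
  rewrite cosD c1 mul0r sub0r => /eqP; rewrite oppr_eq0 mulf_eq0 orbb => /eqP s1.
  by have := cos2Dsin2 (t / 2 / 2); rewrite c1 s1 expr0n addr0 => /eqP; rewrite eq_sym oner_eq0.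
have E x : flow 1 0 t x = flow 1 0 (t / 2) (flow 1 0 (t / 2) x).
  by rewrite flowD; congr flow; field.
under eq_integral do rewrite E.
have mg : measurable_fun [set: T3] (f \o flow 1 0 (t / 2)).
  exact: (measurableT_comp mf (measurable_flow _ _ _)).
rewrite (@ge0_integral_rot_half (t / 2) (f \o flow 1 0 (t / 2)) c1 mg (fun=> f0 _)).
exact: ge0_integral_rot_half.
Qed.

Lemma ge0_integral_flow (b c t : R) (f : T3 -> \bar R) :
  measurable_fun [set: T3] f -> (forall x, 0 <= f x)%E ->
  (\int[leb]_x f (flow b c t x) = (expR (- (3 * c * t)))%:E * \int[leb]_x f x)%E.
Proof.
move=> mf f0; pose e := expR (c * t).
have E x : flow b c t x = (fun x : T3 => (e * x.1.1, e * x.1.2, e * x.2)) (flow 1 0 (b * t) x).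
  by rewrite /flow/= !mul0r expR0 !mul1r.
under eq_integral do rewrite E.
rewrite (@ge0_integral_rot (b * t) (f \o (fun x : T3 => (e * x.1.1, e * x.1.2, e * x.2)))); last 2 first.
- exact: (measurableT_comp mf (measurable_dilation e)).
- by move=> x; exact: f0.
rewrite /= (ge0_integral_dilation (expR_gt0 _) mf f0).
by congr (_%:E * _)%E; rewrite -expRM_natl -expRN; congr expR; ring.
Qed.

Lemma integrable_flow (b c t : R) (f : T3 -> \bar R) :
  leb.-integrable setT f -> leb.-integrable setT (f \o flow b c t).
Proof.
move=> /integrableP[mf fi]; apply/integrableP; split.
  exact: (measurableT_comp mf (measurable_flow _ _ _)).
have ma : measurable_fun [set: T3] (abse \o f) by exact: measurableT_comp.
rewrite (@ge0_integral_flow b c t (abse \o f) ma (fun=> abse_ge0 _)).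
by rewrite lte_mul_pinfty// lee_fin expR_ge0.
Qed.

Lemma integral_flow (b c t : R) (f : T3 -> \bar R) :
  leb.-integrable setT f ->
  (\int[leb]_x f (flow b c t x) = (expR (- (3 * c * t)))%:E * \int[leb]_x f x)%E.
Proof.
move=> fi; have mf := measurable_int _ fi.
transitivity (\int[leb]_x f^\+ (flow b c t x) - \int[leb]_x f^\- (flow b c t x))%E.
  by rewrite [LHS]integralE; congr (_ - _)%E; apply: eq_integral => x _; rewrite ?funeposE ?funenegE.
rewrite [in RHS]integralE.
rewrite (@ge0_integral_flow b c t (f^\+)%E (measurable_funepos mf) (funepos_ge0 f)).
rewrite (@ge0_integral_flow b c t (f^\-)%E (measurable_funeneg mf) (funeneg_ge0 f)).
rewrite [RHS]muleBr//; apply: fin_num_adde_defl; rewrite fin_numN.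
by have := integrable_neg_fin_num measurableT fi.
Qed.

End flow.

(** * Smooth bumps on the line *)

Section smooth_bump.
Context {R : realType}.

(* The factors [t^-1 ^+ k] make the family closed under differentiation. *)
Definition expbump (k : nat) (t : R) : R :=
  if 0 < t then t^-1 ^+ k * expR (- t^-1) else 0.

Lemma expbump_ge0 k t : 0 <= expbump k t.
Proof.
by rewrite /expbump; case: ifPn => // t0; rewrite mulr_ge0 ?expR_ge0// exprn_ge0// invr_ge0 ltW.
Qed.

(** One term of the exponential series at [t^-1] bounds the bump by a multiple of [t], which settles
    differentiability at the gluing point 0. *)
Lemma expbump_le k t : expbump k t <= (k.+1)`!%:R * `|t|.
Proof.
rewrite /expbump; case: ifPn => t0; last by rewrite mulr_ge0.
have y0 : 0 < t^-1 by rewrite invr_gt0.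
have H : t^-1 ^+ k.+1 / (k.+1)`!%:R <= expR t^-1.
  by apply: le_trans (expR_ge1Dxn k (ltW y0)); rewrite lerDr.
rewrite ler_pdivrMr ?ltr0n ?fact_gt0// in H.
rewrite expRN (gtr0_norm t0) ler_pdivrMr ?expR_gt0//.
have -> : t^-1 ^+ k = t * t^-1 ^+ k.+1 by rewrite exprS mulrA divff ?mul1r ?gt_eqF.
rewrite (mulrC _ t) -mulrA ler_pM2l// mulrC//.
Qed.

Lemma is_derive_expbump k t :
  is_derive t (1 : R) (expbump k) (expbump k.+2 t - k%:R * expbump k.+1 t).
Proof.
have [t0|t0|->] := ltrgtP t 0.
- have -> : expbump k.+2 t - k%:R * expbump k.+1 t = 0.
    by rewrite /expbump (lt_gtF t0) mulr0 subr0.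
  apply: (@near_eq_is_derive _ _ _ (cst 0)).
  near=> s; rewrite /expbump/=; case: ifPn => // s0.
  suff : s < 0 by rewrite ltNge (ltW s0).
  by near: s; exact: lt_nbhsl.
- have dV : is_derive t (1 : R) (fun s : R => s^-1) (- t^-1 ^+ 2).
    apply: DeriveDef; first by apply: derivableV => //; rewrite gt_eqF.
    by rewrite deriveV ?gt_eqF// derive_id -exprVn [_ *: _]mulr1.
  apply: (@near_eq_is_derive _ _ _ ((fun s : R => s^-1) ^+ k * (expR \o (- (fun s : R => s^-1))))).
    near=> s; rewrite /expbump ifT ?exprfctE//=.
    by near: s; exact: lt_nbhsr.
  rewrite /expbump ifT// ifT//.
  apply: is_derive_eq.
  rewrite exprfctE /= -[- (fun s : R => s^-1)]/(fun s : R => - s^-1) /= opprK.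
  rewrite -![_ *: _]/(_ * _).
  by case: k => [|k]; rewrite ?exprS ?expr0/=; ring.
- rewrite /expbump ltxx mulr0 subr0 -/(expbump k).
  have c0 : expbump k.+1 h @[h --> (0 : R)^'] --> (0 : R).
    apply: (@squeeze_cvgr _ _ _ _ (cst 0) (fun h => (k.+2)`!%:R * `|h|)).
    + by apply: nearW => h /=; rewrite expbump_ge0 expbump_le.
    + exact: cvg_cst.
    + rewrite -[X in _ --> X](mulr0 (k.+2)`!%:R).
      apply: cvgMl_tmp; rewrite -[X in _ --> X](normr0 R).
      by apply: cvg_norm; exact: nbhs_dnbhs.
  (* At 0 the difference quotient of a bump is the next bump of the family. *)
  have E : (fun h : R => h^-1 *: (expbump k (h *: (1 : R) + 0) - expbump k 0)) = expbump k.+1.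
    apply/funext => h; rewrite /expbump ltxx subr0 addr0 [h *: _]mulr1.
    by case: ifPn => _; rewrite ?scaler0// exprS -mulrA.
  apply: DeriveDef; first by apply/cvg_ex; exists 0; rewrite E.
  by apply: cvg_lim => //; rewrite E.
Unshelve. all: by end_near. Qed.

Lemma differentiable_expbump k t : differentiable (expbump k) t.
Proof. by apply/derivable1_diffP; case: (is_derive_expbump k t). Qed.

Lemma continuous_expbump k : continuous (expbump k).
Proof. by move=> t; apply: differentiable_continuous; exact: differentiable_expbump. Qed.

Lemma diff_expbump k t h :
  'd (expbump k) t h = h * (expbump k.+2 t - k%:R * expbump k.+1 t).
Proof.
have dt := is_derive_expbump k t.
rewrite deriv1E; last by case: dt.
by rewrite derive1E (@derive_val _ _ _ _ _ _ _ dt).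
Qed.

End smooth_bump.

(** * A syntax of test functions, and shells exhausting the complement of the axis *)

Section test_expressions.
Context {R : realType}.
Let T3 := (R * R * R)%type.

(* Syntax for a class of functions closed under differentiation and under
   composition with the flows; their smoothness follows by iterating
   [tderiv]. *)
Inductive texpr : Type :=
| TConst of R
| TCoord of 'I_3
| TAdd of texpr & texpr
| TMul of texpr & texpr
| TBump of nat & texpr.

Definition coord (i : 'I_3) (x : T3) : R :=
  if (i == 0 :> nat) then x.1.1 else if (i == 1 :> nat) then x.1.2 else x.2.

Fixpoint teval (e : texpr) (x : T3) : R :=
  match e with
  | TConst c => c
  | TCoord i => coord i x
  | TAdd e1 e2 => teval e1 x + teval e2 x
  | TMul e1 e2 => teval e1 x * teval e2 x
  | TBump k e1 => expbump k (teval e1 x)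
  end.

Fixpoint tderiv (v : T3) (e : texpr) : texpr :=
  match e with
  | TConst _ => TConst 0
  | TCoord i => TConst (coord i v)
  | TAdd e1 e2 => TAdd (tderiv v e1) (tderiv v e2)
  | TMul e1 e2 => TAdd (TMul e1 (tderiv v e2)) (TMul e2 (tderiv v e1))
  | TBump k e1 => TMul (tderiv v e1)
      (TAdd (TBump k.+2 e1) (TMul (TConst (- k%:R)) (TBump k.+1 e1)))
  end.

Fixpoint tsubst (l : 'I_3 -> texpr) (e : texpr) : texpr :=
  match e with
  | TConst c => TConst c
  | TCoord i => l i
  | TAdd e1 e2 => TAdd (tsubst l e1) (tsubst l e2)
  | TMul e1 e2 => TMul (tsubst l e1) (tsubst l e2)
  | TBump k e1 => TBump k (tsubst l e1)
  end.

Lemma teval_subst l e (f : T3 -> T3) :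
  (forall i x, teval (l i) x = coord i (f x)) ->
  forall x, teval (tsubst l e) x = teval e (f x).
Proof.
move=> H x; elim: e => //= [e1 -> e2 -> //|e1 -> e2 -> //|k e -> //].
Qed.

Lemma coord_linear i : linear (coord i : T3 -> R^o).
Proof. by move=> a x y; rewrite /coord; case: ifP => _ //; case: ifP => _. Qed.

HB.instance Definition _ i := GRing.isLinear.Build R T3 R^o _ (coord i) (coord_linear i).

Lemma continuous_coord i : continuous (coord i).
Proof.
move=> x; case: i => [[|[|[|//]]]] hi.
- apply: (@continuous_comp _ _ _ fst fst); exact: cvg_fst.
- apply: (@continuous_comp _ _ _ fst snd); [exact: cvg_fst|exact: cvg_snd].
- exact: cvg_snd.
Qed.

Lemma differentiable_coord3 i x : differentiable (coord i : T3 -> R) x.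
Proof. apply: (@linear_differentiable _ _ _ (coord i)); exact: continuous_coord. Qed.

Lemma diff_coord3 i x : 'd (coord i : T3 -> R) x = coord i :> (T3 -> R).
Proof. apply: (@diff_lin _ _ _ (coord i)); exact: continuous_coord. Qed.

Lemma differentiable_teval e x : differentiable (teval e) x.
Proof.
elim: e => [c|i|e1 H1 e2 H2|e1 H1 e2 H2|k e H] /=.
- exact: differentiable_cst.
- exact: differentiable_coord3.
- exact: differentiableD.
- exact: differentiableM.
- apply: (@differentiable_comp _ _ _ _ (teval e) (expbump k)) => //.
  exact: differentiable_expbump.
Qed.

Lemma diff_teval e x v : 'd (teval e) x v = teval (tderiv v e) x.
Proof.
elim: e => [c|i|e1 H1 e2 H2|e1 H1 e2 H2|k e H] /=.
- by have /(congr1 (@^~ v)) := diff_cst c x.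
- by have /(congr1 (@^~ v)) := diff_coord3 i x.
- rewrite -H1 -H2.
  by have /(congr1 (@^~ v)) := diffD (differentiable_teval e1 x) (differentiable_teval e2 x).
- rewrite -H1 -H2.
  by have /(congr1 (@^~ v)) := diffM (differentiable_teval e1 x) (differentiable_teval e2 x).
- have /(congr1 (@^~ v)) := diff_comp (differentiable_teval e x) (differentiable_expbump k (teval e x)).
  by move=> E; rewrite [LHS]E /= diff_expbump H mulNr.
Qed.

Lemma continuous_teval e : continuous (teval e).
Proof. by move=> x; apply: differentiable_continuous; exact: differentiable_teval. Qed.

Lemma partial_teval j e : partial j (teval e) = teval (tderiv (ej j) e).
Proof.
apply/funext => x; rewrite /partial deriveE; last exact: differentiable_teval.
exact: diff_teval.
Qed.

Lemma smooth3_teval e : smooth3 (teval e).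
Proof.
move=> js.
have [e' ->] : exists e', iter_partial js (teval e) = teval e'.
  elim: js => [|j js [e' H]]; first by exists e.
  by exists (tderiv (ej j) e'); rewrite /= -/(iter_partial js _) H partial_teval.
split; first exact: continuous_teval.
by move=> j x; apply: diff_derivable; exact: differentiable_teval.
Qed.

(** The flow differentiates along its field, while the weak gradient is tested against coordinate
    partials; linearity in the direction links the two. *)
Lemma tderivE v e x :
  teval (tderiv v e) x = \sum_(j < 3) coord j v * teval (tderiv (ej j) e) x.
Proof.
rewrite !big_ord_recl big_ord0 addr0.
elim: e => [c|i|e1 H1 e2 H2|e1 H1 e2 H2|k e H] /=.
- by ring.
- by case: i => [[|[|[|//]]]] hi; rewrite /coord/=; ring.
- by rewrite H1 H2 /=; ring.
- by rewrite H1 H2 /=; ring.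
- by rewrite H /=; ring.
Qed.

Lemma measurable_coord i : measurable_fun [set: T3] (coord i).
Proof. by case: i => [[|[|[|//]]]] hi; rewrite /coord//=; exact: measurableT_comp. Qed.

Lemma measurable_teval e : measurable_fun [set: T3] (teval e).
Proof.
elim: e => [c|i|e1 H1 e2 H2|e1 H1 e2 H2|k e H] /=.
- exact: measurable_cst.
- exact: measurable_coord.
- exact: measurable_funD.
- exact: measurable_funM.
- apply: (@measurableT_comp _ _ _ _ _ _ (expbump k)) => //.
  by apply: continuous_measurable_fun; exact: continuous_expbump.
Qed.

(** For d > 0 the shells exhaust [Omega] by compact sets. They are cut out by [rho2] and [norm2]
    because the flows act on these two quantities by scalars, hence carry shells into shells. *)
Definition shell (d M : R) : set T3 := [set x | d <= rho2 x /\ norm2 x <= M].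

Let trho2 := TAdd (TMul (TCoord 0) (TCoord 0)) (TMul (TCoord 1) (TCoord 1)).
Let tnorm2 := TAdd trho2 (TMul (TCoord 2) (TCoord 2)).

Lemma shell_Omega d M : 0 < d -> shell d M `<=` Omega.
Proof. by move=> d0 x [dx _]; rewrite /Omega/= gt_eqF// (lt_le_trans d0). Qed.

Lemma measurable_rho2 : measurable_fun [set: T3] (@rho2 R).
Proof. exact: (measurable_teval trho2). Qed.

Lemma measurable_norm2 : measurable_fun [set: T3] (@norm2 R).
Proof. exact: (measurable_teval tnorm2). Qed.

Lemma compact_shell d M : compact (shell d M).
Proof.
pose r := M + 1.
apply: (@subclosed_compact _ _ ((`[- r, r] `*` `[- r, r]) `*` `[- r, r])).
- have -> : shell d M = teval trho2 @^-1` [set y | d <= y] `&` teval tnorm2 @^-1` [set y | y <= M].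
    by apply/seteqP; split.
  apply: closedI; apply: preimage_closed.
  + by move=> x _; exact: continuous_teval.
  + exact: closed_ge.
  + by move=> x _; exact: continuous_teval.
  + exact: closed_le.
- by do 2?apply: compact_setX; exact: segment_compact.
- move=> [[y1 y2] y3] []; rewrite /norm2 /rho2 /x1 /x2 /x3/= => _ H.
  have B y : y ^+ 2 <= M -> y \in `[- r, r].
    by move=> yM; rewrite in_itv/=; apply/andP; split; rewrite /r; nra.
  by split; first split; apply: B; nra.
Qed.

Lemma testfun3_teval e d M : 0 < d ->
  (forall x, ~ shell d M x -> teval e x = 0) -> testfun3 (teval e).
Proof.
move=> d0 H; split; first exact: smooth3_teval.
by exists (shell d M); split => //; [exact: compact_shell|exact: shell_Omega].
Qed.

Lemma teval_bounded e d M : (forall x, ~ shell d M x -> teval e x = 0) ->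
  exists2 B, 0 <= B & forall x, `|teval e x| <= B.
Proof.
move=> H.
have cb : compact (teval e @` shell d M).
  apply: continuous_compact; last exact: compact_shell.
  by apply: continuous_subspaceT => x; exact: continuous_teval.
have /ex_strict_bound_gt0[B B0 /= HB] : bounded_set (teval e @` shell d M).
  exact: compact_bounded.
exists B => [|x]; first exact: ltW.
have [xs|xs] := pselect (shell d M x); last by rewrite H ?normr0// ltW.
by apply/ltW/HB; exists x.
Qed.

Lemma tderiv_support v e d M : (forall x, ~ shell d M x -> teval e x = 0) ->
  (forall x, ~ shell d M x -> teval (tderiv v e) x = 0).
Proof.
move=> H x nx; rewrite -diff_teval -deriveE; last exact: differentiable_teval.
have op : open (~` shell d M).
  by apply: closed_openC; apply: compact_closed; [exact: norm_hausdorff|exact: compact_shell].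
rewrite (@near_eq_derive _ _ _ _ (cst 0)) ?derive_cst//.
by apply: filterS (open_nbhs_nbhs (conj op nx)) => y /H.
Qed.

End test_expressions.

(** * The du Bois-Reymond lemma: orthants and a Dynkin argument *)

Section du_bois_reymond.
Context {R : realType}.
Local Notation leb := (lebesgue3 R).
Let T3 := (R * R * R)%type.

Lemma expbump0_le1 (t : R) : expbump 0 t <= 1.
Proof.
rewrite /expbump; case: ifPn => // t0.
by rewrite expr0 mul1r -expR0 ler_expR oppr_le0 invr_ge0 ltW.
Qed.

(** This makes indicators of open half-lines pointwise limits of test expressions. *)
Lemma expbump0_cvg (s : R) :
  expbump 0 (n.+1%:R * s) @[n --> \oo] --> ((0 < s)%R%:R : R).
Proof.
case: (ltP 0 s) => s0.
  have -> : (fun n => expbump 0 (n.+1%:R * s)) = (fun n => expR (- (s^-1 * harmonic n))).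
    apply/funext => n; rewrite /expbump mulr_gt0 ?ltr0n// expr0 mul1r /harmonic.
    by rewrite invfM mulrC.
  rewrite -[X in _ --> X]expR0 -[X in expR X]oppr0 -(mulr0 s^-1).
  apply: (@cvg_comp _ _ _ (fun n => - (s^-1 * harmonic n)) expR); last exact: continuous_expR.
  by apply: cvgN; apply: cvgMl_tmp; exact: cvg_harmonic.
rewrite (_ : (fun n => _) = cst 0); first exact: cvg_cst.
by apply/funext => n; rewrite /expbump ifF//=; apply/negbTE; rewrite -leNgt pmulr_rle0.
Qed.

(** Orthants form a pi-system that generates the measurable sets, and their indicators are limits of
    products of three bumps. *)
Definition orthant (a : T3) : set T3 :=
  [set x | [/\ x.1.1 < a.1.1, x.1.2 < a.1.2 & x.2 < a.2]].

Lemma measurable_orthant a : measurable (orthant a).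
Proof.
have -> : orthant a = (`]-oo, a.1.1[%classic `*` `]-oo, a.1.2[%classic) `*` `]-oo, a.2[%classic.
  by apply/seteqP; split => [x [? ? ?]|x [[? ?] ?]]; split => //; rewrite /= ?in_itv.
by apply: measurableX => //; exact: measurableX.
Qed.

Lemma orthant_setI : setI_closed (range orthant).
Proof.
move=> _ _ [a _ <-] [b _ <-].
exists (Num.min a.1.1 b.1.1, Num.min a.1.2 b.1.2, Num.min a.2 b.2) => //.
apply/seteqP; split => x; rewrite /orthant/= !lt_min.
  by move=> [/andP[-> ->] /andP[-> ->] /andP[-> ->]].
by move=> [[-> -> ->] [-> -> ->]].
Qed.

(** Each coordinate is measurable for the sigma-algebra generated by the orthants, a half-space
    being the union of the orthants whose other two bounds run through the integers. The identity
    into R^3 is then measurable too, which is the nontrivial inclusion. *)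
Lemma measurable_orthantE : (@measurable _ T3) = <<s range orthant >>.
Proof.
apply/seteqP; split; last first.
  apply: smallest_sub; first exact: sigma_algebra_measurable.
  by move=> _ [a _ <-]; exact: measurable_orthant.
pose S : measurableType _ := g_sigma_algebraType (range orthant).
have mc (f : S -> R) :
    (forall r, exists a : nat -> T3, f @^-1` `]-oo, r[ = \bigcup_n orthant (a n)) ->
    measurable_fun [set: S] f.
  move=> H; apply: (measurability _ (RGenInftyO.measurableE R)) => _ [_ [r ->] <-].
  rewrite setTI; have [a ->] := H r.
  by apply: bigcup_measurable => n _; apply: sub_sigma_algebra; exists (a n).
pose N (x : T3) := (Num.truncn (`|x.1.1| + `|x.1.2| + `|x.2|)).+1.
have N1 x : x.1.1 < (N x)%:R.
  by apply: le_lt_trans (truncnS_gt _); rewrite -addrA (le_trans (ler_norm _))// lerDl addr_ge0.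
have N2 x : x.1.2 < (N x)%:R.
  by apply: le_lt_trans (truncnS_gt _); rewrite addrAC (le_trans (ler_norm _))// lerDr addr_ge0.
have N3 x : x.2 < (N x)%:R.
  by apply: le_lt_trans (truncnS_gt _); rewrite (le_trans (ler_norm _))// lerDr addr_ge0.
have m1 : measurable_fun [set: S] (fun x : T3 => x.1.1).
  apply: mc => r; exists (fun n => (r, n%:R, n%:R)).
  apply/seteqP; split => [x|x [n _ [? ? ?]]]; rewrite /= in_itv//= => xr.
  by exists (N x) => //; split.
have m2 : measurable_fun [set: S] (fun x : T3 => x.1.2).
  apply: mc => r; exists (fun n => (n%:R, r, n%:R)).
  apply/seteqP; split => [x|x [n _ [? ? ?]]]; rewrite /= in_itv//= => xr.
  by exists (N x) => //; split.
have m3 : measurable_fun [set: S] (fun x : T3 => x.2).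
  apply: mc => r; exists (fun n => (n%:R, n%:R, r)).
  apply/seteqP; split => [x|x [n _ [? ? ?]]]; rewrite /= in_itv//= => xr.
  by exists (N x) => //; split.
have mid : measurable_fun [set: S] (fun x : T3 => (x.1.1, x.1.2, x.2)).
  by do 2?apply: measurable_fun_pair.
move=> A mA; have := mid measurableT A mA; rewrite setTI.
by rewrite (_ : (fun x : T3 => _) @^-1` A = A)//; apply/seteqP; split => -[[? ?] ?].
Qed.

(** The sets over which the integral of [F] vanishes form a Dynkin system; the vanishing of the
    total integral is what gives complements. *)
Lemma orthant_ae_eq0 (F : T3 -> R) : leb.-integrable setT (EFin \o F) ->
  (\int[leb]_x (F x)%:E = 0)%E ->
  (forall a, \int[leb]_(x in orthant a) (F x)%:E = 0)%E ->
  {ae leb, forall x, F x = 0}.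
Proof.
move=> iF F0 FO; have mF := measurable_int _ iF.
have H S : measurable S -> (\int[leb]_(x in S) (F x)%:E = 0)%E.
  move=> mS; have {mS} : <<s range orthant >> S by rewrite -measurable_orthantE.
  move: S; apply: (@dynkin_induction _ _ (range orthant)
    (fun S => \int[leb]_(x in S) (F x)%:E = 0)%E) => //.
  - exact: measurable_orthantE.
  - exact: orthant_setI.
  - by move=> _ [a _ <-].
  - move=> S mS S0.
    have : (\int[leb]_(x in S `|` ~` S) (F x)%:E = 0)%E by rewrite setUv.
    rewrite integral_setU//; last 3 first.
    + exact: measurableC.
    + by rewrite setUv.
    + by apply/disj_setPS => x [].
    by rewrite S0 add0e.
  - move=> G mG tG G0; rewrite integral_bigcup//.
      by rewrite eseries0// => n _ _; rewrite G0.
    by apply: integrableS iF => //; apply: bigcup_measurable => k _; exact: mG.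
have : ae_eq leb setT (EFin \o F) (cst 0%E).
  apply: integral_ae_eq => // E _ mE.
  by rewrite H// integral0.
by apply: filterS => x /(_ I) /= [].
Qed.

End du_bois_reymond.

Section almost_everywhere.
Context d (T : measurableType d) (R : realType) (m : {measure set T -> \bar R}).

Lemma ae_imply (P Q : T -> Prop) : (forall x, P x -> Q x) ->
  {ae m, forall x, P x} -> {ae m, forall x, Q x}.
Proof. by move=> H; apply: filterS. Qed.

Lemma ae_imply2 (P Q S : T -> Prop) : (forall x, P x -> Q x -> S x) ->
  {ae m, forall x, P x} -> {ae m, forall x, Q x} -> {ae m, forall x, S x}.
Proof. by move=> H; apply: filterS2. Qed.

End almost_everywhere.

(** * The du Bois-Reymond lemma away from the axis *)

Section du_bois_reymond_Omega.
Context {R : realType}.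
Local Notation mu := (@lebesgue_measure R).
Local Notation leb := (lebesgue3 R).
Let T3 := (R * R * R)%type.

Lemma measurable_Omega : measurable (@Omega R).
Proof.
have -> : @Omega R = @rho2 R @^-1` (~` [set 0]).
  by apply/seteqP; split => x; rewrite /Omega/= => /eqP.
rewrite -[X in measurable X]setTI; apply: measurable_rho2 => //.
exact: measurableC.
Qed.

(** A line in the first coordinate direction meets the axis in at most one point. *)
Lemma ae_Omega : {ae leb, forall x, Omega x}.
Proof.
have mN : measurable (~` @Omega R) by apply: measurableC; exact: measurable_Omega.
exists (~` Omega); split => //.
rewrite -[X in leb X]setIT -integral_indic//.
rewrite ge0_integral_leb3E; first last.
- by move=> x; rewrite lee_fin.
- apply/measurable_EFinP; apply: measurable_indic; exact: mN.
apply: integral0_eq => z _; apply: integral0_eq => y _.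
apply/eqP; rewrite eq_le integral_ge0 ?andbT; last by move=> x _; rewrite lee_fin.
apply: (@le_trans _ _ (\int[mu]_x (\1_[set (0:R)] x)%:E)%E).
  apply: ge0_le_integral => //.
  - apply: (@measurable_pair2 _ (fun x => (\1_(~` Omega) x)%:E)).
    apply/measurable_EFinP; apply: measurable_indic; exact: mN.
  - by apply/measurable_EFinP; exact: measurable_indic.
  - move=> x _; rewrite lee_fin !indicE ler_nat.
    case: (boolP (_ \in ~` _)) => //; rewrite inE/= /Omega/= => /negP; rewrite negbK.
    rewrite /rho2/x1/x2/= paddr_eq0 ?sqr_ge0// sqrf_eq0 => /andP[/eqP -> _].
    by rewrite mem_set.
by rewrite integral_indic// setIT [leLHS]lebesgue_measure_set1.
Qed.

Let ttrho2 : @texpr R := TAdd (TMul (TCoord 0) (TCoord 0)) (TMul (TCoord 1) (TCoord 1)).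
Let ttnorm2 := TAdd ttrho2 (TMul (TCoord 2) (TCoord 2)).

(** Each cutoff vanishes off a shell, and the cutoffs have no common zero in [Omega]: multiplication
    by them makes a locally integrable function globally integrable without losing information. *)
Definition cutoff (n : nat) : @texpr R :=
  TMul (TBump 0 (TAdd ttrho2 (TConst (- n.+1%:R^-1))))
       (TBump 0 (TAdd (TConst n.+1%:R) (TMul (TConst (-1)) ttnorm2))).

Lemma cutoffE n x : teval (cutoff n) x =
  expbump 0 (rho2 x - n.+1%:R^-1) * expbump 0 (n.+1%:R - norm2 x).
Proof. by rewrite /= mulN1r. Qed.

Lemma expbump_gt0 k (t : R) : (0 < expbump k t) = (0 < t).
Proof.
rewrite /expbump; have [t0|t0] := ltP 0 t; last by rewrite ltxx.
by rewrite mulr_gt0 ?expR_gt0// exprn_gt0// invr_gt0.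
Qed.

Lemma cutoff_shell n x : ~ shell n.+1%:R^-1 n.+1%:R x -> teval (cutoff n) x = 0.
Proof.
move=> nx; rewrite cutoffE /expbump.
case: ifPn; rewrite ?mul0r// subr_gt0 => r0.
case: ifPn; rewrite ?mulr0// subr_gt0 => n0.
by exfalso; apply: nx; split; exact: ltW.
Qed.

Lemma cutoff_neq0 x : Omega x -> exists n, teval (cutoff n) x != 0.
Proof.
move=> Ox; have r0 : 0 < rho2 x.
  by rewrite lt_neqAle eq_sym Ox /rho2 addr_ge0 ?sqr_ge0.
pose n := maxn (Num.truncn (rho2 x)^-1) (Num.truncn (norm2 x)).
exists n; rewrite cutoffE gt_eqF// mulr_gt0 ?expbump_gt0// subr_gt0.
  rewrite invf_plt ?posrE//; apply: lt_le_trans (truncnS_gt _) _.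
  by rewrite ler_nat ltnS leq_maxl.
apply: lt_le_trans (truncnS_gt _) _.
by rewrite ler_nat ltnS leq_maxr.
Qed.

Let tlt (k : nat) (i : 'I_3) (r : R) : @texpr R :=
  TBump 0 (TMul (TConst k.+1%:R) (TAdd (TConst r) (TMul (TConst (-1)) (TCoord i)))).

(** A smooth approximation of the indicator of [orthant a] as [k] grows. *)
Let torth (k : nat) (a : T3) : @texpr R :=
  TMul (TMul (tlt k 0 a.1.1) (tlt k 1 a.1.2)) (tlt k 2 a.2).

Let torthE k a x : teval (torth k a) x =
  expbump 0 (k.+1%:R * (a.1.1 - x.1.1)) * expbump 0 (k.+1%:R * (a.1.2 - x.1.2)) *
  expbump 0 (k.+1%:R * (a.2 - x.2)).
Proof. by rewrite /= !mulN1r. Qed.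

Let torth_cvg a x : teval (torth k a) x @[k --> \oo] --> (\1_(orthant a) x : R).
Proof.
under eq_fun do rewrite torthE.
have -> : \1_(orthant a) x = (0 < a.1.1 - x.1.1)%R%:R * (0 < a.1.2 - x.1.2)%R%:R * (0 < a.2 - x.2)%R%:R :> R.
  rewrite indicE !subr_gt0 -!natrM !mulnb; congr (_%:R); congr nat_of_bool.
  apply/idP/idP; rewrite inE /orthant/=.
    by move=> [-> -> ->].
  by move=> /andP[/andP[-> ->] ->].
by apply: cvgM; [apply: cvgM|]; exact: expbump0_cvg.
Qed.

Let torth_bound k a x : `|teval (torth k a) x| <= 1.
Proof.
rewrite torthE !normrM -[leRHS]mulr1 -[X in X * 1]mulr1.
have B (t : R) : `|expbump 0 t| <= 1 by rewrite ger0_norm ?expbump_ge0// expbump0_le1.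
by rewrite !ler_pM.
Qed.

Lemma integrable_shellM (D : T3 -> R) (e : texpr) d M :
  measurable_fun [set: T3] D -> leb.-integrable (shell d M) (EFin \o D) ->
  (forall x, ~ shell d M x -> teval e x = 0) ->
  leb.-integrable setT (fun x => (D x * teval e x)%:E).
Proof.
move=> mD iD e0; have [B B0 HB] := teval_bounded e0.
have mS : measurable (shell d M).
  have -> : shell d M = @rho2 R @^-1` `[d, +oo[ `&` @norm2 R @^-1` `]-oo, M].
    by apply/seteqP; split => x; rewrite /shell/= !in_itv/= andbT.
  by apply: measurableI; rewrite -[X in measurable X]setTI;
    [apply: measurable_rho2|apply: measurable_norm2].
have iB : leb.-integrable (shell d M) (fun x => (B * D x)%:E).
  by under eq_fun do rewrite EFinM; exact: integrableZl.
move/(@integrable_mkcond _ _ _ leb _ _ mS) in iB.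
apply: le_integrable iB => //.
  by apply/measurable_EFinP; apply: measurable_funM => //; exact: measurable_teval.
move=> x _; rewrite patchE; case: ifPn => [xs|].
  by rewrite !abse_EFin lee_fin !normrM mulrC ler_wpM2r// (ger0_norm B0).
by move=> /negP; rewrite inE => xs; rewrite e0// mulr0.
Qed.

(** The approximate orthants [torth] are not supported in a shell, but their products with a cutoff
    are, so the hypothesis applies to these. Dominated convergence in [k] then shows that [D] times
    the cutoff has integral zero over every orthant. *)
Lemma du_bois_reymond (D : T3 -> R) : measurable_fun [set: T3] D ->
  (forall d M, 0 < d -> leb.-integrable (shell d M) (EFin \o D)) ->
  (forall e d M, 0 < d -> (forall x, ~ shell d M x -> teval e x = 0) ->
    (\int[leb]_x (D x * teval e x)%:E = 0)%E) ->
  {ae leb, forall x, D x = 0}.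
Proof.
move=> mD iD D0.
have n0 n : 0 < n.+1%:R^-1 :> R by rewrite invr_gt0 ltr0n.
have H n : {ae leb, forall x, D x * teval (cutoff n) x = 0}.
  have iF : leb.-integrable setT (fun x => (D x * teval (cutoff n) x)%:E).
    by apply: integrable_shellM (iD _ _ (n0 n)) _ => //; exact: cutoff_shell.
  apply: orthant_ae_eq0 => // [|a].
    by apply: D0 (n0 n) _; exact: cutoff_shell.
  have mF := measurable_int _ iF.
  have I0 k : (\int[leb]_x (D x * teval (cutoff n) x * teval (torth k a) x)%:E = 0)%E.
    under eq_integral do rewrite -mulrA.
    apply: (D0 (TMul (cutoff n) (torth k a)) _ _ (n0 n)) => x /cutoff_shell xs.
    by rewrite [LHS]/= [X in X * _]xs mul0r.
  have [| | | | |_ _] := @dominated_convergence _ _ _ leb setT measurableT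
    (fun k x => (D x * teval (cutoff n) x * teval (torth k a) x)%:E)
    (fun x => (D x * teval (cutoff n) x * \1_(orthant a) x)%:E)
    (fun x => `|(D x * teval (cutoff n) x)%:E|)%E.
  - by move=> k; apply/measurable_EFinP; apply: measurable_funM; [exact/measurable_EFinP|exact: measurable_teval].
  - apply/measurable_EFinP; apply: measurable_funM; first exact/measurable_EFinP.
    by apply: measurable_indic; exact: measurable_orthant.
  - apply: aeW => x _; apply: cvg_EFin; first exact: nearW.
    by apply: cvgMl_tmp; exact: torth_cvg.
  - exact: integrable_abse.
  - apply: aeW => x k _; rewrite !abse_EFin lee_fin normrM -[leRHS]mulr1.
    by rewrite ler_wpM2l//; exact: torth_bound.
  rewrite (_ : (fun k => _) = cst 0%E); last by apply/funext => k; exact: I0.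
  move=> /cvg_lim; rewrite lim_cst// => /(_ (@ereal_hausdorff R)) E.
  transitivity (\int[leb]_x (D x * teval (cutoff n) x * \1_(orthant a) x)%:E)%E; last exact/esym/E.
  rewrite integral_mkcond; apply: eq_integral => x _; rewrite patchE indicE.
  by case: ifPn => _; rewrite ?mulr1 ?mulr0.
have /ae_foralln HH : forall n, {ae leb, forall x, D x * teval (cutoff n) x = 0} by [].
apply: (ae_imply2 _ ae_Omega HH) => x Ox {}HH.
have [n n1] := cutoff_neq0 Ox.
by move: (HH n) => /eqP; rewrite mulf_eq0 (negbTE n1) orbF => /eqP.
Qed.

End du_bois_reymond_Omega.

Section parametric_integrals.
Context d1 d2 (T1 : measurableType d1) (T2 : measurableType d2) (R : realType).
Variable m2 : {sigma_finite_measure set T2 -> \bar R}.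

Lemma measurable_fun_integral_pair (f : T1 * T2 -> \bar R) :
  measurable_fun setT f -> measurable_fun setT (fun x => \int[m2]_y f (x, y))%E.
Proof.
move=> mf.
rewrite (_ : (fun x => _) = (fun x => \int[m2]_y (f^\+)%E (x, y) - \int[m2]_y (f^\-)%E (x, y))%E).
  apply: emeasurable_funB.
  - apply: (measurable_fun_fubini_tonelli_F (m2 := m2) f^\+%E) => //.
    exact: measurable_funepos.
  - apply: (measurable_fun_fubini_tonelli_F (m2 := m2) f^\-%E) => //.
    exact: measurable_funeneg.
by apply/funext => x; rewrite integralE; congr (_ - _)%E; apply: eq_integral => y _;
  rewrite ?funeposE ?funenegE.
Qed.

End parametric_integrals.

Section indicator_integrals.
Context d (T : measurableType d) (R : realType) (m : {measure set T -> \bar R}).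

Lemma integral_indicM (A : set T) (f : T -> R) :
  (\int[m]_x (\1_A x * f x)%:E = \int[m]_(x in A) (f x)%:E)%E.
Proof.
rewrite [RHS]integral_mkcond; apply: eq_integral => x _; rewrite patchE indicE.
by case: ifPn => _; rewrite ?mul1r ?mul0r.
Qed.

Lemma integrable_indicM (A : set T) (f : T -> R) : measurable A ->
  m.-integrable setT (fun x => (\1_A x * f x)%:E) <->
  m.-integrable A (fun x => (f x)%:E).
Proof.
move=> mA.
have -> : (fun x => (\1_A x * f x)%:E) = (fun x => (f x)%:E) \_ A.
  apply/funext => x; rewrite patchE indicE.
  by case: ifPn => _; rewrite ?mul1r ?mul0r.
by apply: iff_sym; exact: integrable_mkcond.
Qed.

End indicator_integrals.

(** * The vector field generating the flow, and the chain rule *)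

Section flow_field.
Context {R : realType}.
Let T3 := (R * R * R)%type.
Variables (b c : R).

(** The generator of the flow. Its divergence is the constant [3 * c], the origin of this factor in
    all the formulas below. *)
Definition field (x : T3) : T3 :=
  (c * x.1.1 - b * x.1.2, b * x.1.1 + c * x.1.2, c * x.2).

Definition tfield (i : 'I_3) : @texpr R :=
  if (i == 0 :> nat) then TAdd (TMul (TConst c) (TCoord 0)) (TMul (TConst (- b)) (TCoord 1))
  else if (i == 1 :> nat) then TAdd (TMul (TConst b) (TCoord 0)) (TMul (TConst c) (TCoord 1))
  else TMul (TConst c) (TCoord 2).

Lemma teval_field i x : teval (tfield i) x = coord i (field x).
Proof. by case: i => [[|[|[|//]]]] hi; rewrite /coord/= ?mulNr. Qed.

Definition tflow (t : R) (i : 'I_3) : @texpr R :=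
  let e := TConst (expR (c * t)) in
  let C := TConst (cos (b * t)) in let S := TConst (sin (b * t)) in
  if (i == 0 :> nat) then TMul e (TAdd (TMul C (TCoord 0)) (TMul (TConst (- sin (b * t))) (TCoord 1)))
  else if (i == 1 :> nat) then TMul e (TAdd (TMul S (TCoord 0)) (TMul C (TCoord 1)))
  else TMul e (TCoord 2).

Lemma teval_flow t i x : teval (tflow t i) x = coord i (flow b c t x).
Proof. by case: i => [[|[|[|//]]]] hi; rewrite /coord/= ?mulNr. Qed.

Lemma tderiv_flow t i v x : teval (tderiv v (tflow t i)) x = coord i (flow b c t v).
Proof. by case: i => [[|[|[|//]]]] hi; rewrite /coord/=; ring. Qed.

(** The chain rule: the flow is linear, hence its own differential. *)
Lemma tderiv_subst_flow t e v x :
  teval (tderiv v (tsubst (tflow t) e)) x =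
  teval (tderiv (flow b c t v) e) (flow b c t x).
Proof.
have E e' : teval (tsubst (tflow t) e') x = teval e' (flow b c t x).
  exact: (teval_subst _ (teval_flow t)).
elim: e => [r//|i|e1 H1 e2 H2|e1 H1 e2 H2|k e H].
- exact: tderiv_flow.
- by rewrite [LHS]/= H1 H2.
- by rewrite [LHS]/= !E H1 H2.
- by rewrite [LHS]/= H !E.
Qed.

Lemma field_flow t x : field (flow b c t x) = flow b c t (field x).
Proof. by rewrite /field /flow/=; congr (_, _, _); ring. Qed.

Lemma is_derive_flow t i x :
  is_derive t (1 : R) (fun s => coord i (flow b c s x)) (coord i (field (flow b c t x))).
Proof.
pose E := expR \o (fun s => c * s).
pose C := cos \o (fun s => b * s); pose S := sin \o (fun s => b * s).
case: i => [[|[|[|//]]]] hi; rewrite /coord/=.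
- rewrite -[X in is_derive _ _ X _]/(E * (C * cst x.1.1 - S * cst x.1.2)).
  apply: is_derive_eq; rewrite /E /C /S /= -![_ *: _]/(_ * _) /=.
  by rewrite -[(_ - _) t]/(cos (b * t) * x.1.1 - sin (b * t) * x.1.2); ring.
- rewrite -[X in is_derive _ _ X _]/(E * (S * cst x.1.1 + C * cst x.1.2)).
  apply: is_derive_eq; rewrite /E /C /S /= -![_ *: _]/(_ * _) /=.
  by rewrite -[(_ + _) t]/(sin (b * t) * x.1.1 + cos (b * t) * x.1.2); ring.
- rewrite -[X in is_derive _ _ X _]/(E * cst x.2).
  by apply: is_derive_eq; rewrite /E /C /S /= -![_ *: _]/(_ * _) /=; ring.
Qed.

Lemma is_derive_teval_curve e (g : R -> T3) (v : T3) t :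
  (forall i, is_derive t (1 : R) (fun s => coord i (g s)) (coord i v)) ->
  is_derive t (1 : R) (fun s => teval e (g s)) (teval (tderiv v e) (g t)).
Proof.
move=> H; elim: e => [r|i|e1 H1 e2 H2|e1 H1 e2 H2|k e He] /=.
- exact: is_derive_cst.
- exact: H.
- exact: is_deriveD.
- rewrite -[X in is_derive _ _ X _]/((fun s => teval e1 (g s)) * (fun s => teval e2 (g s))).
  by apply: is_derive_eq; rewrite -![_ *: _]/(_ * _).
- rewrite -[X in is_derive _ _ X _]/(expbump k \o (fun s => teval e (g s))).
  have D := @is_derive1_comp _ (expbump k) (fun s => teval e (g s)) t _ _ (is_derive_expbump _ _) He.
  by apply: is_derive_eq; rewrite mulNr mulrC.
Qed.

End flow_field.

(** * Integrability along the flow *)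

Section flow_integrals.
Context {R : realType}.
Local Notation mu := (@lebesgue_measure R).
Local Notation leb := (lebesgue3 R).
Let T3 := (R * R * R)%type.
Variables (b c : R).
Hypothesis c0 : 0 <= c.

Lemma measurable_shell (d M : R) : measurable (shell d M).
Proof.
have -> : shell d M = @rho2 R @^-1` `[d, +oo[ `&` @norm2 R @^-1` `]-oo, M].
  by apply/seteqP; split => x; rewrite /shell/= !in_itv/= andbT.
by apply: measurableI; rewrite -[X in measurable X]setTI;
  [apply: measurable_rho2|apply: measurable_norm2].
Qed.

(** For c >= 0 the forward flow never decreases [rho2], so the inner bound [d] survives and only the
    outer bound grows, uniformly for t <= s. The absolute value keeps that bound monotone in the
    exponential factor whatever the sign of [M]. *)
Lemma shell_flow d M s t y : 0 <= t <= s ->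
  shell d M (flow b c (- t) y) -> shell d (expR (c * s) ^+ 2 * `|M|) y.
Proof.
move=> /andP[t0 ts]; rewrite /shell/= rho2_flow norm2_flow.
have rho0 : 0 <= rho2 y by rewrite /rho2 addr_ge0// sqr_ge0.
have e1 : expR (c * - t) ^+ 2 <= 1.
  by rewrite exprn_ile1 ?expR_ge0// -expR0 ler_expR mulrN oppr_le0 mulr_ge0.
move=> [h1 h2]; split; first by apply: (le_trans h1); rewrite ler_piMl.
have := le_trans h2 (ler_norm M); rewrite mulrN expRN exprVn.
rewrite ler_pdivrMl ?exprn_gt0 ?expR_gt0// => /le_trans; apply.
rewrite ler_wpM2r// lerXn2r ?nnegrE ?expR_ge0// ler_expR.
exact: ler_wpM2l.
Qed.

Lemma measurable_flow2r : measurable_fun [set: T3 * R] (fun p : T3 * R => flow b c p.2 p.1).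
Proof.
have mp : measurable_fun [set: T3 * R] (fun p : T3 * R => (p.2, p.1)).
  exact: measurable_fun_pair.
exact: (measurableT_comp (measurable_flow2 b c) mp).
Qed.

(** At each time t in [0, s] the change of variables costs a factor at most 1 and moves the shell
    into a fixed larger one, so the double integral of the absolute value is at most s times the
    integral of |w| over that shell. *)
Lemma integrable_flow_shell (w : T3 -> R) d M s : 0 < d -> 0 <= s ->
  measurable_fun [set: T3] w ->
  (forall M, leb.-integrable (shell d M) (EFin \o w)) ->
  (product_sf leb mu).-integrable setT
    (fun p => (\1_`[0, s] p.2 * (\1_(shell d M) p.1 * w (flow b c p.2 p.1)))%:E).
Proof.
move=> d0 s0 mw iw.
set M' := expR (c * s) ^+ 2 * `|M|.
have mS := measurable_shell d M.
pose K p := (\1_`[0, s] p.2 * (\1_(shell d M) p.1 * w (flow b c p.2 p.1)))%:E.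
have mf : measurable_fun [set: T3 * R] K.
  apply/measurable_EFinP; apply: measurable_funM.
    by apply: measurableT_comp => //; exact: measurable_indic.
  apply: measurable_funM; last exact: (measurableT_comp mw measurable_flow2r).
  by apply: measurableT_comp => //; exact: measurable_indic.
pose I := (\int[leb]_(y in shell d M') `|(w y)%:E|)%E.
have Ioo : (I < +oo)%E by case/integrableP : (iw M').
have I0 : (0 <= I)%E by exact: integral_ge0.
apply/(integrable21ltyP leb mu mf).
have H : (\int[mu]_(t in `[0%R, s]) I < +oo)%E.
  rewrite integral_cst//= lebesgue_measure_itv/= lte_fin.
  case: ifP => _; last by rewrite mule0 ltry.
  apply: lte_mul_pinfty; [exact: I0| |by rewrite -EFinD ltry].
  by rewrite ge0_fin_numE.
apply: (le_lt_trans _ H).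
rewrite [leRHS]integral_mkcond; apply: ge0_le_integral.
  - by [].
  - by move=> t _; exact: integral_ge0.
  - apply: (measurable_fun_fubini_tonelli_G (m1 := leb) (abse \o K)).
    + exact: (measurableT_comp (@abse_measurable R setT)).
    + by move=> p; exact: abse_ge0.
  - by apply/(measurable_restrictT _ _).1.
  - move=> t _; rewrite patchE; case: ifPn => [/set_mem/=|nt]; last first.
      rewrite le_eqVlt; apply/orP; left; apply/eqP; apply: integral0_eq => x _.
      by rewrite /K/= indicE (negbTE nt) mul0r normr0.
    rewrite in_itv/= => ts.
    pose f y := `|(\1_(shell d M) (flow b c (- t) y) * w y)%:E|%E.
    have mff : measurable_fun [set: T3] f.
      apply: measurableT_comp => //; apply/measurable_EFinP; apply: measurable_funM => //.
      apply: measurableT_comp; last exact: measurable_flow.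
      exact: measurable_indic.
    apply: (@le_trans _ _ (\int[leb]_x f (flow b c t x))%E).
      rewrite le_eqVlt; apply/orP; left; apply/eqP.
      apply: eq_integral => x _; rewrite /K/= /f flowK.
      by rewrite (_ : \1_`[0, s] t = 1) ?mul1r// indicE mem_set//= in_itv.
    rewrite (@ge0_integral_flow _ b c t f mff (fun=> abse_ge0 _)).
    apply: (@le_trans _ _ (1 * \int[leb]_x f x)%E).
      apply: lee_wpmul2r; first by apply: integral_ge0 => y _; exact: abse_ge0.
      rewrite lee_fin -[leRHS]expR0 ler_expR oppr_le0; case/andP: ts => t0 _.
      have ct : 0 <= c * t by exact: mulr_ge0.
      by rewrite -mulrA mulr_ge0.
    rewrite mul1e /I [leRHS]integral_mkcond; apply: ge0_le_integral.
    + by [].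
    + by move=> y _; exact: abse_ge0.
    + exact: mff.
    + apply/(measurable_restrictT _ _).1; first exact: measurable_shell.
      by apply: measurable_funTS; apply: measurableT_comp => //; exact/measurable_EFinP.
    + move=> y _; rewrite patchE /f indicE.
      case: (boolP (_ \in shell d M)) => [/set_mem/(shell_flow ts) ys|_].
        by rewrite mem_set// mul1r.
      by rewrite mul0r abse0; case: ifP => // _; exact: abse_ge0.
Qed.

End flow_integrals.

Lemma sum_ord3 (V : nmodType) (F : 'I_3 -> V) :
  \sum_(j < 3) F j = F 0 + (F 1 + F 2).
Proof.
rewrite !big_ord_recl big_ord0 addr0.
by congr (F _ + (F _ + F _)); apply/val_inj.
Qed.

(** * The weak derivative along the flow *)

Section derivative_along_flow.
Context {R : realType}.
Local Notation leb := (lebesgue3 R).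
Let T3 := (R * R * R)%type.
Variables (b c : R).
Hypothesis c0 : 0 <= c.

Lemma integrable_shell_mull (w : T3 -> R) (e : texpr) d M :
  measurable_fun [set: T3] w -> leb.-integrable (shell d M) (EFin \o w) ->
  leb.-integrable (shell d M) (fun x => (teval e x * w x)%:E).
Proof.
move=> mw iw.
have mS := measurable_shell d M.
have [B B0 HB] : exists2 B, 0 <= B & forall x, shell d M x -> `|teval e x| <= B.
  have cb : compact (teval e @` shell d M).
    apply: continuous_compact; last exact: compact_shell.
    by apply: continuous_subspaceT => x; exact: continuous_teval.
  have /ex_strict_bound_gt0[B B0 /= HB] : bounded_set (teval e @` shell d M).
    exact: compact_bounded.
  by exists B => [|x xs]; [exact: ltW|apply/ltW/HB; exists x].
have iB : leb.-integrable (shell d M) (fun x => (B * w x)%:E).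
  by under eq_fun do rewrite EFinM; exact: integrableZl.
apply: le_integrable iB => //.
  apply: measurable_funTS; apply/measurable_EFinP; apply: measurable_funM => //.
  exact: measurable_teval.
move=> x xs; rewrite !abse_EFin lee_fin !normrM ler_wpM2r// (ger0_norm B0).
exact: HB.
Qed.

Variables (u : T3 -> R) (g : 'I_3 -> T3 -> R).
Hypothesis mu_ : measurable_fun [set: T3] u.
Hypothesis iu : forall d M, 0 < d -> leb.-integrable (shell d M) (EFin \o u).
Hypothesis wg : forall j, weak_partial3 j u (g j).

Let mg j : measurable_fun [set: T3] (g j). Proof. by case: (wg j). Qed.

Let ig j d M : 0 < d -> leb.-integrable (shell d M) (EFin \o g j).
Proof.
by move=> d0; case: (wg j) => _ [H _]; apply: H; [exact: compact_shell|exact: shell_Omega].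
Qed.

(** For the dilations this is x . grad u, for the rotations the angular derivative x1 d2 u - x2 d1
    u. *)
Definition dflow (x : T3) : R := \sum_(j < 3) coord j (field b c x) * g j x.

Let dflowE x : dflow x = teval (tfield b c 0) x * g 0 x +
  (teval (tfield b c 1) x * g 1 x + teval (tfield b c 2) x * g 2 x).
Proof. by rewrite /dflow sum_ord3 !teval_field. Qed.

Lemma measurable_dflow : measurable_fun [set: T3] dflow.
Proof.
rewrite (funext dflowE).
by apply: measurable_funD; [|apply: measurable_funD]; apply: measurable_funM => //;
  exact: measurable_teval.
Qed.

Lemma integrable_dflow d M : 0 < d -> leb.-integrable (shell d M) (EFin \o dflow).
Proof.
move=> d0; have mS := measurable_shell d M.
rewrite (_ : EFin \o dflow = (fun x => (teval (tfield b c 0) x * g 0 x)%:E) \+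
  ((fun x => (teval (tfield b c 1) x * g 1 x)%:E) \+
   (fun x => (teval (tfield b c 2) x * g 2 x)%:E)))%E; last first.
  by apply/funext => x /=; rewrite dflowE !EFinD.
by apply: integrableD => //; [|apply: integrableD => //]; apply: integrable_shell_mull => //;
  exact: ig.
Qed.

(* minus the divergence of [teval e] times the field *)
Definition tdivm (e : texpr) : texpr :=
  TMul (TConst (-1)) (TAdd (TMul (TConst (3 * c)) e)
   (TAdd (TMul (tfield b c 0) (tderiv (ej 0) e))
   (TAdd (TMul (tfield b c 1) (tderiv (ej 1) e))
         (TMul (tfield b c 2) (tderiv (ej 2) e))))).

Lemma tdivmE e x : teval (tdivm e) x =
  - (3 * c * teval e x + teval (tderiv (field b c x) e) x).
Proof.
rewrite [in RHS]tderivE sum_ord3 -!teval_field.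
by rewrite [LHS]/= mulN1r.
Qed.

Lemma tdivm_support e d M : (forall x, ~ shell d M x -> teval e x = 0) ->
  forall x, ~ shell d M x -> teval (tdivm e) x = 0.
Proof.
move=> H x xs; rewrite tdivmE H// mulr0 (tderiv_support _ H)//.
by rewrite addr0 oppr0.
Qed.

(** The density [e] carried along by the flow, with its Jacobian factor; as an operator on test
    functions it is the adjoint of composing with the flow at time t. *)
Definition ttransport (t : R) (e : texpr) : texpr :=
  TMul (TConst (expR (- (3 * c * t)))) (tsubst (tflow b c (- t)) e).

Lemma ttransportE t e y : teval (ttransport t e) y =
  expR (- (3 * c * t)) * teval e (flow b c (- t) y).
Proof. by rewrite [LHS]/= (teval_subst _ (teval_flow b c (- t))). Qed.

Lemma ttransport_support t e d M : 0 <= t ->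
  (forall x, ~ shell d M x -> teval e x = 0) ->
  forall x, ~ shell d (expR (c * t) ^+ 2 * `|M|) x -> teval (ttransport t e) x = 0.
Proof.
move=> t0 H x xs; rewrite ttransportE H ?mulr0// => ys; apply: xs.
by apply: shell_flow ys => //; rewrite t0 lexx.
Qed.

(** The field is invariant under its own flow, so transport commutes with the divergence. The right
    side is spelled out in coordinate partials of products, the form against which weak derivatives
    are tested. *)
Lemma tdivm_transport t e y : teval (ttransport t (tdivm e)) y =
  - (teval (tderiv (ej 0) (TMul (tfield b c 0) (ttransport t e))) y +
     (teval (tderiv (ej 1) (TMul (tfield b c 1) (ttransport t e))) y +
      teval (tderiv (ej 2) (TMul (tfield b c 2) (ttransport t e))) y)).
Proof.
rewrite ttransportE tdivmE field_flow -tderiv_subst_flow.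
transitivity (- (3 * c * teval (ttransport t e) y +
    teval (tderiv (field b c y) (ttransport t e)) y)).
  rewrite ttransportE [teval (tderiv _ (ttransport _ _)) _]/=; ring.
rewrite tderivE sum_ord3 -!teval_field.
set e' := ttransport t e.
by rewrite /= /coord/=; ring.
Qed.

Lemma weak_derivative_flow e d M t : 0 < d -> 0 <= t ->
  (forall x, ~ shell d M x -> teval e x = 0) ->
  (\int[leb]_y (u y * teval (ttransport t (tdivm e)) y)%:E =
   \int[leb]_y (dflow y * teval (ttransport t e) y)%:E)%E.
Proof.
move=> d0 t0 He.
pose M' := expR (c * t) ^+ 2 * `|M|.
have H := ttransport_support t0 He.
pose w j := TMul (tfield b c j) (ttransport t e).
have Hw j x : ~ shell d M' x -> teval (w j) x = 0.
  by move=> xs; rewrite [LHS]/= [X in _ * X]H// mulr0.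
have Hw' j x : ~ shell d M' x -> teval (tderiv (ej j) (w j)) x = 0.
  by move=> xs; exact: (tderiv_support _ (Hw j) xs).
have W j : (\int[leb]_y (u y * teval (tderiv (ej j) (w j)) y)%:E =
            - \int[leb]_y (g j y * teval (w j) y)%:E)%E.
  by case: (wg j) => _ [_ /(_ _ (testfun3_teval d0 (Hw j)))]; rewrite partial_teval.
have iW j : leb.-integrable setT (fun y => (u y * teval (tderiv (ej j) (w j)) y)%:E).
  exact: integrable_shellM (iu M' d0) (Hw' j).
have iG j : leb.-integrable setT (fun y => (g j y * teval (w j) y)%:E).
  exact: integrable_shellM (ig j M' d0) (Hw j).
transitivity (\int[leb]_y - ((u y * teval (tderiv (ej 0) (w 0)) y)%:E +
   ((u y * teval (tderiv (ej 1) (w 1)) y)%:E + (u y * teval (tderiv (ej 2) (w 2)) y)%:E)))%E.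
  apply: eq_integral => y _; rewrite tdivm_transport -!EFinD -EFinN; congr _%:E.
  by rewrite -/(w 0) -/(w 1) -/(w 2); ring.
transitivity (\int[leb]_y ((g 0 y * teval (w 0) y)%:E +
   ((g 1 y * teval (w 1) y)%:E + (g 2 y * teval (w 2) y)%:E)))%E; last first.
  apply: eq_integral => y _; rewrite -!EFinD; congr _%:E.
  have E j : teval (w j) y = teval (tfield b c j) y * teval (ttransport t e) y by [].
  by rewrite dflowE !E; ring.
rewrite integralN; last first.
  by apply: integrable_add_def => //; apply: integrableD => //; apply: integrableD.
have D3 (f : 'I_3 -> T3 -> R) : (forall j, leb.-integrable setT (fun y => (f j y)%:E)) ->
    (\int[leb]_y ((f 0 y)%:E + ((f 1 y)%:E + (f 2 y)%:E)) = \int[leb]_y (f 0 y)%:E +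
     (\int[leb]_y (f 1 y)%:E + \int[leb]_y (f 2 y)%:E))%E.
  move=> fi; rewrite (integralD measurableT (fi 0) (integrableD measurableT (fi 1) (fi 2))).
  by rewrite (integralD measurableT (fi 1) (fi 2)).
rewrite (D3 (fun j y => u y * teval (tderiv (ej j) (w j)) y) iW).
rewrite (D3 (fun j y => g j y * teval (w j) y) iG) !W.
have fG j : (\int[leb]_y (g j y * teval (w j) y)%:E)%E \is a fin_num.
  exact: integrable_fin_num (iG j).
rewrite -(fineK (fG 0)) -(fineK (fG 1)) -(fineK (fG 2)).
move: (fine _) (fine _) (fine _) => r0 r1 r2.
by rewrite -[LHS]/((- (- r2 + (- r1 + - r0)))%:E); congr _%:E; ring.
Qed.

End derivative_along_flow.

(** * The fundamental theorem of calculus along the flow *)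

Section flow_identity.
Context {R : realType}.
Local Notation mu := (@lebesgue_measure R).
Local Notation leb := (lebesgue3 R).
Let T3 := (R * R * R)%type.

Lemma flow00 t (x : T3) : flow 0 0 t x = x.
Proof.
by case: x => [[x y] z]; rewrite /flow/= !mul0r expR0 cos0 sin0 !mul1r !mul0r subr0 add0r.
Qed.

Variables (b c : R).
Hypothesis c0 : 0 <= c.

(** The continuity equation for a density carried by the flow. *)
Lemma is_derive_ttransport e (y : T3) t :
  is_derive t (1 : R) (fun s => teval (ttransport b c s e) y)
    (teval (ttransport b c t (tdivm b c e)) y).
Proof.
rewrite ttransportE tdivmE.
rewrite (_ : (fun s => _) = (fun s => expR (- (3 * c * s)) * teval e (flow b c (- s) y))); last first.
  by apply/funext => s; rewrite ttransportE.
have dl : is_derive t (1 : R) (fun s => - (3 * c * s)) (- (3 * c)).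
  by apply: is_derive_eq; rewrite -[_ *: _]/(_ * _) mulr1.
have dE := @is_derive1_comp _ expR (fun s => - (3 * c * s)) t _ _ (is_derive_expR _) dl.
have dN : is_derive t (1 : R) (fun s => - s) (-1) by exact: is_deriveN.
have dC : is_derive t (1 : R) (fun s => teval e (flow b c (- s) y))
    (teval (tderiv (- field b c (flow b c (- t) y)) e) (flow b c (- t) y)).
  apply: is_derive_teval_curve => i.
  have -> : coord i (- field b c (flow b c (- t) y)) = coord i (field b c (flow b c (- t) y)) * -1.
    by rewrite mulrN1; exact: (raddfN (coord i)).
  exact: (@is_derive1_comp _ (fun s => coord i (flow b c s y)) (fun s => - s) t _ _
    (is_derive_flow b c (- t) i y) dN).
have E : teval (tderiv (- field b c (flow b c (- t) y)) e) (flow b c (- t) y) =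
   - teval (tderiv (field b c (flow b c (- t) y)) e) (flow b c (- t) y).
  rewrite tderivE [in RHS]tderivE -sumrN; apply: eq_bigr => j _.
  by rewrite -mulNr; congr (_ * _); exact: (raddfN (coord j)).
rewrite E in dC.
have H := is_deriveM dE dC.
rewrite -[X in is_derive _ _ X _]/((expR \o (fun s => - (3 * c * s))) * (fun s => teval e (flow b c (- s) y))).
apply: (is_derive_eq H); rewrite -![_ *: _]/(_ * _) /=; ring.
Qed.

Lemma continuous_ttransport e (y : T3) : continuous (fun t => teval (ttransport b c t e) y).
Proof.
move=> t; apply: differentiable_continuous; apply/derivable1_diffP.
by case: (is_derive_ttransport e y t).
Qed.

Lemma integral_ttransport e (y : T3) s : 0 < s ->
  (\int[mu]_(t in `[0%R, s]) (teval (ttransport b c t (tdivm b c e)) y)%:E =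
   (teval (ttransport b c s e) y - teval e y)%:E)%E.
Proof.
move=> s0.
rewrite (@continuous_FTC2 _ _ (fun t => teval (ttransport b c t e) y) _ _ s0).
- have -> : teval (ttransport b c 0 e) y = teval e y.
    by rewrite ttransportE mulr0 oppr0 expR0 mul1r flow0.
  by rewrite EFinB.
- by apply: continuous_subspaceT; exact: continuous_ttransport.
- split.
  + by move=> t _; case: (is_derive_ttransport e y t).
  + by apply: cvg_at_right_filter; exact: continuous_ttransport.
  + by apply: cvg_at_left_filter; exact: continuous_ttransport.
- move=> t _; rewrite derive1E; have H := is_derive_ttransport e y t.
  by rewrite (@derive_val _ _ _ _ _ _ _ H).
Qed.


Lemma integral_transport (w : T3 -> R) e d M t : 0 < d -> 0 <= t ->
  measurable_fun [set: T3] w ->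
  (forall M, leb.-integrable (shell d M) (EFin \o w)) ->
  (forall x, ~ shell d M x -> teval e x = 0) ->
  (\int[leb]_x (w (flow b c t x) * teval e x)%:E =
   \int[leb]_y (w y * teval (ttransport b c t e) y)%:E)%E.
Proof.
move=> d0 t0 mw iw He.
pose f y := (w y * teval e (flow b c (- t) y))%:E.
have H := integrable_shellM mw (iw _) (ttransport_support b c0 t0 He).
have fi : leb.-integrable setT f.
  have := integrableZl measurableT (expR (3 * c * t)) H.
  rewrite (_ : (fun x => _) = f)//; apply/funext => y.
  rewrite ttransportE /f -EFinM expRN; congr _%:E.
  by field; rewrite gt_eqF// expR_gt0.
transitivity (\int[leb]_x f (flow b c t x))%E.
  by apply: eq_integral => x _; rewrite /f flowK.
rewrite (integral_flow b c t fi) -integralZl//.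
by apply: eq_integral => y _; rewrite ttransportE /f -EFinM; congr _%:E; ring.
Qed.

(** Fubini gives this on each shell; countably many shells cover [Omega], whose complement is
    null. *)
Lemma ae_integrable_flow (w : T3 -> R) s : 0 <= s ->
  measurable_fun [set: T3] w ->
  (forall d M, 0 < d -> leb.-integrable (shell d M) (EFin \o w)) ->
  {ae leb, forall x, mu.-integrable setT (fun t => (\1_`[0, s] t * w (flow b c t x))%:E)}.
Proof.
move=> s0 mw iw.
have H n : {ae leb, forall x, shell n.+1%:R^-1 n.+1%:R x ->
    mu.-integrable setT (fun t => (\1_`[0, s] t * w (flow b c t x))%:E)}.
  have iK : (product_sf leb mu).-integrable setT
      (fun p => (\1_`[0, s] p.2 * (\1_(shell n.+1%:R^-1 n.+1%:R) p.1 * w (flow b c p.2 p.1)))%:E).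
    by apply: integrable_flow_shell => // M'; exact: iw.
  have := ae_integrable1 (m1 := leb) (m2 := mu) iK.
  apply: ae_imply => x /= H xs; move: H.
  by under eq_fun do rewrite [\1_(shell _ _) x]indicE mem_set// mul1r.
have /ae_foralln HH := H.
apply: (ae_imply2 _ (ae_Omega (R := R)) HH) => x Ox Hx.
have [n n1] := cutoff_neq0 Ox; apply: (Hx n).
by apply: contrapT => nx; move: n1; rewrite cutoff_shell// eqxx.
Qed.

Variables (u : T3 -> R) (g : 'I_3 -> T3 -> R).
Hypothesis mu_ : measurable_fun [set: T3] u.
Hypothesis iu : forall d M, 0 < d -> leb.-integrable (shell d M) (EFin \o u).
Hypothesis wg : forall j, weak_partial3 j u (g j).
Let G := dflow b c g.
Let mG : measurable_fun [set: T3] G. Proof. exact: measurable_dflow wg. Qed.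
Let iG d M : 0 < d -> leb.-integrable (shell d M) (EFin \o G).
Proof. by move=> d0; apply: integrable_dflow => //; exact: wg. Qed.

Variable s : R.
Hypothesis s0 : 0 < s.

Let J (x : T3) : \bar R := (\int[mu]_t (\1_`[0%R, s] t * G (flow b c t x))%:E)%E.

Let mJ2 : measurable_fun [set: T3 * R] (fun p => \1_`[0, s] p.2 * G (flow b c p.2 p.1)).
Proof.
apply: measurable_funM; last exact: (measurableT_comp mG (measurable_flow2r b c)).
by apply: measurableT_comp => //; exact: measurable_indic.
Qed.

Let mJ : measurable_fun [set: T3] J.
Proof.
apply: (measurable_fun_integral_pair mu (f := fun p => (\1_`[0, s] p.2 * G (flow b c p.2 p.1))%:E)).
exact/measurable_EFinP.
Qed.

Let iK d M : 0 < d -> (product_sf leb mu).-integrable setT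
  (fun p => (\1_`[0, s] p.2 * (\1_(shell d M) p.1 * G (flow b c p.2 p.1)))%:E).
Proof. by move=> d0; apply: integrable_flow_shell => //; [exact: ltW|move=> M'; exact: iG]. Qed.

Let J_shell d M x : shell d M x ->
  (\int[mu]_t (\1_`[0%R, s] t * (\1_(shell d M) x * G (flow b c t x)))%:E = J x)%E.
Proof.
by move=> xs; apply: eq_integral => t _; rewrite [\1_(shell d M) x]indicE mem_set// mul1r.
Qed.

Let integrable_shift d M : 0 < d ->
  leb.-integrable (shell d M) (fun x => (u (flow b c s x))%:E).
Proof.
move=> d0; apply/integrable_indicM; first exact: measurable_shell.
pose f y := (\1_(shell d M) (flow b c (- s) y) * u y)%:E.
have -> : (fun x => (\1_(shell d M) x * u (flow b c s x))%:E) = f \o flow b c s.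
  by apply/funext => x; rewrite /f /= flowK.
apply: integrable_flow.
have mS := measurable_shell d (expR (c * s) ^+ 2 * `|M|).
have := (integrable_indicM leb u mS).2 (iu _ d0).
apply: le_integrable => //.
  apply/measurable_EFinP; apply: measurable_funM => //.
  by apply: measurableT_comp; [apply: measurable_indic; exact: measurable_shell|exact: measurable_flow].
move=> y _; rewrite /f !abse_EFin lee_fin !normrM ler_wpM2r//.
rewrite !indicE !normr_nat ler_nat.
case: (boolP (_ \in shell d M)) => // /set_mem ys; rewrite mem_set//.
by apply: shell_flow ys => //; rewrite lexx ltW.
Qed.

Let integrable_J d M : 0 < d ->
  leb.-integrable (shell d M) (fun x => (fine (J x))%:E).
Proof.
move=> d0; apply/integrable_indicM; first exact: measurable_shell.
have := integrable_fubini_F (m1 := leb) (m2 := mu) (iK M d0).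
apply: le_integrable => //.
  apply/measurable_EFinP; apply: measurable_funM.
    by apply: measurable_indic; exact: measurable_shell.
  exact: (measurableT_comp (fine_measurable measurableT) mJ).
move=> x _; rewrite /fubini_F/= [in leLHS]indicE; case: (boolP (x \in shell d M)) => [/set_mem xs|_].
  rewrite [in leRHS]J_shell// mul1r.
  by case: (J x) => [r| |] //=; rewrite normr0 leey.
by rewrite mul0r normr0 abse_ge0.
Qed.


Let fubini_u e d M : 0 < d -> (forall x, ~ shell d M x -> teval e x = 0) ->
  (\int[mu]_(t in `[0%R, s]) \int[leb]_y (u y * teval (ttransport b c t (tdivm b c e)) y)%:E
   = \int[leb]_y (u y * (teval (ttransport b c s e) y - teval e y))%:E)%E.
Proof.
move=> d0 He.
have Hk := tdivm_support b c He.
have [B B0 HB] := teval_bounded Hk.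
pose M' := expR (c * s) ^+ 2 * `|M|.
pose k t y := teval (ttransport b c t (tdivm b c e)) y.
pose H (p : T3 * R) := (\1_`[0, s] p.2 * (u p.1 * k p.2 p.1))%:E.
have mk : measurable_fun [set: T3 * R] (fun p : T3 * R => k p.2 p.1).
  rewrite (_ : (fun p => _) = fun p : T3 * R => expR (- (3 * c * p.2)) *
      teval (tdivm b c e) (flow b c (- p.2) p.1)); last first.
    by apply/funext => p; rewrite /k ttransportE.
  apply: measurable_funM.
    apply: (measurableT_comp (f := fun t : R => expR (- (3 * c * t)))) => //.
    apply: measurableT_comp; first exact: measurable_expR.
    by apply: measurableT_comp => //; exact: measurable_funM.
  apply: measurableT_comp; first exact: measurable_teval.
  have mp : measurable_fun [set: T3 * R] (fun p : T3 * R => (p.1, - p.2)).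
    by apply: measurable_fun_pair => //; exact: measurableT_comp.
  exact: (measurableT_comp (measurable_flow2r b c) mp).
have mH : measurable_fun [set: T3 * R] H.
  apply/measurable_EFinP; apply: measurable_funM.
    by apply: measurableT_comp => //; exact: measurable_indic.
  by apply: measurable_funM => //; exact: measurableT_comp.
have iH : (product_sf leb mu).-integrable setT H.
  (* The constant flow [flow 0 0] lets the integrability lemma apply to [u] itself, as a function on
     the product that is independent of time. *)
  have i0 : (product_sf leb mu).-integrable setT (fun p : T3 * R =>
      (\1_`[0, s] p.2 * (\1_(shell d M') p.1 * u (flow 0 0 p.2 p.1)))%:E).
    by apply: integrable_flow_shell => //; [exact: ltW|move=> M''; exact: iu].
  apply: (le_integrable measurableT _ _ (integrableZl measurableT B i0)) => //.
  move=> [y t] _; rewrite /H flow00 -EFinM !abse_EFin lee_fin -[(y, t).1]/y -[(y, t).2]/t.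
  (* For all times in [0, s] the transported test functions share one bound and one shell containing
     their supports. *)
  have kB : 0 <= t <= s -> `|k t y| <= B * \1_(shell d M') y.
    move=> ts; have /andP[t0 _] := ts; rewrite /k ttransportE.
    have [ys|ys] := pselect (shell d M' y); last first.
      by rewrite Hk ?mulr0 ?normr0 ?mulr_ge0// => /(shell_flow c0 ts).
    rewrite indicE mem_set// mulr1 normrM -[leRHS]mul1r ler_pM//.
    rewrite ger0_norm ?expR_ge0// -[leRHS]expR0 ler_expR oppr_le0.
    by rewrite -mulrA mulr_ge0// mulr_ge0.
  move: (k t y) kB => r kB; rewrite !normrM.
  have [ts|ts] := boolP (t \in `[0, s]%classic); last first.
    by rewrite [\1_`[0, s] t]indicE (negbTE ts) !(mul0r, normr0, mulr0).
  rewrite [\1_`[0, s] t]indicE ts normr1 !mul1r.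
  have {}ts : 0 <= t <= s by move/set_mem: ts; rewrite /= in_itv.
  rewrite (ger0_norm B0) mulrA mulrC ler_wpM2r// (le_trans (kB ts))//.
  by rewrite ler_wpM2l// ler_norm.
rewrite integral_mkcond.
transitivity (\int[mu]_t \int[leb]_y H (y, t))%E.
  apply: eq_integral => t _; rewrite patchE; case: ifPn => [ts|ts].
    by apply: eq_integral => y _; rewrite /H -[(y, t).2]/t indicE ts mul1r.
  by apply/esym/integral0_eq => y _; rewrite /H -[(y, t).2]/t indicE (negbTE ts) mul0r.
have := @Fubini _ _ _ _ R leb mu H iH => <-.
apply: eq_integral => y _; rewrite /H integral_indicM.
rewrite EFinM -(integral_ttransport e y s0) -integralZl//.
apply: continuous_compact_integrable; first exact: segment_compact.
by apply: continuous_subspaceT; exact: continuous_ttransport.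
Qed.

(** Fubini takes the time integral outside. At each time a change of variables puts the flow on the
    test function, and the weak derivative is moved there as well; by the continuity equation what
    remains is a time derivative, which integrates exactly. *)
Let du_bois_reymond_flow e d M : 0 < d -> (forall x, ~ shell d M x -> teval e x = 0) ->
  (\int[leb]_x (fine (J x) * teval e x)%:E =
   \int[leb]_x ((u (flow b c s x) - u x) * teval e x)%:E)%E.
Proof.
move=> d0 He.
have [B B0 HB] := teval_bounded He.
pose L (p : T3 * R) := (\1_`[0, s] p.2 * (G (flow b c p.2 p.1) * teval e p.1))%:E.
have iL : (product_sf leb mu).-integrable setT L.
  apply: (le_integrable measurableT _ _ (integrableZl measurableT B (iK M d0))) => //.
    apply/measurable_EFinP; under eq_fun do rewrite mulrA.
    apply: measurable_funM => //; apply: measurableT_comp => //.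
    exact: measurable_teval.
  move=> [x t] _; rewrite /L /= lee_fin !normrM.
  have [xs|xs] := pselect (shell d M x); last by rewrite He// normr0 !mulr0 !mulr_ge0.
  rewrite [\1_(shell d M) x]indicE mem_set// normr1 mul1r mulrA mulrC.
  by rewrite ler_wpM2r// ?mulr_ge0// (ger0_norm B0).
transitivity (\int[leb]_x \int[mu]_t L (x, t))%E.
  apply: ae_eq_integral => //.
  - apply/measurable_EFinP; apply: measurable_funM; last exact: measurable_teval.
    exact: (measurableT_comp (fine_measurable measurableT) mJ).
  - apply: (measurable_fun_integral_pair mu (f := L)); exact: (measurable_int _ iL).
  (* [J x] is finite for almost every x, so [fine] changes nothing here. *)
  - apply: ae_imply (ae_integrable_flow (ltW s0) mG iG) => x /= iJ _.
    rewrite /L/= EFinM fineK; last exact: (integrable_fin_num _ iJ).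
    rewrite muleC -integralZl//; apply: eq_integral => t _.
    by rewrite -EFinM; congr _%:E; ring.
rewrite (@Fubini _ _ _ _ R leb mu L iL).
transitivity (\int[mu]_(t in `[0%R, s]) \int[leb]_y (u y * teval (ttransport b c t (tdivm b c e)) y)%:E)%E.
  rewrite [RHS]integral_mkcond; apply: eq_integral => t _; rewrite patchE; case: ifPn => ts; last first.
    by apply: integral0_eq => y _; rewrite /L/= indicE (negbTE ts) mul0r.
  have /andP[t0 _] : 0 <= t <= s by move/set_mem: ts; rewrite /= in_itv.
  rewrite (weak_derivative_flow b c0 mu_ iu wg d0 t0 He).
  rewrite -(integral_transport d0 t0 mG _ He); last by move=> M'; exact: iG.
  by apply: eq_integral => y _; rewrite /L/= indicE ts mul1r.
rewrite (fubini_u d0 He).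
have s00 := ltW s0.
have H1 := integrable_shellM mu_ (iu _ d0) (ttransport_support b c0 s00 He).
have H2 := integrable_shellM mu_ (iu _ d0) He.
have H3 : leb.-integrable setT (fun x => (u (flow b c s x) * teval e x)%:E).
  apply: integrable_shellM (integrable_shift M d0) He.
  exact: (measurableT_comp mu_ (measurable_flow _ _ _)).
transitivity (\int[leb]_y (u y * teval (ttransport b c s e) y)%:E - \int[leb]_y (u y * teval e y)%:E)%E.
  rewrite -integralB//; apply: eq_integral => y _.
  by rewrite -EFinB; congr _%:E; ring.
rewrite -(integral_transport d0 s00 mu_ _ He); last by move=> M'; exact: iu.
rewrite -integralB//; apply: eq_integral => y _.
by rewrite -EFinB; congr _%:E; ring.
Qed.

Let integrable_shellB d M (f1 f2 : T3 -> R) :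
  leb.-integrable (shell d M) (fun x => (f1 x)%:E) ->
  leb.-integrable (shell d M) (fun x => (f2 x)%:E) ->
  leb.-integrable (shell d M) (fun x => (f1 x - f2 x)%:E).
Proof.
move=> i1 i2.
have -> : (fun x => (f1 x - f2 x)%:E) = ((fun x => (f1 x)%:E) \- (fun x => (f2 x)%:E))%E.
  by apply/funext => x /=; rewrite EFinB.
by apply: integrableB => //; exact: measurable_shell.
Qed.

Lemma flow_identity : {ae leb, forall x,
  (u (flow b c s x) - u x)%:E = (\int[mu]_(t in `[0%R, s]) (G (flow b c t x))%:E)%E}.
Proof.
have D0 : {ae leb, forall x, u (flow b c s x) - u x - fine (J x) = 0}.
  apply: du_bois_reymond.
  - apply: measurable_funB; last exact: (measurableT_comp (fine_measurable measurableT) mJ).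
    by apply: measurable_funB => //; exact: (measurableT_comp mu_ (measurable_flow _ _ _)).
  - move=> d M d0.
    exact: integrable_shellB (integrable_shellB (integrable_shift M d0) (iu M d0)) (integrable_J M d0).
  - move=> e d M d0 He.
    have iD : leb.-integrable setT (fun x => ((u (flow b c s x) - u x) * teval e x)%:E).
      apply: integrable_shellM He.
        by apply: measurable_funB => //; exact: (measurableT_comp mu_ (measurable_flow _ _ _)).
      exact: integrable_shellB (integrable_shift M d0) (iu M d0).
    have iJe : leb.-integrable setT (fun x => (fine (J x) * teval e x)%:E).
      apply: integrable_shellM (integrable_J M d0) He.
      exact: (measurableT_comp (fine_measurable measurableT) mJ).
    transitivity (\int[leb]_x ((u (flow b c s x) - u x) * teval e x)%:E -
                  \int[leb]_x (fine (J x) * teval e x)%:E)%E.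
      rewrite -integralB//; apply: eq_integral => x _.
      by rewrite -EFinB; congr _%:E; ring.
    rewrite (du_bois_reymond_flow d0 He) subee//.
    exact: (integrable_fin_num _ iD).
apply: (ae_imply2 _ D0 (ae_integrable_flow (ltW s0) mG iG)) => x /eqP; rewrite subr_eq0 => /eqP -> iJ.
rewrite -integral_indicM fineK//.
exact: (integrable_fin_num _ iJ).
Qed.

End flow_identity.

Lemma measurable_funVr d (T : measurableType d) (R : realType) (f : T -> R) :
  measurable_fun setT f -> measurable_fun setT (fun x => (f x)^-1).
Proof.
move=> mf; apply: (@measurableT_comp _ _ _ _ _ _ (fun t : R => t^-1)) => //.
rewrite -(setUv [set (0 : R)]); apply/measurable_funU => //.
  exact: measurableC.
split.
  have H : measurable_fun [set (0 : R)] (cst 0 : R -> R) by exact: measurable_cst.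
  apply: eq_measurable_fun H.
  by move=> x; rewrite inE => ->; rewrite invr0.
apply: open_continuous_measurable_fun.
  by apply: closed_openC; exact: closed_eq.
by move=> x; rewrite inE => /eqP x0; exact: inv_continuous.
Qed.

(** * Cauchy-Schwarz on [0, 1] with an exponential weight *)

Section exponential_weight.
Context {R : realType}.
Local Notation mu := (@lebesgue_measure R).

Lemma integral_expR_half :
  (\int[mu]_(t in `[0%R, 1%R]) (expR (- (t / 2)))%:E = (2 * (1 - expR (- (1 / 2))))%:E)%E.
Proof.
have dF (t : R) : is_derive t (1 : R) (fun t => -2 * expR (- (t / 2))) (expR (- (t / 2))).
  have dl : is_derive t (1 : R) (fun t => - (t / 2)) (- (1 / 2)).
    have -> : (fun t : R => - (t / 2)) = (fun t => (- (1 / 2)) * t).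
      by apply/funext => x; field.
    by apply: is_derive_eq; rewrite -[_ *: _]/(_ * _) mulr1.
  have dE := @is_derive1_comp _ expR (fun t => - (t / 2)) t _ _ (is_derive_expR _) dl.
  have H := is_deriveZ (-2) dE.
  by apply: (is_derive_eq H); rewrite -[_ *: _]/(_ * _); field.
have cF : continuous (fun t : R => -2 * expR (- (t / 2))).
  by move=> t; apply: differentiable_continuous; apply/derivable1_diffP; case: (dF t).
rewrite (@continuous_FTC2 _ _ (fun t => -2 * expR (- (t / 2))) _ _ ltr01).
- by rewrite -EFinB mul0r oppr0 expR0; congr _%:E; ring.
- apply: continuous_subspaceT => t.
  have -> : (fun t : R => expR (- (t / 2))) = (fun t => (-2)^-1 * (-2 * expR (- (t / 2)))).
    by apply/funext => x; field.
  by apply: cvgMl_tmp; exact: cF.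
- split.
  + by move=> t _; case: (dF t).
  + by apply: cvg_at_right_filter; exact: cF.
  + by apply: cvg_at_left_filter; exact: cF.
- move=> t _; rewrite derive1E; have H := dF t.
  by rewrite (@derive_val _ _ _ _ _ _ _ H).
Qed.

(* Cauchy-Schwarz with the weight [expR (t / 2)], obtained by integrating
   [2 k f <= k^2 / p + p f^2] and optimizing in [k]. *)
Lemma sqr_integral_expR_half (f : R -> R) (I : R) :
  measurable_fun [set: R] f ->
  mu.-integrable `[0, 1] (EFin \o f) ->
  (\int[mu]_(t in `[0%R, 1%R]) (f t)%:E = I%:E)%E ->
  ((I ^+ 2 / (2 * (1 - expR (- (1 / 2)))))%:E <=
   \int[mu]_(t in `[0%R, 1%R]) (expR (t / 2) * f t ^+ 2)%:E)%E.
Proof.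
move=> mf fi fI; set W := 2 * _.
have W0 : 0 < W.
  by rewrite mulr_gt0// subr_gt0 -[ltRHS]expR0 ltr_expR oppr_lt0 divr_gt0.
have mE : measurable_fun [set: R] (fun t : R => (expR (t / 2) * f t ^+ 2)%:E).
  apply/measurable_EFinP; apply: measurable_funM; last exact: measurable_funX.
  by apply: measurableT_comp; [exact: measurable_expR|exact: measurable_funM].
have [Qoo|Qoo] := eqVneq (\int[mu]_(t in `[0%R, 1%R]) (expR (t / 2) * f t ^+ 2)%:E)%E +oo%E.
  by rewrite Qoo leey.
pose k := I / W.
have iW : mu.-integrable `[0, 1] (fun t => (expR (- (t / 2)))%:E).
  apply: continuous_compact_integrable; first exact: segment_compact.
  apply: continuous_subspaceT => t; apply: continuous_comp; last exact: continuous_expR.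
  by apply: cvgN; apply: cvgMr_tmp; exact: cvg_id.
have iQ : mu.-integrable `[0, 1] (fun t => (expR (t / 2) * f t ^+ 2)%:E).
  apply/integrableP; split; first exact: measurable_funTS.
  rewrite (_ : (\int[mu]_(t in _) _ = \int[mu]_(t in `[0%R, 1%R]) (expR (t / 2) * f t ^+ 2)%:E)%E) ?ltey//.
  by apply: eq_integral => t _; rewrite gee0_abs// lee_fin mulr_ge0 ?expR_ge0 ?sqr_ge0.
have -> : ((I ^+ 2 / W)%:E = \int[mu]_(t in `[0%R, 1%R])
    (2 * k * f t - k ^+ 2 * expR (- (t / 2)))%:E)%E.
  under eq_integral do rewrite EFinB !EFinM.
  rewrite integralB//=; [|exact: integrableZl|exact: integrableZl].
  rewrite !integralZl// fI integral_expR_half -!EFinM -EFinB; congr _%:E.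
  by rewrite -/W /k; field; rewrite gt_eqF.
apply: le_integral => //.
- have -> : (fun t => (2 * k * f t - k ^+ 2 * expR (- (t / 2)))%:E) =
     ((fun t => (2 * k)%:E * (f t)%:E) \- (fun t => (k ^+ 2)%:E * (expR (- (t / 2)))%:E))%E.
    by apply/funext => t /=; rewrite EFinB !EFinM.
  by apply: integrableB => //; exact: integrableZl.
- move=> t _; rewrite lee_fin expRN.
  set p := expR (t / 2); have p0 : 0 < p by exact: expR_gt0.
  rewrite -subr_ge0.
  have -> : p * f t ^+ 2 - (2 * k * f t - k ^+ 2 * p^-1) = (p * f t - k) ^+ 2 / p.
    by field; rewrite gt_eqF.
  by rewrite divr_ge0 ?sqr_ge0// ltW.
Qed.

End exponential_weight.

(** * The radial Hardy inequality *)

Section hardy.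
Context {R : realType}.
Local Notation mu := (@lebesgue_measure R).
Local Notation leb := (lebesgue3 R).
Let T3 := (R * R * R)%type.

(** With the truncation the weighted integral of [u ^+ 2] is finite, and its scaling under dilations
    survives as an inequality. *)
Let w (n : nat) (x : T3) : R := Num.min (norm2 x)^-1 n%:R.

Let norm2_ge0 (x : T3) : 0 <= norm2 x.
Proof. by rewrite /norm2 /rho2 !addr_ge0// sqr_ge0. Qed.

Let w_ge0 n x : 0 <= w n x.
Proof. by rewrite le_min invr_ge0 norm2_ge0 ler0n. Qed.

Let measurable_w n : measurable_fun [set: T3] (w n).
Proof.
by apply: measurable_minr => //; apply: measurable_funVr; exact: measurable_norm2.
Qed.

(** The Jacobian contributes e^(-3t) and the weight at most e^(2t): a minimum with a constant grows
    no faster than its first argument when t >= 0. *)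
Let integral_dilation_w n (h : T3 -> R) t : 0 <= t ->
  measurable_fun [set: T3] h -> (forall x, 0 <= h x) ->
  (\int[leb]_x (h (flow 0 1 t x) * w n x)%:E <=
   (expR (- t))%:E * \int[leb]_x (h x * w n x)%:E)%E.
Proof.
move=> t0 mh h0.
pose f y := (h y * w n (flow 0 1 (- t) y))%:E.
have mf : measurable_fun [set: T3] f.
  apply/measurable_EFinP; apply: measurable_funM => //.
  exact: (measurableT_comp (measurable_w n) (measurable_flow _ _ _)).
have f0 y : (0 <= f y)%E by rewrite lee_fin mulr_ge0.
have -> : (\int[leb]_x (h (flow 0 1 t x) * w n x)%:E = \int[leb]_x f (flow 0 1 t x))%E.
  by apply: eq_integral => x _; rewrite /f flowK.
rewrite (ge0_integral_flow 0 1 t mf f0).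
have -> : expR (- t) = expR (- (3 * 1 * t)) * expR (2 * t).
  by rewrite -expRD; congr expR; ring.
rewrite EFinM -muleA; apply: lee_wpmul2l; first by rewrite lee_fin expR_ge0.
have hw0 x : (0 <= (h x * w n x)%:E)%E by rewrite lee_fin mulr_ge0.
have mhw : measurable_fun [set: T3] (fun x => (h x * w n x)%:E).
  by apply/measurable_EFinP; exact: measurable_funM.
apply: (@le_trans _ _ (\int[leb]_x ((expR (2 * t)%R)%:E * (h x * w n x)%:E))%E); last first.
  by rewrite ge0_integralZl_EFin// expR_ge0.
apply: ge0_le_integral => //.
- by apply: measurable_funeM.
- move=> y _; rewrite /f -EFinM lee_fin mulrCA ler_wpM2l//.
  rewrite /w norm2_flow invfM -exprVn -expRN mul1r opprK -expRM_natl mulr_natl.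
  rewrite -[leRHS]/(_ * _) minr_pMr ?expR_ge0// le_min ge_min lexx/= ge_min.
  apply/orP; right; rewrite -[leLHS]mul1r ler_wpM2r//.
  by rewrite -[leLHS]expR0 ler_expR mulrn_wge0.
Qed.

Variables (u : T3 -> R) (g : 'I_3 -> T3 -> R).
Hypothesis mu_ : measurable_fun [set: T3] u.
Hypothesis iu : forall d M, 0 < d -> leb.-integrable (shell d M) (EFin \o u).
Hypothesis wg : forall j, weak_partial3 j u (g j).
Hypothesis u2 : (\int[leb]_x (u x ^+ 2)%:E < +oo)%E.
Let G := dflow 0 1 g.
Let mG : measurable_fun [set: T3] G. Proof. exact: measurable_dflow wg. Qed.
(** The factor by which |x|^(-1/2) decreases along the dilation in unit time. Up to the truncation,
    the estimates below are equalities for this function, which is why they yield the constant 4. *)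
Let lam : R := expR (- (1 / 2)).

Let lam0 : 0 < lam. Proof. exact: expR_gt0. Qed.

Let lam1 : 0 < 1 - lam.
Proof. by rewrite subr_gt0 -[ltRHS]expR0 ltr_expR oppr_lt0 divr_gt0. Qed.

Let F n (p : T3 * R) : R :=
  \1_`[0, 1] p.2 * (expR (p.2 / 2) * (G (flow 0 1 p.2 p.1) ^+ 2 * w n p.1)).

Let F_ge0 n p : 0 <= F n p.
Proof.
apply: mulr_ge0; first by rewrite indicE ler0n.
by apply: mulr_ge0; [exact: expR_ge0|apply: mulr_ge0; [exact: sqr_ge0|exact: w_ge0]].
Qed.

Let measurable_F n : measurable_fun [set: T3 * R] (F n).
Proof.
apply: measurable_funM; first by apply: measurableT_comp => //; exact: measurable_indic.
apply: measurable_funM.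
  by apply: measurableT_comp; [exact: measurable_expR|exact: measurable_funM].
apply: measurable_funM; last exact: measurableT_comp.
by apply: measurable_funX; exact: (measurableT_comp mG (measurable_flow2r 0 1)).
Qed.

Let hardy_pointwise n : {ae leb, forall x,
  ((u x ^+ 2 * w n x)%:E <= (lam^-1)%:E * (u (flow 0 1 1 x) ^+ 2 * w n x)%:E +
     2%:E * \int[mu]_t (F n (x, t))%:E)%E}.
Proof.
have H1 := flow_identity 0 ler01 mu_ iu wg ltr01.
have H2 := ae_integrable_flow 0 ler01 ler01 mG (fun d M d0 => integrable_dflow 0 1 wg M d0).
apply: (ae_imply2 _ H1 H2) => x; rewrite -/G => E iE.
have iG : mu.-integrable `[0, 1] (EFin \o (fun t => G (flow 0 1 t x))).
  by apply/(integrable_indicM mu _ _).1.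
set I := u (flow 0 1 1 x) - u x in E.
have mGx : measurable_fun [set: R] (fun t => G (flow 0 1 t x)).
  apply: measurableT_comp => //.
  have mp : measurable_fun [set: R] (fun t : R => (t, x)) by exact: measurable_fun_pair.
  exact: (measurableT_comp (measurable_flow2 0 1) mp).
have Q := sqr_integral_expR_half mGx iG (esym E).
rewrite -/lam in Q.
have -> : (\int[mu]_t (F n (x, t))%:E =
    (w n x)%:E * \int[mu]_(t in `[0%R, 1%R]) (expR (t / 2) * G (flow 0 1 t x) ^+ 2)%:E)%E.
  have mq : measurable_fun [set: R] (fun t => (\1_`[0, 1] t * (expR (t / 2) * G (flow 0 1 t x) ^+ 2))%:E).
    apply/measurable_EFinP; apply: measurable_funM; first exact: measurable_indic.
    apply: measurable_funM; last exact: measurable_funX.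
    by apply: measurableT_comp; [exact: measurable_expR|exact: measurable_funM].
  have q0 (t : R) : setT t -> (0 <= (\1_`[0%R, 1%R] t * (expR (t / 2)%R * G (flow 0 1 t x) ^+ 2))%:E)%E.
    move=> _; rewrite lee_fin; apply: mulr_ge0; first by rewrite indicE ler0n.
    by apply: mulr_ge0; [exact: expR_ge0|exact: sqr_ge0].
  rewrite -[in RHS]integral_indicM -(ge0_integralZl_EFin mu measurableT q0 mq (w_ge0 n x)).
  by apply: eq_integral => t _; rewrite /F -EFinM; congr _%:E; rewrite /=; ring.
apply: (@le_trans _ _ ((lam^-1)%:E * (u (flow 0 1 1 x) ^+ 2 * w n x)%:E +
     2%:E * ((w n x)%:E * (I ^+ 2 / (2 * (1 - lam)))%:E))%E); last first.
  apply: leeD => //; apply: lee_wpmul2l => //.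
  by apply: lee_wpmul2l => //; rewrite lee_fin.
rewrite -!EFinM -EFinD lee_fin -subr_ge0.
have -> : u x = u (flow 0 1 1 x) - I by rewrite /I; ring.
clearbody I; move: (u (flow 0 1 1 x)) (w n x) (w_ge0 n x) lam lam0 lam1 => A W W0 l l0 l1.
(* Young's inequality (A - I)^2 <= A^2 / l + I^2 / (1 - l), its defect written as a square that
   vanishes when A = l (A - I). *)
have -> : l^-1 * (A ^+ 2 * W) + 2 * (W * (I ^+ 2 / (2 * (1 - l)))) - (A - I) ^+ 2 * W =
  W * (((1 - l) * A + l * I) ^+ 2 / (l * (1 - l))).
  by field; rewrite !gt_eqF.
by rewrite mulr_ge0// divr_ge0 ?sqr_ge0// mulr_ge0 ?ltW.
Qed.

(** Integrated, the pointwise bound reads A <= lam A + 4 (1 - lam) B. The truncation makes A finite,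
    so that lam A can be absorbed and 1 - lam cancelled. *)
Let hardy_w n : (\int[leb]_x (u x ^+ 2 * w n x)%:E <=
  4%:E * \int[leb]_x (G x ^+ 2 * w n x)%:E)%E.
Proof.
set A := (\int[leb]_x (u x ^+ 2 * w n x)%:E)%E.
set B := (\int[leb]_x (G x ^+ 2 * w n x)%:E)%E.
have mu2 : measurable_fun [set: T3] (fun x => (u x ^+ 2 * w n x)%:E).
  by apply/measurable_EFinP; apply: measurable_funM => //; exact: measurable_funX.
have A0 : (0 <= A)%E by apply: integral_ge0 => x _; rewrite lee_fin mulr_ge0 ?sqr_ge0.
have B0 : (0 <= B)%E by apply: integral_ge0 => x _; rewrite lee_fin mulr_ge0 ?sqr_ge0.
have Aoo : (A < +oo)%E.
  apply: (@le_lt_trans _ _ (n%:R%:E * \int[leb]_x (u x ^+ 2)%:E)%E); last first.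
    rewrite lte_mul_pinfty// ?lee_fin//.
  have mu2' : measurable_fun [set: T3] (fun x => (u x ^+ 2)%:E).
    by apply/measurable_EFinP; exact: measurable_funX.
  apply: (@le_trans _ _ (\int[leb]_x (n%:R%:E * (u x ^+ 2)%:E))%E); last first.
    by rewrite ge0_integralZl_EFin// => x _; rewrite lee_fin sqr_ge0.
  apply: ge0_le_integral => //.
  - by move=> x _; rewrite lee_fin mulr_ge0 ?sqr_ge0.
  - exact: measurable_funeM.
  - by move=> x _; rewrite -EFinM lee_fin mulrC ler_wpM2r ?sqr_ge0// ge_min lexx orbT.
have mT : measurable_fun [set: T3] (fun x => (u (flow 0 1 1 x) ^+ 2 * w n x)%:E).
  apply/measurable_EFinP; apply: measurable_funM => //; apply: measurable_funX.
  exact: (measurableT_comp mu_ (measurable_flow _ _ _)).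
have mFi : measurable_fun [set: T3] (fun x => \int[mu]_t (F n (x, t))%:E)%E.
  apply: (measurable_fun_integral_pair mu (f := fun p => (F n p)%:E)).
  by apply/measurable_EFinP; exact: measurable_F.
have F0 x : (0 <= \int[mu]_t (F n (x, t))%:E)%E.
  by apply: integral_ge0 => t _; rewrite lee_fin.
have I1 : (\int[leb]_x (u (flow 0 1 1 x) ^+ 2 * w n x)%:E <= (lam ^+ 2)%:E * A)%E.
  have := integral_dilation_w n ler01 (measurable_funX 2 mu_) (fun x => sqr_ge0 (u x)).
  by rewrite -/A (_ : lam ^+ 2 = expR (- 1))// /lam -expRM_natl; congr expR; field.
(* The weight e^(t/2) and the dilation factor e^(-t) leave e^(-t/2), whose integral over [0, 1] is 2
   (1 - lam). *)
have I2 : (\int[leb]_x \int[mu]_t (F n (x, t))%:E <= (2 * (1 - lam))%:E * B)%E.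
  rewrite (fubini_tonelli (m1 := leb) (m2 := mu) (fun p => (F n p)%:E)); last 2 first.
  - by apply/measurable_EFinP; exact: measurable_F.
  - by move=> p; rewrite lee_fin.
  have mW : measurable_fun [set: R] (fun t => (expR (- (t / 2)))%:E).
    apply/measurable_EFinP; apply: measurableT_comp; first exact: measurable_expR.
    by apply: measurableT_comp => //; exact: measurable_funM.
  have EW : (\int[mu]_(t in `[0%R, 1%R]) ((expR (- (t / 2))%R)%:E * B) =
      \int[mu]_(t in `[0%R, 1%R]) (expR (- (t / 2)))%:E * B)%E.
    apply: ge0_integralZr.
    - by [].
    - exact: measurable_funTS.
    - by move=> t _; rewrite lee_fin expR_ge0.
    - exact: B0.
  rewrite -integral_expR_half -EW.
  rewrite [leRHS]integral_mkcond; apply: ge0_le_integral.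
  - by [].
  - by move=> t _; apply: integral_ge0 => x _; rewrite lee_fin.
  - apply: (measurable_fun_fubini_tonelli_G (m1 := leb) (fun p => (F n p)%:E)).
    + by apply/measurable_EFinP; exact: measurable_F.
    + by move=> p; rewrite lee_fin.
  - apply/(measurable_restrictT _ _).1; first exact: measurable_itv.
    apply: measurable_funTS; apply: emeasurable_funM => //; exact: measurable_cst.
  - move=> t _; rewrite patchE; case: ifPn => ts; last first.
      by rewrite integral0_eq// => x _; rewrite /F/= indicE (negbTE ts) mul0r.
    have /andP[t0 _] : 0 <= t <= 1 by move/set_mem: ts; rewrite /= in_itv.
    have mGt : measurable_fun [set: T3] (fun x => (G (flow 0 1 t x) ^+ 2 * w n x)%:E).
      apply/measurable_EFinP; apply: measurable_funM => //; apply: measurable_funX.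
      exact: (measurableT_comp mG (measurable_flow _ _ _)).
    have Gt0 x : setT x -> (0 <= (G (flow 0 1 t x) ^+ 2 * w n x)%:E)%E.
      by move=> _; rewrite lee_fin; apply: mulr_ge0; [exact: sqr_ge0|exact: w_ge0].
    apply: (@le_trans _ _ ((expR (t / 2)%R)%:E * \int[leb]_x (G (flow 0 1 t x) ^+ 2 * w n x)%:E)%E).
      rewrite -(ge0_integralZl_EFin leb measurableT Gt0 mGt (expR_ge0 _)).
      rewrite le_eqVlt; apply/orP; left; apply/eqP; apply: eq_integral => x _.
      by rewrite /F/= indicE ts mul1r.
    have := integral_dilation_w n t0 (measurable_funX 2 mG) (fun x => sqr_ge0 (G x)).
    have -> : expR (- (t / 2)) = expR (t / 2) * expR (- t) by rewrite -expRD; congr expR; field.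
    rewrite EFinM -muleA => H; apply: lee_wpmul2l; last exact: H.
    by rewrite lee_fin expR_ge0.
have [->|Boo] := eqVneq B +oo%E; first by rewrite gt0_muley ?leey.
have H : (A <= (lam^-1)%:E * ((lam ^+ 2)%:E * A) + 2%:E * ((2 * (1 - lam))%:E * B))%E.
  apply: (@le_trans _ _ ((lam^-1)%:E * \int[leb]_x (u (flow 0 1 1 x) ^+ 2 * w n x)%:E +
     2%:E * \int[leb]_x \int[mu]_t (F n (x, t))%:E)%E); last first.
    apply: leeD; apply: lee_wpmul2l => //.
    by rewrite lee_fin invr_ge0 ltW.
  rewrite -ge0_integralZl_EFin//; last 2 first.
  - by move=> x _; rewrite lee_fin; apply: mulr_ge0; [exact: sqr_ge0|exact: w_ge0].
  - by rewrite invr_ge0 ltW.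
  rewrite -ge0_integralZl_EFin//.
  rewrite -ge0_integralD//; first last.
  - exact: measurable_funeM.
  - by move=> x _; rewrite mule_ge0.
  - exact: measurable_funeM.
  - move=> x _; rewrite mule_ge0// lee_fin; first by rewrite invr_ge0 ltW.
    by apply: mulr_ge0; [exact: sqr_ge0|exact: w_ge0].
  apply: ae_ge0_le_integral => //.
  - by move=> x _; rewrite lee_fin; apply: mulr_ge0; [exact: sqr_ge0|exact: w_ge0].
  - move=> x _; apply: adde_ge0; apply: mule_ge0 => //; rewrite lee_fin.
      by rewrite invr_ge0 ltW.
    by apply: mulr_ge0; [exact: sqr_ge0|exact: w_ge0].
  - by apply: emeasurable_funD; exact: measurable_funeM.
  - by apply: ae_imply (hardy_pointwise n).
clear I1 I2; clearbody A B.
move: H A0 Aoo B0 Boo; case: A => [r| |] //; case: B => [q| |] //.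
rewrite -!EFinM -EFinD !lee_fin => H _ _ _ _.
have E : lam^-1 * (lam ^+ 2 * r) = lam * r by field; rewrite gt_eqF.
rewrite E in H; rewrite -(ler_pM2l lam1); nra.
Qed.

Lemma hardy : (\int[leb]_x (u x ^+ 2 / norm2 x)%:E <=
  4%:E * \int[leb]_x (G x ^+ 2 / norm2 x)%:E)%E.
Proof.
have wE n x : w n x <= (norm2 x)^-1 by rewrite ge_min lexx.
have mn : measurable_fun [set: T3] (fun x : T3 => (norm2 x)^-1).
  by apply: measurable_funVr; exact: measurable_norm2.
have L x : (u x ^+ 2 * w n x)%:E @[n --> \oo] --> (u x ^+ 2 / norm2 x)%:E.
  apply: cvg_EFin; first exact: nearW.
  (* At each point the truncation is inactive for all large n. *)
  apply: cvgMl_tmp; apply: cvg_near_cst.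
  near=> n; rewrite /w; apply/min_idPl.
  apply: le_trans (ltW (truncnS_gt _)) _; rewrite ler_nat.
  by near: n; exact: nbhs_infty_ge.
have C : (\int[leb]_x (u x ^+ 2 * w n x)%:E @[n --> \oo] -->
    \int[leb]_x (u x ^+ 2 / norm2 x)%:E)%E.
  have -> : (\int[leb]_x (u x ^+ 2 / norm2 x)%:E =
      \int[leb]_x limn (fun n => (u x ^+ 2 * w n x)%:E))%E.
    by apply: eq_integral => x _; apply/esym/cvg_lim => //; exact: L.
  apply: cvg_monotone_convergence => //.
  - by move=> n; apply/measurable_EFinP; apply: measurable_funM; [exact: measurable_funX|exact: measurable_w].
  - by move=> n x _; rewrite lee_fin; apply: mulr_ge0; [exact: sqr_ge0|exact: w_ge0].
  - move=> x _ n m nm; rewrite lee_fin ler_wpM2l ?sqr_ge0//.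
    by rewrite /w le_min ge_min lexx/= ge_min ler_nat nm orbT.
have := cvg_lim (@ereal_hausdorff R) C => <-; apply: lime_le.
  by apply/cvg_ex; eexists; exact: C.
apply: nearW => n; apply: (le_trans (hardy_w n)).
apply: lee_wpmul2l => //; apply: ge0_le_integral => //.
- by move=> x _; rewrite lee_fin; apply: mulr_ge0; [exact: sqr_ge0|exact: w_ge0].
- by apply/measurable_EFinP; apply: measurable_funM; [exact: measurable_funX|exact: measurable_w].
- by apply/measurable_EFinP; apply: measurable_funM => //; exact: measurable_funX.
- by move=> x _; rewrite lee_fin ler_wpM2l ?sqr_ge0.
Unshelve. all: by end_near. Qed.

End hardy.

(** * From primitives to weak derivatives on the line *)

Section weak_derivative_line.
Context {R : realType}.
Local Notation mu := (@lebesgue_measure R).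

Lemma indic_itvcc (a b t : R) : \1_`[a, b] t = (a <= t <= b)%R%:R :> R.
Proof. by rewrite indicE; congr (_%:R); congr nat_of_bool; apply/idP/idP; rewrite inE/= in_itv. Qed.

Lemma indic_itvcy (a t : R) : \1_`[a, +oo[ t = (a <= t)%R%:R :> R.
Proof.
by rewrite indicE; congr (_%:R); congr nat_of_bool; apply/idP/idP; rewrite inE/= in_itv/= andbT.
Qed.

Lemma measurable_indic_itv0 d (T : measurableType d) (s r : T -> R) :
  measurable_fun setT s -> measurable_fun setT r ->
  measurable_fun setT (fun p => \1_`[0, s p] (r p) : R).
Proof.
move=> ms mr.
have -> : (fun p => \1_`[0, s p] (r p) : R) =
    (fun p => \1_`[0, +oo[ (r p) * \1_`[0, +oo[ (s p - r p)).
  by apply/funext => p; rewrite indic_itvcc !indic_itvcy subr_ge0 -natrM mulnb.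
apply: measurable_funM; apply: measurableT_comp => //; try exact: measurable_indic.
exact: measurable_funB.
Qed.

Lemma derive1_support (chi : R -> R) (n : R) :
  (forall t, ~ (0 < t < n) -> chi t = 0) ->
  forall t, ~ (0 <= t <= n) -> derive1 chi t = 0.
Proof.
move=> H t tn; rewrite derive1E -[RHS](derive_cst (0 : R) t (1 : R)).
apply: near_eq_derive.
have [t0|t0] := ltP t 0.
  near=> x; apply: H => /andP[x0 _].
  suff : x < 0 by rewrite ltNge (ltW x0).
  by near: x; exact: lt_nbhsl.
have nt : n < t by rewrite ltNge; apply/negP => h; apply: tn; rewrite t0.
near=> x; apply: H => /andP[_ xn].
suff : n < x by rewrite ltNge (ltW xn).
by near: x; exact: lt_nbhsr.
Unshelve. all: by end_near. Qed.

(** Since [f] is a primitive only almost everywhere, integration by parts is replaced by Fubini over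
    the triangle 0 <= r <= t <= n. The constant [f 0] contributes nothing because chi vanishes at
    both ends. *)
Lemma weak_derivative_line (f f' chi : R -> R) (n : R) : 0 < n ->
  measurable_fun setT f -> measurable_fun setT f' ->
  mu.-integrable `[0, n] (EFin \o f') ->
  {ae mu, forall t, 0 < t -> (f t - f 0)%:E = (\int[mu]_(r in `[0%R, t]) (f' r)%:E)%E} ->
  (forall t, derivable chi t 1) -> continuous (derive1 chi) ->
  (forall t, ~ (0 < t < n) -> chi t = 0) ->
  (\int[mu]_t (f t * derive1 chi t)%:E = - \int[mu]_t (f' t * chi t)%:E)%E.
Proof.
move=> n0 mf mf' if' ae_f dchi cchi' chi0.
have cchi : continuous chi.
  by move=> t; apply: differentiable_continuous; apply/derivable1_diffP.
have mchi : measurable_fun [set: R] chi by exact: continuous_measurable_fun.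
have mchi' : measurable_fun [set: R] (derive1 chi) by exact: continuous_measurable_fun.
have chi'0 := derive1_support chi0.
have ftc r : 0 <= r <= n -> (\int[mu]_(t in `[r, n]) (derive1 chi t)%:E = (- chi r)%:E)%E.
  move=> /andP[r0 rn].
  have chin : chi n = 0 by apply: chi0; rewrite ltxx andbF.
  move: rn; rewrite le_eqVlt => /predU1P[->|rn].
    by rewrite set_itv1 integral_set1 chin oppr0.
  rewrite (@continuous_FTC2 _ _ chi _ _ rn).
  - by rewrite chin sub0e.
  - exact: continuous_subspaceT.
  - split => //; first by apply: cvg_at_right_filter; exact: cchi.
    by apply: cvg_at_left_filter; exact: cchi.
  - by [].
pose K (p : R * R) := (\1_`[0, n] p.1 * derive1 chi p.1 * (\1_`[0, p.1] p.2 * f' p.2))%:E.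
have mK : measurable_fun [set: R * R] K.
  apply/measurable_EFinP; apply: measurable_funM; apply: measurable_funM.
  - by apply: measurableT_comp => //; exact: measurable_indic.
  - exact: measurableT_comp.
  - exact: measurable_indic_itv0.
  - exact: measurableT_comp.
have bnd (h : R -> R) : continuous h -> (forall t, ~ (0 <= t <= n) -> h t = 0) ->
    exists2 B, 0 <= B & forall t, `|h t| <= B.
  move=> ch h0.
  have cb : compact (h @` `[0, n]).
    by apply: continuous_compact; [exact: continuous_subspaceT|exact: segment_compact].
  have /ex_strict_bound_gt0[B B0 /= HB] : bounded_set (h @` `[0, n]).
    exact: compact_bounded.
  exists B => [|t]; first exact: ltW.
  have [tn|tn] := boolP (0 <= t <= n); last first.
    by rewrite (h0 _ (elimN idP tn)) normr0 ltW.
  by apply/ltW/HB; exists t => //=; rewrite in_itv.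
have [B B0 HB] := bnd _ cchi' chi'0.
have iI : (\int[mu]_(r in `[0%R, n]) `|(f' r)%:E| < +oo)%E by case/integrableP : if'.
set I := (\int[mu]_(r in `[0%R, n]) `|(f' r)%:E|)%E in iI.
have I0 : (0 <= I)%E by exact: integral_ge0.
have sub t : t <= n -> `[0, t] `<=` `[0, n]%classic.
  by move=> tn r /=; rewrite !in_itv/= => /andP[-> /le_trans]; apply.
have if't t : t <= n -> mu.-integrable `[0, t] (EFin \o f').
  by move=> tn; apply: integrableS if' => //; exact: sub.
have iK : (product_sf mu mu).-integrable setT K.
  apply/(integrable12ltyP mu mu mK).
  apply: (@le_lt_trans _ _ (\int[mu]_(t in `[0%R, n]) (B%:E * I))%E); last first.
    rewrite integral_cst//= lebesgue_measure_itv/= lte_fin n0.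
    apply: lte_mul_pinfty; last by rewrite -EFinD ltry.
      by rewrite mule_ge0// lee_fin.
    by rewrite fin_numM// ge0_fin_numE.
  rewrite [leRHS]integral_mkcond; apply: ge0_le_integral.
  - by [].
  - by move=> t _; exact: integral_ge0.
  - apply: (measurable_fun_fubini_tonelli_F (m2 := mu) (abse \o K)).
    + exact: (measurableT_comp (@abse_measurable R setT)).
    + by move=> p; exact: abse_ge0.
  - by apply/(measurable_restrictT _ _).1.
  - move=> t _; rewrite patchE; case: ifPn => ts; last first.
      rewrite integral0_eq// => r _.
      by rewrite /K/= [\1_`[0, n] t]indicE (negbTE ts) !mul0r normr0.
    have /andP[t0 tn] : 0 <= t <= n by move/set_mem: ts; rewrite /= in_itv.
    apply: (@le_trans _ _ (\int[mu]_(r in `[0%R, n]) (B%:E * `|(f' r)%:E|))%E); last first.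
      rewrite ge0_integralZl_EFin//.
      by apply: measurable_funTS; apply: measurableT_comp => //; exact/measurable_EFinP.
    rewrite [leRHS]integral_mkcond; apply: ge0_le_integral.
    + by [].
    + by move=> r _; exact: abse_ge0.
    + apply: (measurableT_comp (@abse_measurable R setT)).
      by apply: (measurableT_comp mK); exact: measurable_fun_pair.
    + apply/(measurable_restrictT _ _).1 => //.
      apply: measurable_funTS; apply: measurable_funeM.
      by apply: measurableT_comp => //; exact/measurable_EFinP.
    + move=> r _; rewrite /K/= [\1_`[0, n] t]indicE ts mul1r patchE.
      have [rt|rt] := boolP (r \in `[0, t]%classic); last first.
        rewrite [\1_`[0, t] r]indicE (negbTE rt) mul0r mulr0 normr0.
        by case: ifP => // _; rewrite mule_ge0 ?lee_fin ?abse_ge0.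
      have -> : r \in `[0, n]%classic by apply/mem_set/(sub _ tn)/set_mem.
      by rewrite indicE rt mul1r lee_fin normrM ler_wpM2r.
pose FK t := (\int[mu]_r K (t, r))%E.
have iFK : mu.-integrable setT FK := integrable_fubini_F iK.
have iC r : 0 <= r -> mu.-integrable `[r, n] (EFin \o derive1 chi).
  move=> r0; apply: continuous_compact_integrable; first exact: segment_compact.
  exact: continuous_subspaceT.
have iC0 : mu.-integrable setT (fun t => (f 0)%:E * (\1_`[0, n] t * derive1 chi t)%:E)%E.
  apply: integrableZl => //; apply/integrable_indicM => //; exact: iC.
transitivity (\int[mu]_t (FK t + (f 0)%:E * (\1_`[0%R, n] t * derive1 chi t)%:E))%E.
  apply: ae_eq_integral => //.
  - by apply/measurable_EFinP; exact: measurable_funM.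
  - by apply: emeasurable_funD; [exact: (measurable_int _ iFK)|exact: (measurable_int _ iC0)].
  - apply: ae_imply ae_f => t Ht _.
    have [ts|ts] := boolP (t \in `[0, n]%classic); last first.
      rewrite /FK integral0_eq; last first.
        by move=> r _; rewrite /K/= [\1_`[0, n] t]indicE (negbTE ts) !mul0r.
      rewrite indicE (negbTE ts) mul0r mule0 adde0 chi'0 ?mulr0// => t0n.
      by move/negP: ts; apply; apply/mem_set; rewrite /= in_itv.
    have /andP[t0 tn] : 0 <= t <= n by move/set_mem: ts; rewrite /= in_itv.
    have -> : FK t = ((derive1 chi t)%:E * (f t - f 0)%:E)%E.
      transitivity ((derive1 chi t)%:E * \int[mu]_(r in `[0%R, t]) (f' r)%:E)%E.
        rewrite -[in RHS]integral_indicM -integralZl//.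
          by apply: eq_integral => r _; rewrite /K/= [\1_`[0, n] t]indicE ts mul1r EFinM.
        by apply/integrable_indicM => //; exact: if't.
      congr (_ * _)%E; move: t0; rewrite le_eqVlt => /predU1P[<-|t0].
        by rewrite set_itv1 integral_set1 subrr.
      by rewrite Ht.
    by rewrite indicE ts mul1r -!EFinM -EFinD; congr _%:E; ring.
rewrite (integralD measurableT iFK iC0) integralZl//; last first.
  by apply/integrable_indicM => //; exact: iC.
rewrite integral_indicM (ftc 0) ?lexx ?ltW// (chi0 0) ?ltxx// oppr0 mule0 adde0.
rewrite /FK (@Fubini _ _ _ _ R mu mu K iK).
(* For fixed r in [0, n] the variable t runs over [r, n], where the integral of the derivative of
   chi is - chi r. *)
have GE r : (\int[mu]_t K (t, r))%E = (- (f' r * chi r))%:E.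
  have [rs|rs] := boolP (r \in `[0, n]%classic); last first.
    have rn : ~ (0 <= r <= n).
      by move=> rn; move/negP: rs; apply; apply/mem_set; rewrite /= in_itv.
    rewrite chi0; last by move=> /andP[/ltW r0 /ltW rn']; apply: rn; rewrite r0.
    rewrite mulr0 oppr0 integral0_eq// => t _; rewrite /K/= !indic_itvcc.
    have [/andP[t0 tn]|_] := boolP (0 <= t <= n); last by rewrite !mul0r.
    case: (boolP (0 <= r <= t)) => [/andP[r0 rt]|_]; last by rewrite mul0r mulr0.
    by exfalso; apply: rn; rewrite r0 (le_trans rt).
  have rn : 0 <= r <= n by move/set_mem: rs; rewrite /= in_itv.
  have /andP[r0 _] := rn.
  transitivity ((f' r)%:E * \int[mu]_(t in `[r, n]) (derive1 chi t)%:E)%E; last first.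
    by rewrite (ftc r rn) -EFinM mulrN.
  rewrite -[in RHS]integral_indicM -integralZl//; last first.
    by apply/integrable_indicM => //; exact: iC.
  apply: eq_integral => t _; rewrite /K/= -EFinM; congr _%:E; rewrite !indic_itvcc r0/=.
  case: (leP r t) => rt; last by rewrite !(mul0r, mulr0).
  by rewrite (le_trans r0 rt)/=; ring.
rewrite (funext GE).
have [B' B'0 HB'] : exists2 B, 0 <= B & forall t, `|chi t| <= B.
  apply: bnd => // t tn; apply: chi0 => /andP[t0 t1]; apply: tn.
  by rewrite !ltW.
have ig : mu.-integrable setT (fun r => (f' r * chi r)%:E).
  have i0 : mu.-integrable setT (fun r => (\1_`[0, n] r * f' r)%:E).
    exact/integrable_indicM.
  apply: (le_integrable measurableT _ _ (integrableZl measurableT B' i0)) => //.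
    by apply/measurable_EFinP; exact: measurable_funM.
  move=> r _; rewrite /= lee_fin !normrM indic_itvcc (ger0_norm B'0).
  have [rn|rn] := boolP (0 <= r <= n); first by rewrite normr1 mul1r mulrC ler_wpM2r.
  rewrite chi0 ?normr0 ?mul0r ?mulr0 ?lexx// => /andP[/ltW r0 /ltW rn'].
  by move/negP: rn; apply; rewrite r0.
under eq_integral do rewrite EFinN.
by rewrite integralN//; exact: integrable_add_def.
Qed.

End weak_derivative_line.

(** * Periodic functions and H^1 of the circle *)

Section circle.
Context {R : realType}.
Local Notation mu := (@lebesgue_measure R).

Lemma ge0_integral_translate (b : R) (f : R -> \bar R) :
  measurable_fun [set: R] f -> (forall x, 0 <= f x)%E ->
  (\int[mu]_x f (x + b)%R = \int[mu]_x f x)%E.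
Proof.
move=> mf f0; have := ge0_integral_affine b ltr01 mf f0.
by rewrite invr1 mul1e => <-; apply: eq_integral => x _; rewrite mul1r.
Qed.

Lemma integral_translate (b : R) (f : R -> R) : measurable_fun [set: R] f ->
  (\int[mu]_x (f (x + b))%:E = \int[mu]_x (f x)%:E)%E.
Proof.
move=> /measurable_EFinP mf; rewrite [LHS]integralE [RHS]integralE.
rewrite -(ge0_integral_translate b (measurable_funepos mf) (funepos_ge0 _)).
rewrite -(ge0_integral_translate b (measurable_funeneg mf) (funeneg_ge0 _)).
by congr (_ - _)%E; apply: eq_integral => x _; rewrite ?funeposE ?funenegE.
Qed.

Lemma periodic2piD (f : R -> R) k t : periodic2pi f -> f (t + k%:R * (2 * pi)) = f t.
Proof.
move=> pf; elim: k => [|k IH]; first by rewrite mul0r addr0.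
by rewrite -natr1 mulrDl mul1r addrA pf.
Qed.

Lemma derive1_shift (chi : R -> R) (b t : R) :
  (forall s, derivable chi s 1) ->
  derivable (fun s => chi (s - b)) t 1 /\
  derive1 (fun s => chi (s - b)) t = derive1 chi (t - b).
Proof.
move=> dchi.
have d1 : is_derive t (1 : R) (fun s => s - b) 1.
  by apply: is_derive_eq; rewrite subr0.
have d2 : is_derive (t - b) (1 : R) chi (derive1 chi (t - b)).
  by rewrite derive1E; exact: derivableP.
have H := @is_derive1_comp _ chi (fun s => s - b) t _ _ d2 d1.
split; first by case: H.
by rewrite derive1E (@derive_val _ _ _ _ _ _ _ H) mulr1.
Qed.

(** The primitive is given for positive times only, while test functions live on the whole line. A
    translation by a multiple [b] of the period moves a compact set from (-b, b) into (0, 2b) and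
    leaves [f] and [f'] unchanged. *)
Lemma H1circ_primitive (f f' : R -> R) :
  periodic2pi f -> periodic2pi f' ->
  measurable_fun setT f -> measurable_fun setT f' ->
  (forall n, mu.-integrable `[0, n.+1%:R] (EFin \o f)) ->
  (forall n, mu.-integrable `[0, n.+1%:R] (EFin \o f')) ->
  {ae mu, forall t, 0 < t -> (f t - f 0)%:E = (\int[mu]_(r in `[0%R, t]) (f' r)%:E)%E} ->
  (\int[mu]_(t in @per R) (f' t ^+ 2)%:E < +oo)%E ->
  H1circ f f'.
Proof.
move=> pf pf' mf mf' if_ if' aef f'2.
have pi0 : 0 < 2 * pi :> R by rewrite mulr_gt0// pi_gt0.
have cov (K : set R) : compact K -> exists k : nat,
    forall t, K t -> - (k%:R * (2 * pi)) < t < k%:R * (2 * pi).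
  move=> /compact_bounded/ex_strict_bound_gt0[M M0 HM].
  exists (Num.truncn (M / (2 * pi))).+1 => t /HM /=.
  rewrite -ltr_norml => /lt_trans; apply.
  by rewrite -ltr_pdivrMr// truncnS_gt.
have I0 (h : R -> R) : (forall n, mu.-integrable `[0, n.+1%:R] (EFin \o h)) ->
    forall s, mu.-integrable `[0, s] (EFin \o h).
  move=> ih s; apply: integrableS (ih (Num.truncn s)) => //.
  move=> t /=; rewrite !in_itv/= => /andP[-> /le_trans]; apply.
  by rewrite ltW// truncnS_gt.
have I1 (h : R -> R) : periodic2pi h -> measurable_fun setT h ->
    (forall n, mu.-integrable `[0, n.+1%:R] (EFin \o h)) ->
    forall K, compact K -> mu.-integrable K (EFin \o h).
  move=> ph mh ih K cK; have [k Hk] := cov K cK.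
  set b := k%:R * (2 * pi) in Hk.
  apply: (@integrableS _ _ _ mu `[- b, b]) => //.
  - exact: compact_measurable.
  - by move=> t /Hk /andP[/ltW h1 /ltW h2]; rewrite /= in_itv/= h1.
  apply/integrableP; split; first by apply: measurable_funTS; exact/measurable_EFinP.
  have /integrableP[_] := I0 _ ih (2 * b).
  suff -> : (\int[mu]_(t in `[(- b)%R, b]) `|(EFin \o h) t| =
             \int[mu]_(t in `[0%R, (2 * b)%R]) `|(EFin \o h) t|)%E by [].
  pose H := (fun t => `|(h t)%:E|%E) \_ `[0, 2 * b].
  have mH : measurable_fun [set: R] H.
    apply/(measurable_restrictT _ _).1 => //; apply: measurable_funTS.
    by apply/measurable_EFinP; apply: measurableT_comp.
  have H0 t : (0 <= H t)%E by rewrite /H patchE; case: ifP.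
  rewrite [LHS]integral_mkcond [RHS]integral_mkcond -/H -(ge0_integral_translate b mH H0).
  apply: eq_integral => t _; rewrite /H !patchE /=.
  rewrite (periodic2piD k t ph).
  have -> : (t + b \in `[0, 2 * b]%classic) = (t \in `[- b, b]%classic).
    by apply/idP/idP; rewrite !inE/= !in_itv/= => /andP[h1 h2]; apply/andP; split; lra.
  by [].
split => //.
- by move=> K cK; split; exact: I1.
- move=> chi [schi [K [cK HK]]].
  have [k Hk] := cov K cK; set b := k%:R * (2 * pi) in Hk.
  have [cchi dchi] := schi 0%N.
  have [cchi' _] := schi 1%N.
  have [b0|b0] := ltP 0 b; last first.
    have chi0 t : chi t = 0.
      apply: HK => /Hk /andP[h1 h2].
      by move: (lt_trans h1 h2); rewrite ltNge => /negP; apply; lra.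
    have chi'0 t : derive1 chi t = 0.
      by rewrite (_ : chi = cst 0) ?derive1_cst//; exact/funext.
    rewrite !integral0_eq ?oppe0// => t _; by rewrite ?chi0 ?chi'0 mulr0.
  have E : derive1 (fun t => chi (t - b)) = fun t => derive1 chi (t - b).
    by apply/funext => t; have [] := derive1_shift b t dchi.
  have cE : continuous (fun t : R => derive1 chi (t - b)).
    move=> t; apply: (@continuous_comp _ _ _ (fun t => t - b) (derive1 chi)).
      by apply: cvgB; [exact: cvg_id|exact: cvg_cst].
    exact: cchi'.
  have mchi : measurable_fun [set: R] chi by exact: continuous_measurable_fun.
  have mS : measurable_fun [set: R] (fun t : R => t - b) by exact: measurable_funB.
  transitivity (\int[mu]_t (f t * derive1 chi (t - b))%:E)%E.
    rewrite -[RHS](integral_translate b).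
      by apply: eq_integral => t _; rewrite addrK (periodic2piD k t pf).
    by apply: measurable_funM => //; exact: continuous_measurable_fun.
  transitivity (- \int[mu]_t (f' t * chi (t - b))%:E)%E; last first.
    congr (- _)%E; rewrite -[LHS](integral_translate b).
      by apply: eq_integral => t _; rewrite addrK (periodic2piD k t pf').
    by apply: measurable_funM => //; exact: measurableT_comp.
  transitivity (\int[mu]_t (f t * derive1 (fun t => chi (t - b)) t)%:E)%E.
    by apply: eq_integral => t _; rewrite E.
  apply: (@weak_derivative_line _ f f' (fun t => chi (t - b)) (2 * b)).
  + by rewrite mulr_gt0.
  + exact: mf.
  + exact: mf'.
  + exact: I0.
  + exact: aef.
  + by move=> t; have [] := derive1_shift b t dchi.
  + by rewrite E.
  + move=> t tb; apply: HK => /Hk /andP[h1 h2]; apply: tb; apply/andP; split; lra.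
Qed.

End circle.

(** * Restriction to the orbits of the rotations *)

Section rotation.
Context {R : realType}.
Local Notation mu := (@lebesgue_measure R).
Local Notation leb := (lebesgue3 R).
Let T3 := (R * R * R)%type.

Lemma flow_rot_periodic t (x : T3) : flow 1 0 (t + 2 * pi) x = flow 1 0 t x.
Proof.
by rewrite /flow !mul0r !mul1r mulr_natl cosD2pi sinD2pi.
Qed.

Variables (u : T3 -> R) (g : 'I_3 -> T3 -> R).
Hypothesis mu_ : measurable_fun [set: T3] u.
Hypothesis iu : forall d M, 0 < d -> leb.-integrable (shell d M) (EFin \o u).
Hypothesis wg : forall j, weak_partial3 j u (g j).
Let G := dflow 1 0 g.
Let mG : measurable_fun [set: T3] G. Proof. exact: measurable_dflow wg. Qed.
Let iG d M : 0 < d -> leb.-integrable (shell d M) (EFin \o G).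
Proof. by move=> d0; apply: integrable_dflow => //; exact: wg. Qed.

Let J (p : T3 * R) : \bar R :=
  (\int[mu]_r (\1_`[0%R, p.2] r * G (flow 1 0 r p.1))%:E)%E.

Let mJ : measurable_fun [set: T3 * R] J.
Proof.
apply: (measurable_fun_integral_pair mu
  (f := fun q : (T3 * R) * R => (\1_`[0, q.1.2] q.2 * G (flow 1 0 q.2 q.1.1))%:E)).
apply/measurable_EFinP; apply: measurable_funM.
  by apply: measurable_indic_itv0 => //; exact: measurableT_comp.
have mp : measurable_fun [set: (T3 * R) * R] (fun q : (T3 * R) * R => (q.1.1, q.2)).
  by apply: measurable_fun_pair => //; exact: measurableT_comp.
exact: (measurableT_comp mG (measurableT_comp (measurable_flow2r 1 0) mp)).
Qed.

(** The failure of the flow identity at (x, t). For each t it vanishes for almost every x; its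
    integral over both variables is therefore zero, and Tonelli in the other order gives, for almost
    every x, the identity at almost every t. *)
Let defect (p : T3 * R) : \bar R :=
  (`|(\1_`]0%R, +oo[ p.2 * ((u (flow 1 0 p.2 p.1) - u p.1) - fine (J p)))%:E|)%E.

Let mdefect : measurable_fun [set: T3 * R] defect.
Proof.
apply: (measurableT_comp (@abse_measurable R setT)); apply/measurable_EFinP.
apply: measurable_funM.
  by apply: measurableT_comp => //; exact: measurable_indic.
apply: measurable_funB; last exact: (measurableT_comp (fine_measurable measurableT) mJ).
apply: measurable_funB; last exact: measurableT_comp.
exact: (measurableT_comp mu_ (measurable_flow2r 1 0)).
Qed.

Let defect_ge0 p : (0 <= defect p)%E. Proof. exact: abse_ge0. Qed.

Let integral_defect0 t : (\int[leb]_x defect (x, t) = 0)%E.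
Proof.
have [t0|t0] := ltP 0 t; last first.
  apply: integral0_eq => x _; rewrite /defect/= indicE.
  rewrite memNset ?mul0r ?normr0//= in_itv/= andbT => t0'.
  by move: (lt_le_trans t0' t0); rewrite ltxx.
have mdt : measurable_fun [set: T3] (fun x => defect (x, t)).
  by apply: (measurableT_comp mdefect); exact: measurable_fun_pair.
rewrite (ae_eq_integral (cst 0%E)) ?integral0//.
have H1 := flow_identity 1 (lexx 0) mu_ iu wg t0.
have H2 := ae_integrable_flow 1 (lexx 0) (ltW t0) mG iG.
apply: (ae_imply2 _ H1 H2) => x; rewrite -/G => E iE _.
rewrite /defect/= /J/= integral_indicM -E /= subrr mulr0 normr0//.
Qed.

Let ae_defect0 : {ae leb, forall x, {ae mu, forall t, defect (x, t) = 0%E}}.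
Proof.
have I0 : (\int[leb]_x \int[mu]_t defect (x, t) = 0)%E.
  rewrite (fubini_tonelli (m1 := leb) (m2 := mu) defect mdefect defect_ge0).
  by apply: integral0_eq => t _; exact: integral_defect0.
have mI : measurable_fun [set: T3] (fun x => \int[mu]_t defect (x, t))%E.
  exact: (measurable_fun_integral_pair mu mdefect).
have H : ae_eq leb setT (fun x => \int[mu]_t defect (x, t))%E (cst 0%E).
  apply/(ae_eq_integral_abs leb measurableT mI).
  rewrite -[RHS]I0; apply: eq_integral => x _.
  by rewrite gee0_abs//; exact: integral_ge0.
apply: ae_imply H => x /(_ Logic.I) /= Hx.
have mdx : measurable_fun [set: R] (fun t => defect (x, t)).
  by apply: (measurableT_comp mdefect); exact: measurable_fun_pair.
have Hd : ae_eq mu setT (fun t => defect (x, t)) (cst 0%E).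
  apply/(ae_eq_integral_abs mu measurableT mdx).
  by rewrite -[RHS]Hx; apply: eq_integral => t _; rewrite gee0_abs.
by apply: ae_imply Hd => t /(_ Logic.I).
Qed.

(** Finite energy of the orbit stays a premise: it is derived later, only on the orbits where the
    circle inequality has a finite right side. *)
Lemma ae_H1circ_flow : {ae leb, forall x,
  (\int[mu]_(t in @per R) (G (flow 1 0 t x) ^+ 2)%:E < +oo)%E ->
  H1circ (fun t => u (flow 1 0 t x)) (fun t => G (flow 1 0 t x))}.
Proof.
have A1 n := ae_integrable_flow 1 (lexx 0) (ltW (ltr0Sn R n)) mu_ iu.
have A2 n := ae_integrable_flow 1 (lexx 0) (ltW (ltr0Sn R n)) mG iG.
have /ae_foralln B1 := A1.
have /ae_foralln B2 := A2.
have B := ae_imply2 (fun x h1 h2 => conj h1 h2) B1 B2.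
apply: (ae_imply2 _ B ae_defect0) => x [h1 h2] h3 G2.
have mx : measurable_fun [set: R] (fun t => flow 1 0 t x).
  have mp : measurable_fun [set: R] (fun t : R => (t, x)) by exact: measurable_fun_pair.
  exact: (measurableT_comp (measurable_flow2 1 0) mp).
have i2 n : mu.-integrable `[0, n.+1%:R] (fun t => (G (flow 1 0 t x))%:E).
  by apply/(integrable_indicM mu _ _).1 => //; exact: h2.
apply: H1circ_primitive => //.
- by move=> t; rewrite flow_rot_periodic.
- by move=> t; rewrite flow_rot_periodic.
- exact: (measurableT_comp mu_ mx).
- exact: (measurableT_comp mG mx).
- by move=> n; apply/(integrable_indicM mu _ _).1 => //; exact: h1.
- apply: ae_imply h3 => t Ht t0; move: Ht.
  rewrite /defect/= indicE mem_set/= ?in_itv/= ?t0// mul1r => -[/eqP].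
  rewrite normr_eq0 subr_eq0 flow0 => /eqP ->.
  rewrite /J/= integral_indicM fineK//.
  have it : mu.-integrable `[0, t] (fun r => (G (flow 1 0 r x))%:E).
    apply: integrableS (i2 (Num.truncn t)) => //.
    move=> r /=; rewrite !in_itv/= => /andP[-> /le_trans]; apply.
    by rewrite ltW// truncnS_gt.
  exact: (integrable_fin_num _ it).
Qed.

End rotation.

(** * Hoelder's inequality for the uniform probability measure *)

Section circle_hoelder.
Context {R : realType}.
Local Notation mu := (@lebesgue_measure R).

(** The exponents p/(p-2) and p/2 are conjugate, so the two powers of the normalizing factor
    multiply to its first power. *)
Lemma hoelder_circle (p : R) (P S : R -> R) : 2 < p ->
  measurable_fun [set: R] P -> measurable_fun [set: R] S ->
  (forall t, 0 <= P t) -> (forall t, 0 <= S t) ->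
  ((2 * pi)^-1%:E * \int[mu]_(t in @per R) (P t * S t)%:E <=
   ((2 * pi)^-1%:E * \int[mu]_(t in @per R) (powR (P t) (p / (p - 2)))%:E) `^ ((p / (p - 2))^-1) *
   ((2 * pi)^-1%:E * \int[mu]_(t in @per R) (powR (S t) (p / 2))%:E) `^ (2 / p))%E.
Proof.
move=> p2 mP mS P0 S0.
have pgt0 : 0 < p by lra.
have p20 : 0 < p - 2 by lra.
set q := p / (p - 2); set k : R := (2 * pi)^-1.
have q0 : 0 < q by rewrite divr_gt0.
have k0 : 0 < k by rewrite invr_gt0 mulr_gt0// pi_gt0.
have mper : measurable (@per R) by exact: measurable_itv.
pose f t := \1_(@per R) t * P t; pose g t := \1_(@per R) t * S t.
have mf : measurable_fun [set: R] f by apply: measurable_funM => //; exact: measurable_indic.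
have mg : measurable_fun [set: R] g by apply: measurable_funM => //; exact: measurable_indic.
have pw (h : R -> R) r : 0 < r -> (forall t, 0 <= h t) ->
    (\int[mu]_t (`|(\1_(@per R) t * h t)%:E| `^ r) = \int[mu]_(t in @per R) (powR (h t) r)%:E)%E.
  move=> r0 h0; rewrite [RHS]integral_mkcond; apply: eq_integral => t _.
  rewrite patchE indicE; case: ifPn => _.
    by rewrite mul1r abse_EFin ger0_norm.
  by rewrite mul0r abse0 poweR_EFin powR0// gt_eqF.
have qp : q^-1 + (p / 2)^-1 = 1.
  by rewrite /q; field; rewrite !gt_eqF.
have ph0 : 0 < p / 2 by rewrite divr_gt0.
have := hoelder mu mf mg q0 ph0 qp.
rewrite Lnorm1 Lnorm.unlock (pw P q q0 P0) (pw S _ ph0 S0).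
rewrite (_ : (p / 2)^-1 = 2 / p); last by field; rewrite gt_eqF.
rewrite (_ : (\int[mu]_t `|(f t * g t)%:E| = \int[mu]_(t in @per R) (P t * S t)%:E)%E); last first.
  rewrite [RHS]integral_mkcond; apply: eq_integral => t _; rewrite patchE /f /g indicE.
  by case: ifPn => _; rewrite ?mul1r ?mul0r ?abse0// abse_EFin ger0_norm// mulr_ge0.
set A := (\int[mu]_(t in @per R) (powR (P t) q)%:E)%E.
set B := (\int[mu]_(t in @per R) (powR (S t) (p / 2))%:E)%E.
have A0 : (0 <= A)%E by apply: integral_ge0 => t _; rewrite lee_fin powR_ge0.
have B0 : (0 <= B)%E by apply: integral_ge0 => t _; rewrite lee_fin powR_ge0.
clearbody A B => HH.
have kE : (0 <= k%:E)%E by rewrite lee_fin ltW.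
rewrite (poweRM _ kE A0) (poweRM _ kE B0) !poweR_EFin muleACA -EFinM -powRD; last first.
  by rewrite (gt_eqF k0) implybT.
have -> : q^-1 + 2 / p = 1 by rewrite -[RHS]qp; congr (_ + _); field; rewrite gt_eqF.
rewrite powRr1 ?(ltW k0)//; apply: lee_wpmul2l => //.
Qed.

End circle_hoelder.

(** * The polar angle and its measurability *)

Section angle.
Context {R : realType}.

(** If s < t, then cos(t - s) = 1 although (t - s)/2 lies in (0, pi), where the sine is positive;
    the half-angle formula excludes this. *)
Lemma cos_sin_inj (s t : R) : 0 <= s < 2 * pi -> 0 <= t < 2 * pi ->
  cos s = cos t -> sin s = sin t -> s = t.
Proof.
wlog st : s t / s <= t.
  by move=> H hs ht c1 s1; have [st|/ltW st] := leP s t; [exact: H|apply/esym; exact: H].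
move=> /andP[s0 s1] /andP[t0 t1] cst sst.
apply/eqP; rewrite eq_le st/= leNgt; apply/negP => lts.
have c1 : cos (t - s) = 1 by rewrite cosB cst sst -!expr2 cos2Dsin2.
have : 0 < sin ((t - s) / 2) by apply: sin_gt0_pi; apply/andP; split; lra.
move: c1; rewrite (_ : t - s = (t - s) / 2 + (t - s) / 2); last by field.
rewrite cosD; have := cos2Dsin2 ((t - s) / 2).
rewrite (_ : ((t - s) / 2 + (t - s) / 2) / 2 = (t - s) / 2); last by field.
by move=> h1 h2 h3; nra.
Qed.

Lemma angle_exists (y1 y2 : R) : exists t, [/\ 0 <= t, t < 2 * pi,
  cos t * Num.sqrt (y1 ^+ 2 + y2 ^+ 2) = y1 & sin t * Num.sqrt (y1 ^+ 2 + y2 ^+ 2) = y2].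
Proof.
have p0 := pi_gt0 R.
set r := Num.sqrt _.
have r2 : r ^+ 2 = y1 ^+ 2 + y2 ^+ 2 by rewrite sqr_sqrtr// addr_ge0// sqr_ge0.
have r0 : 0 <= r by exact: sqrtr_ge0.
have [re|rn0] := eqVneq r 0.
  move: r2; rewrite re expr0n/= => /esym/eqP.
  rewrite paddr_eq0 ?sqr_ge0// !sqrf_eq0 => /andP[/eqP -> /eqP ->].
  by exists 0; rewrite !mulr0; split => //; lra.
have rgt0 : 0 < r by rewrite lt_neqAle eq_sym rn0.
have b1 : -1 <= y1 / r <= 1.
  rewrite ler_pdivlMr// ler_pdivrMr// mulN1r mul1r.
  by apply/andP; split; nra.
have ca : cos (acos (y1 / r)) = y1 / r by rewrite acosK// in_itv.
have sa : sin (acos (y1 / r)) * r = `|y2|.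
  rewrite sin_acos// -[X in _ * X]ger0_norm// -sqrtr_sqr -sqrtrM.
    rewrite -sqrtr_sqr; congr Num.sqrt.
    have -> : y2 ^+ 2 = r ^+ 2 - y1 ^+ 2 by rewrite r2; ring.
    by field.
  by case/andP: b1 => b1 b2; rewrite subr_ge0; nra.
have a0 := acos_ge0 b1; have a1 := acos_lepi b1.
have [y20|y20] := leP 0 y2.
  exists (acos (y1 / r)); split => //; first lra.
    by rewrite ca divfK.
  by rewrite sa ger0_norm.
exists (2 * pi - acos (y1 / r)); split; first lra.
- rewrite ltrBlDr ltrDl lt_neqAle a0 andbT; apply/eqP => a00.
  by move: sa; rewrite -a00 sin0 mul0r => /esym/eqP; rewrite normr_eq0 (lt_eqF y20).
- rewrite cosB (mulr_natl pi) cos2pi sin2pi mul1r mul0r addr0 ca divfK//.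
- rewrite sinB (mulr_natl pi) cos2pi sin2pi mul1r mul0r sub0r mulNr sa.
  by rewrite ltr0_norm// opprK.
Qed.

Lemma angleP (y1 y2 : R) : [/\ 0 <= angle y1 y2, angle y1 y2 < 2 * pi,
  cos (angle y1 y2) * Num.sqrt (y1 ^+ 2 + y2 ^+ 2) = y1 &
  sin (angle y1 y2) * Num.sqrt (y1 ^+ 2 + y2 ^+ 2) = y2].
Proof.
have [t Ht] := angle_exists y1 y2.
rewrite /angle; case: xgetP => [s _ //|/(_ t)]; by [].
Qed.

Lemma angle_per (y1 y2 : R) : per (angle y1 y2).
Proof. by have [h1 h2 _ _] := angleP y1 y2; rewrite /per/= in_itv/= h1 ltW. Qed.

Lemma angle_scale (r y1 y2 : R) : 0 < r -> angle (r * y1) (r * y2) = angle y1 y2.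
Proof.
move=> r0; rewrite /angle; congr xget; apply/seteqP.
have E : Num.sqrt ((r * y1) ^+ 2 + (r * y2) ^+ 2) = r * Num.sqrt (y1 ^+ 2 + y2 ^+ 2).
  by rewrite !exprMn -mulrDr sqrtrM ?sqr_ge0// sqrtr_sqr gtr0_norm.
rewrite E; split => t /= [h1 h2 h3 h4]; split => //.
- by apply: (mulfI (lt0r_neq0 r0)); rewrite mulrCA.
- by apply: (mulfI (lt0r_neq0 r0)); rewrite mulrCA.
- by rewrite mulrCA h3.
- by rewrite mulrCA h4.
Qed.

Lemma angle_cos_sin (s : R) : 0 <= s < 2 * pi -> angle (cos s) (sin s) = s.
Proof.
move=> hs; have [h1 h2] := angleP (cos s) (sin s).
rewrite cos2Dsin2 sqrtr1 !mulr1 => h3 h4.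
by apply: cos_sin_inj => //; rewrite h1.
Qed.

(** Off the origin the angle is the arccosine of y1 / r, or 2 pi minus it, according to the sign of
    y2. *)
Lemma measurable_angle : measurable_fun [set: R * R] (fun y : R * R => angle y.1 y.2).
Proof.
pose r (y : R * R) := Num.sqrt (y.1 ^+ 2 + y.2 ^+ 2).
pose c (y : R * R) := y.1 / r y.
have mr : measurable_fun [set: R * R] r.
  apply: measurableT_comp.
    by apply: continuous_measurable_fun; exact: sqrt_continuous.
  by apply: measurable_funD; apply: measurable_funX.
have mc : measurable_fun [set: R * R] c.
  by apply: measurable_funM => //; exact: measurable_funVr.
have macos : measurable_fun (`[(-1 : R), 1]%classic : set (measurableTypeR R)) (@acos R).
  (* Continuity of the arccosine is used on the open interval; the endpoints are singletons. *)
  have -> : `[(-1 : R), 1]%classic = [set -1] `|` (`]-1, 1[ `|` [set 1]) :> set (measurableTypeR R).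
    apply/seteqP; split => t /=; rewrite !in_itv/=.
      move=> /andP[]; rewrite le_eqVlt => /predU1P[<-|h1]; first by left.
      by rewrite le_eqVlt => /predU1P[->|h2]; right; [right|left; rewrite h1].
    by case=> [->|[/andP[h1 h2]|->]]; apply/andP; split; lra.
  apply/measurable_funU => //; first exact: measurableU.
  split; first exact: measurable_fun_set1.
  apply/measurable_funU => //; split; last exact: measurable_fun_set1.
  apply: open_continuous_measurable_fun; first exact: interval_open.
  by move=> t; rewrite inE/= in_itv/= => ht; exact: continuous_acos.
have cb y : -1 <= c y <= 1.
  have [h1 h2 h3 h4] := angleP y.1 y.2.
  rewrite /c -/(r y) in h3 *.
  have [->|r0] := eqVneq (r y) 0; first by rewrite invr0 mulr0; apply/andP; split; lra.
  by rewrite -h3 mulfK// cos_geN1 cos_le1.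
have mac : measurable_fun [set: R * R] (fun y => acos (c y)).
  apply: (measurable_comp _ _ macos mc) => //.
  by move=> _ [y _ <-]; rewrite /= in_itv/=; exact: (cb y).
have E y : angle y.1 y.2 = if r y == 0 then angle 0 0 else
    if y.2 < 0 then 2 * pi - acos (c y) else acos (c y).
  have [h1 h2 h3 h4] := angleP y.1 y.2; rewrite -/(r y) in h3 h4.
  have [r0|r0] := eqVneq (r y) 0.
    by move: h3 h4; rewrite r0 !mulr0 => /esym -> /esym ->.
  have rgt0 : 0 < r y by rewrite lt_neqAle eq_sym r0 sqrtr_ge0.
  have cE : c y = cos (angle y.1 y.2).
    by apply: (mulIf r0); rewrite divfK// h3.
  rewrite cE; case: (ltP y.2 0) => y2.
    have s0 : sin (angle y.1 y.2) < 0 by rewrite -(pmulr_llt0 _ rgt0) h4.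
    have ap : pi < angle y.1 y.2.
      by rewrite ltNge; apply/negP => h; move: s0; rewrite ltNge sin_ge0_pi// h1.
    rewrite -[cos _]cosN -[cos _]cosD2pi cosK; last by rewrite in_itv/=; apply/andP; split; lra.
    by rewrite -mulr_natl; lra.
  have s0 : 0 <= sin (angle y.1 y.2) by rewrite -(pmulr_lge0 _ rgt0) h4.
  rewrite cosK// in_itv/= h1/= leNgt; apply/negP => h.
  have : 0 < sin (angle y.1 y.2 - pi) by apply: sin_gt0_pi; apply/andP; split; lra.
  by rewrite sinB cospi sinpi mulr0 subr0 mulrN1 => ?; lra.
rewrite (funext E); apply: measurable_fun_ifT => //.
  exact: measurable_fun_eqr.
by apply: measurable_fun_ifT => //; [exact: measurable_fun_ltr|exact: measurable_funB].
Qed.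

End angle.

(** * Averaging over rotations *)

Section rotation_invariance.
Context {R : realType}.
Local Notation mu := (@lebesgue_measure R).
Local Notation leb := (lebesgue3 R).
Let T3 := (R * R * R)%type.

Lemma ge0_integral_itv_translate (h : R -> R) (c d b : R) :
  measurable_fun [set: R] h -> (forall t, 0 <= h t) ->
  (\int[mu]_(t in `[c, d[) (h (t + b)%R)%:E = \int[mu]_(t in `[(c + b)%R, (d + b)%R[) (h t)%:E)%E.
Proof.
move=> mh h0; rewrite -integral_indicM -[in RHS]integral_indicM.
rewrite -[in RHS](@ge0_integral_translate R b); first last.
- by move=> t; rewrite lee_fin; apply: mulr_ge0 => //; rewrite indicE.
- by apply/measurable_EFinP; apply: measurable_funM => //; exact: measurable_indic.
apply: eq_integral => t _; congr ((_ * _)%:E).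
by rewrite !indicE !mem_setE !in_itv/= lerD2r ltrD2r.
Qed.

(** The part of the shifted interval beyond 2 pi is moved back by one period; half-open intervals
    make the pieces disjoint. *)
Lemma ge0_integral_per_shift (h : R -> R) (al : R) :
  measurable_fun [set: R] h -> (forall t, 0 <= h t) -> periodic2pi h ->
  0 <= al <= 2 * pi ->
  (\int[mu]_(t in @per R) (h (t + al)%R)%:E = \int[mu]_(t in @per R) (h t)%:E)%E.
Proof.
move=> mh h0 ph /andP[a0 a1].
have mhE : measurable_fun [set: R] (EFin \o h) by exact/measurable_EFinP.
have msE : measurable_fun [set: R] (fun t => (h (t + al))%:E).
  by apply/measurable_EFinP; apply: measurableT_comp => //; exact: measurable_funD.
have split_itv (x y z : R) : x <= y -> y <= z ->
    (\int[mu]_(t in `[x, z[) (h t)%:E =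
     \int[mu]_(t in `[x, y[) (h t)%:E + \int[mu]_(t in `[y, z[) (h t)%:E)%E.
  move=> xy yz; rewrite -(@ge0_integral_setU _ _ R mu `[x, y[ `[y, z[) //.
  - congr (integral _ _ _); apply/seteqP; split => t /=; rewrite !in_itv/=.
      by move=> /andP[-> ->]; have [ty|ty] := ltP t y; [left|right].
    by case=> /andP[h1 h2]; apply/andP; split => //; [exact: lt_le_trans yz|exact: le_trans h1].
  - exact: (measurable_funS measurableT).
  - by move=> t _; rewrite lee_fin.
  - apply/disj_setPS => t [] /=; rewrite !in_itv/= => /andP[_ h1] /andP[h2 _].
    by move: h2; rewrite leNgt h1.
rewrite /per -integral_itv_bndo_bndc; last exact: (measurable_funS measurableT).
rewrite -[in RHS]integral_itv_bndo_bndc; last exact: (measurable_funS measurableT).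
rewrite ge0_integral_itv_translate// add0r (split_itv al (2 * pi))//; last by rewrite lerDl.
rewrite [in RHS](split_itv 0 al)// addeC; congr (_ + _)%E.
rewrite -{1}[2 * pi]add0r [2 * pi + al]addrC -ge0_integral_itv_translate//.
by apply: eq_integral => t _; rewrite ph.
Qed.

(** On the right, [angle] applied to a cosine and sine reduces t plus the initial angle modulo 2 pi,
    so that the expression is visibly periodic in t. *)
Lemma flow_rot_angle t (x : T3) : Omega x ->
  angle (x1 (flow 1 0 t x)) (x2 (flow 1 0 t x)) =
  angle (cos (t + angle (x1 x) (x2 x))) (sin (t + angle (x1 x) (x2 x))).
Proof.
move=> Ox; have [_ _] := angleP (x1 x) (x2 x).
rewrite -/(rho2 x); set r := Num.sqrt _; set al := angle _ _ => ec es.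
have r0 : 0 < r.
  by rewrite sqrtr_gt0 lt_neqAle eq_sym Ox addr_ge0// sqr_ge0.
rewrite -[RHS](angle_scale _ _ r0) cosD sinD.
clearbody r al; move: ec es; rewrite /x1 /x2/= mul0r expR0 !mul1r => <- <-.
by congr angle; ring.
Qed.

Lemma integral_angle_flow (phi : R -> R) (q : R) (x : T3) : 0 < q ->
  measurable_fun (@per R) phi -> Omega x ->
  (\int[mu]_(t in @per R)
     (powR `|phi (angle (x1 (flow 1 0 t x)) (x2 (flow 1 0 t x)))| q)%:E =
   \int[mu]_(t in @per R) (powR `|phi t| q)%:E)%E.
Proof.
move=> q0 mphi Ox.
(* The periodic extension of |phi|^q, measurable on the whole line although [phi] is measurable on
   one period only. *)
pose h t := powR `|phi (angle (cos t) (sin t))| q.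
have mcs : measurable_fun [set: R] (fun t => angle (cos t) (sin t)).
  have mp : measurable_fun [set: R] (fun t : R => (cos t, sin t)); last first.
    exact: (measurableT_comp (@measurable_angle R) mp).
  apply: measurable_fun_pair; apply: continuous_measurable_fun => ?;
    [exact: continuous_cos|exact: continuous_sin].
have mh0 : measurable_fun [set: R] (fun t => phi (angle (cos t) (sin t))).
  apply: (measurable_comp _ _ mphi mcs); first exact: measurable_itv.
  by move=> _ [t _ <-]; exact: angle_per.
have mh : measurable_fun [set: R] h.
  by apply: (@measurableT_comp _ _ _ _ _ _ (fun s => powR s q)) => //; exact: measurableT_comp.
have -> : (\int[mu]_(t in @per R)
     (powR `|phi (angle (x1 (flow 1 0 t x)) (x2 (flow 1 0 t x)))| q)%:E =
   \int[mu]_(t in @per R) (h (t + angle (x1 x) (x2 x)))%:E)%E.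
  by apply: eq_integral => t _; rewrite flow_rot_angle.
have [a0 a1 _ _] := angleP (x1 x) (x2 x).
rewrite (ge0_integral_per_shift mh (fun t => powR_ge0 _ _)); first last.
- by rewrite a0 (ltW a1).
- by move=> t; rewrite /h (mulr_natl pi) cosD2pi sinD2pi.
- rewrite /per -integral_itv_bndo_bndc; last first.
    by apply: (measurable_funS measurableT) => //; exact/measurable_EFinP.
  rewrite -[in RHS]integral_itv_bndo_bndc; last first.
    apply: (@measurable_funS _ _ _ _ (@per R)); first exact: measurable_itv.
      by move=> t; rewrite /per/= !in_itv/= => /andP[-> /ltW].
    apply/measurable_EFinP; apply: (@measurableT_comp _ _ _ _ _ _ (fun s => powR s q)) => //.
    exact: measurableT_comp.
  by apply: eq_integral => t; rewrite inE/= in_itv/= => ht; rewrite /h angle_cos_sin.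
Qed.

Let k (h : T3 -> R) (w : T3 * R) := (\1_(@per R) w.2 * h (flow 1 0 w.2 w.1))%:E.

Let mk h : measurable_fun [set: T3] h -> measurable_fun [set: T3 * R] (k h).
Proof.
move=> mh; apply/measurable_EFinP; apply: measurable_funM.
  have mper : measurable (@per R) by exact: measurable_itv.
  exact: (measurableT_comp (measurable_indic mper) measurable_snd).
exact: (measurableT_comp mh (measurable_flow2r 1 0)).
Qed.

Lemma measurable_integral_rot (h : T3 -> R) : measurable_fun [set: T3] h ->
  measurable_fun [set: T3] (fun x => \int[mu]_(t in @per R) (h (flow 1 0 t x))%:E)%E.
Proof.
move=> /mk/(measurable_fun_integral_pair mu); apply: eq_measurable_fun => x _.
by rewrite /k integral_indicM.
Qed.

Lemma measurable_rot (h : T3 -> R) x : measurable_fun [set: T3] h ->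
  measurable_fun [set: R] (fun t => h (flow 1 0 t x)).
Proof.
move=> mh; have mp : measurable_fun [set: R] (fun t : R => (x, t)).
  exact: measurable_fun_pair.
exact: (measurableT_comp mh (measurableT_comp (measurable_flow2r 1 0) mp)).
Qed.

(** Each rotation preserves the integral, hence so does their average; this takes the place of
    cylindrical coordinates. *)
Lemma ge0_integral_average_rot (h : T3 -> R) : measurable_fun [set: T3] h ->
  (forall x, 0 <= h x) ->
  (\int[leb]_x (h x)%:E = (2 * pi)^-1%:E *
   \int[leb]_x \int[mu]_(t in @per R) (h (flow 1 0 t x))%:E)%E.
Proof.
move=> mh h0; have mper : measurable (@per R) by exact: measurable_itv.
have k0 w : (0 <= k h w)%E.
  have i0 : 0 <= \1_(@per R) w.2 :> R by rewrite indicE.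
  by rewrite /k lee_fin (mulr_ge0 i0 (h0 _)).
transitivity ((2 * pi)^-1%:E * \int[leb]_x \int[mu]_t k h (x, t))%E; last first.
  by congr (_ * _)%E; apply: eq_integral => x _; rewrite /k integral_indicM.
rewrite (@fubini_tonelli _ _ _ _ R leb mu (k h) (mk mh) k0).
have p0 := pi_gt0 R.
have mhE : measurable_fun [set: T3] (fun x => (h x)%:E) by exact/measurable_EFinP.
have hE0 x : (0 <= (h x)%:E)%E by rewrite lee_fin.
set I := (\int[leb]_x (h x)%:E)%E.
have I0 : (0 <= I)%E by apply: integral_ge0.
have E t : (\int[leb]_x k h (x, t) = I * (\1_(@per R) t)%:E)%E.
  rewrite muleC -[I]mul1e (_ : 1%E = (expR (- (3 * 0 * t)))%:E); last by rewrite mulr0 mul0r oppr0 expR0.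
  rewrite -(ge0_integral_flow 1 0 t mhE hE0) -ge0_integralZl_EFin//.
  - exact: (measurableT_comp mhE (measurable_flow 1 0 t)).
under eq_integral do rewrite E.
have mI : measurable_fun [set: R] (fun t => (\1_(@per R) t : R)%:E).
  by apply/measurable_EFinP; exact: measurable_indic.
have e0 t : (0 <= (\1_(@per R) t : R)%:E)%E by rewrite lee_fin indicE.
transitivity ((2 * pi)^-1%:E * (I * \int[mu]_t (\1_(@per R) t : R)%:E))%E; last first.
  by congr (_ * _)%E; apply/esym; exact: (ge0_integralZl mu measurableT mI (fun t _ => e0 t) I0).
have muper : (mu (@per R) = (2 * pi)%:E)%E.
  by rewrite /per lebesgue_measure_itv/= lte_fin mulr_gt0// sube0.
rewrite integral_indic// setIT.
rewrite [X in _ = (_ * (_ * X))%E](muper) muleCA -EFinM mulVf ?mule1//.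
by rewrite gt_eqF// mulr_gt0.
Qed.

Lemma integral_rot_rho2 (h : T3 -> R) x : measurable_fun [set: T3] h ->
  (forall x, 0 <= h x) ->
  (\int[mu]_(t in @per R) (h (flow 1 0 t x) / rho2 (flow 1 0 t x))%:E =
   (rho2 x)^-1%:E * \int[mu]_(t in @per R) (h (flow 1 0 t x))%:E)%E.
Proof.
move=> mh h0; rewrite -ge0_integralZl_EFin//.
- by apply: eq_integral => t _; rewrite rho2_flow mul0r expR0 expr1n mul1r mulrC EFinM.
- exact: measurable_itv.
- by move=> t _; rewrite lee_fin.
- by apply: (measurable_funS measurableT) => //; apply/measurable_EFinP; exact: measurable_rot.
- by rewrite invr_ge0 addr_ge0// sqr_ge0.
Qed.

End rotation_invariance.

(** * The weighted inequality on one orbit *)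

Section circle_inequality.
Context {R : realType}.
Local Notation mu := (@lebesgue_measure R).

(** The predicate under the supremum in [mu_ap], isolated so that estimates can be proved for one
    real constant at a time. *)
Definition circle_admissible (a p m : R) : Prop :=
  forall f f' g g' : R -> R, H1circ f f' -> H1circ g g' ->
    (m%:E * Lpcirc_sq p f g <=
     L2circ_sq (fun t => f' t + a * g t)%R (fun t => g' t - a * f t)%R)%E.

(** If the energy on the right is infinite the bound is trivial. Otherwise it controls f' and g'
    together with the L^2 norm of the orbit, which opens the premises giving membership in H^1;
    admissibility then follows Hoelder's inequality. *)
Lemma circle_admissible_weight (a p m N : R) (f f' g g' P : R -> R) :
  2 < p -> 0 <= m -> circle_admissible a p m -> 0 < N ->
  measurable_fun [set: R] f -> measurable_fun [set: R] f' ->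
  measurable_fun [set: R] g -> measurable_fun [set: R] g' ->
  measurable_fun [set: R] P -> (forall t, 0 <= P t) ->
  (((2 * pi)^-1%:E * \int[mu]_(t in @per R) (powR (P t) (p / (p - 2)))%:E)
     `^ ((p / (p - 2))^-1) = N%:E)%E ->
  (\int[mu]_(t in @per R) (f t ^+ 2 + g t ^+ 2)%:E < +oo)%E ->
  ((\int[mu]_(t in @per R) (f' t ^+ 2)%:E < +oo)%E -> H1circ f f') ->
  ((\int[mu]_(t in @per R) (g' t ^+ 2)%:E < +oo)%E -> H1circ g g') ->
  (m%:E * ((2 * pi)^-1%:E * \int[mu]_(t in @per R) (P t * (f t ^+ 2 + g t ^+ 2))%:E) <=
   N%:E * L2circ_sq (fun t => f' t + a * g t)%R (fun t => g' t - a * f t)%R)%E.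
Proof.
move=> p2 m0 adm N0 mf mf' mg mg' mP P0 PN fg Hf Hg.
have mper : measurable (@per R) by exact: measurable_itv.
have mS : measurable_fun [set: R] (fun t => f t ^+ 2 + g t ^+ 2).
  by apply: measurable_funD; apply: measurable_funX.
have mD : measurable_fun [set: R] (fun t => (f' t + a * g t) ^+ 2 + (g' t - a * f t) ^+ 2).
  apply: measurable_funD; apply: measurable_funX.
    by apply: measurable_funD => //; exact: measurable_funM.
  by apply: measurable_funB => //; exact: measurable_funM.
have S0 t : 0 <= f t ^+ 2 + g t ^+ 2 by rewrite addr_ge0// sqr_ge0.
have D0 t : 0 <= (f' t + a * g t) ^+ 2 + (g' t - a * f t) ^+ 2 by rewrite addr_ge0// sqr_ge0.
set B := L2circ_sq _ _.
have k0 : 0 < (2 * pi)^-1 :> R by rewrite invr_gt0 mulr_gt0// pi_gt0.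
have [->|Boo] := eqVneq B +oo%E; first by rewrite gt0_muley ?lte_fin// leey.
have Doo : (\int[mu]_(t in @per R) ((f' t + a * g t) ^+ 2 + (g' t - a * f t) ^+ 2)%:E < +oo)%E.
  rewrite ltey; apply/eqP => Dy; move: Boo; rewrite /B /L2circ_sq Dy.
  by rewrite gt0_muley ?lte_fin// eqxx.
have bound (h : R -> R) : measurable_fun [set: R] h ->
    (forall t, h t ^+ 2 <= 2 * ((f' t + a * g t) ^+ 2 + (g' t - a * f t) ^+ 2)
                           + 2 * a ^+ 2 * (f t ^+ 2 + g t ^+ 2)) ->
    (\int[mu]_(t in @per R) (h t ^+ 2)%:E < +oo)%E.
  move=> mh hb.
  have mres (F : R -> R) : measurable_fun [set: R] F ->
      measurable_fun (@per R) (fun t => (F t)%:E).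
    by move=> mF; apply: (measurable_funS measurableT) => //; exact/measurable_EFinP.
  apply: (@le_lt_trans _ _ (\int[mu]_(t in @per R)
     ((2 * ((f' t + a * g t) ^+ 2 + (g' t - a * f t) ^+ 2))%:E +
      (2 * a ^+ 2 * (f t ^+ 2 + g t ^+ 2))%:E))%E).
    apply: ge0_le_integral => //.
    - by move=> t _; rewrite lee_fin sqr_ge0.
    - by apply: mres; exact: measurable_funX.
    - by apply: emeasurable_funD; apply: mres; exact: measurable_funM.
    - by move=> t _; rewrite lee_fin.
  have aa : 0 <= 2 * a ^+ 2 :> R by rewrite mulr_ge0// sqr_ge0.
  rewrite ge0_integralD//; last first.
  - by apply: mres; exact: measurable_funM.
  - by move=> t _; rewrite lee_fin; exact: mulr_ge0.
  - by apply: mres; exact: measurable_funM.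
  - by move=> t _; rewrite lee_fin; exact: mulr_ge0.
  under eq_integral do rewrite EFinM.
  under [X in (_ + X)%E]eq_integral do rewrite EFinM.
  rewrite ge0_integralZl_EFin//; [|by move=> t _; rewrite lee_fin|exact: mres].
  rewrite ge0_integralZl_EFin//; [|by move=> t _; rewrite lee_fin|exact: mres].
  by apply: lte_add_pinfty; apply: lte_mul_pinfty => //; rewrite lee_fin.
have H1 : (\int[mu]_(t in @per R) (f' t ^+ 2)%:E < +oo)%E.
  (* 2 (f' + a g)^2 + 2 a^2 g^2 - f'^2 is exactly the square (f' + 2 a g)^2; the case of g' is
     symmetric. *)
  apply: bound => // t; have := sqr_ge0 (f' t + 2 * a * g t).
  have := sqr_ge0 (g' t - a * f t); have := sqr_ge0 (a * f t); lra.
have H2 : (\int[mu]_(t in @per R) (g' t ^+ 2)%:E < +oo)%E.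
  apply: bound => // t; have := sqr_ge0 (g' t - 2 * a * f t).
  have := sqr_ge0 (f' t + a * g t); have := sqr_ge0 (a * g t); lra.
have := hoelder_circle p2 mP mS P0 S0; rewrite PN => HH.
have m0E : (0 <= m%:E)%E by rewrite lee_fin.
have N0E : (0 <= N%:E)%E by rewrite lee_fin ltW.
apply: (le_trans (lee_wpmul2l m0E HH)).
rewrite muleCA; apply: lee_wpmul2l => //.
exact: adm (Hf H1) (Hg H2).
Qed.

End circle_inequality.

(** * The angular inequality in R^3 *)

Section angular_inequality.
Context {R : realType}.
Local Notation mu := (@lebesgue_measure R).
Local Notation leb := (lebesgue3 R).
Let T3 := (R * R * R)%type.
Variables (a p : R) (phi : R -> R) (u v : T3 -> R) (gu gv : 'I_3 -> T3 -> R).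
Hypotheses (p2 : 2 < p) (mphi : measurable_fun (@per R) phi).
Hypotheses (mu_ : measurable_fun [set: T3] u) (mv_ : measurable_fun [set: T3] v).
Hypothesis iu : forall d M, 0 < d -> leb.-integrable (shell d M) (EFin \o u).
Hypothesis iv : forall d M, 0 < d -> leb.-integrable (shell d M) (EFin \o v).
Hypothesis wu : forall j, weak_partial3 j u (gu j).
Hypothesis wv : forall j, weak_partial3 j v (gv j).
Hypothesis uv2 : (\int[leb]_x (u x ^+ 2 + v x ^+ 2)%:E < +oo)%E.
Local Notation S := (fun x => u x ^+ 2 + v x ^+ 2).
(** Along an orbit this is |psi' - i a psi|^2; divided by [rho2] it is the squared angular component
    of the magnetic gradient. *)
Local Notation D := (fun x => (dflow 1 0 gu x + a * v x) ^+ 2 + (dflow 1 0 gv x - a * u x) ^+ 2).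
Local Notation aphi := (fun x : T3 => `|phi (angle (x1 x) (x2 x))|).

Let mS : measurable_fun [set: T3] S.
Proof. by apply: measurable_funD; apply: measurable_funX. Qed.

Let S0 x : 0 <= S x. Proof. by rewrite addr_ge0// sqr_ge0. Qed.

Let mGu : measurable_fun [set: T3] (dflow 1 0 gu).
Proof. by apply: measurable_dflow => j; case: (wu j). Qed.

Let mGv : measurable_fun [set: T3] (dflow 1 0 gv).
Proof. by apply: measurable_dflow => j; case: (wv j). Qed.

Lemma measurable_phi_angle :
  measurable_fun [set: T3] (fun x : T3 => phi (angle (x1 x) (x2 x))).
Proof.
have ma : measurable_fun [set: T3] (fun x : T3 => angle (x1 x) (x2 x)).
  exact: (measurableT_comp (@measurable_angle R) measurable_fst).
apply: (measurable_comp _ _ mphi ma); first exact: measurable_itv.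
by move=> _ [x _ <-]; exact: angle_per.
Qed.

Let maphi : measurable_fun [set: T3] aphi.
Proof. exact: (measurableT_comp _ measurable_phi_angle). Qed.

Lemma ae_integral_rot_lty (h : T3 -> R) : measurable_fun [set: T3] h ->
  (forall x, 0 <= h x) -> (\int[leb]_x (h x)%:E < +oo)%E ->
  {ae leb, forall x, (\int[mu]_(t in @per R) (h (flow 1 0 t x))%:E < +oo)%E}.
Proof.
move=> mh h0; rewrite ge0_integral_average_rot// => hoo.
have k0 : 0 < (2 * pi)^-1 :> R by rewrite invr_gt0 mulr_gt0// pi_gt0.
have J0 x : (0 <= \int[mu]_(t in @per R) (h (flow 1 0 t x))%:E)%E.
  by apply: integral_ge0 => t _; rewrite lee_fin.
have iJ : leb.-integrable setT (fun x => \int[mu]_(t in @per R) (h (flow 1 0 t x))%:E)%E.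
  apply/integrableP; split; first exact: measurable_integral_rot.
  under eq_integral do rewrite gee0_abs//.
  rewrite ltey; apply/eqP => E; move: hoo; rewrite E gt0_muley ?lte_fin//.
apply: ae_imply (integrable_ae measurableT iJ) => x /(_ I).
by rewrite ge0_fin_numE.
Qed.

Lemma ae_angular_inequality (m N : R) : 0 <= m -> circle_admissible a p m ->
  0 < N -> Lqcirc (p / (p - 2)) phi = N%:E ->
  {ae leb, forall x,
   (m%:E * ((2 * pi)^-1%:E * \int[mu]_(t in @per R) (aphi (flow 1 0 t x) * S (flow 1 0 t x))%:E) <=
    N%:E * ((2 * pi)^-1%:E * \int[mu]_(t in @per R) (D (flow 1 0 t x))%:E))%E}.
Proof.
move=> m0 adm N0 LN.
have A1 := ae_H1circ_flow mu_ iu wu.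
have A2 := ae_H1circ_flow mv_ iv wv.
have A3 := ae_integral_rot_lty mS S0 uv2.
have A12 := ae_imply2 (fun x h1 h2 => conj h1 h2) A1 A2.
have A03 := ae_imply2 (fun x h1 h2 => conj h1 h2) (@ae_Omega R) A3.
apply: ae_imply2 A12 A03 => x [h1 h2] [Ox h3].
have q0 : 0 < p / (p - 2).
  apply: divr_gt0; last by rewrite subr_gt0.
  exact: lt_trans p2.
apply: (circle_admissible_weight p2 m0 adm N0 (measurable_rot x mu_)
  (measurable_rot x mGu) (measurable_rot x mv_) (measurable_rot x mGv)
  (measurable_rot x maphi) (fun t => normr_ge0 _) _ h3 h1 h2).
by rewrite integral_angle_flow// -LN.
Qed.

Lemma angular_inequality (m N : R) : 0 <= m -> circle_admissible a p m ->
  0 < N -> Lqcirc (p / (p - 2)) phi = N%:E ->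
  (m%:E * \int[leb]_x (aphi x * S x / rho2 x)%:E <=
   N%:E * \int[leb]_x (D x / rho2 x)%:E)%E.
Proof.
move=> m0 adm N0 LN.
have r0 (x : T3) : 0 <= (rho2 x)^-1 by rewrite invr_ge0 addr_ge0// sqr_ge0.
have mr : measurable_fun [set: T3] (fun x => (rho2 x)^-1).
  by apply: measurable_funVr; exact: measurable_rho2.
have k0 : 0 < (2 * pi)^-1 :> R by rewrite invr_gt0 mulr_gt0// pi_gt0.
have mD : measurable_fun [set: T3] D.
  apply: measurable_funD; apply: measurable_funX.
    by apply: measurable_funD => //; exact: measurable_funM.
  by apply: measurable_funB => //; exact: measurable_funM.
have D0 x : 0 <= D x by rewrite addr_ge0// sqr_ge0.
have mA : measurable_fun [set: T3] (fun x => aphi x * S x).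
  exact: measurable_funM.
have A0 x : 0 <= aphi x * S x by rewrite mulr_ge0.
(* Since [rho2] is constant on orbits, its inverse leaves the orbit average, and both sides become
   integrals of the two sides of the orbit inequality. *)
have avg (c : R) (h : T3 -> R) : 0 <= c -> measurable_fun [set: T3] h -> (forall x, 0 <= h x) ->
    (c%:E * \int[leb]_x (h x / rho2 x)%:E = \int[leb]_x ((rho2 x)^-1%:E *
      (c%:E * ((2 * pi)^-1%:E * \int[mu]_(t in @per R) (h (flow 1 0 t x))%:E))))%E.
  move=> c0 mh h0.
  rewrite (@ge0_integral_average_rot R (fun x => h x / rho2 x)); first last.
  - by move=> x; exact: mulr_ge0.
  - exact: measurable_funM.
  rewrite muleA -EFinM -ge0_integralZl_EFin//; first last.
  - by rewrite mulr_ge0// ltW.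
  - apply: (@measurable_integral_rot R (fun x => h x / rho2 x)).
    exact: measurable_funM.
  - by move=> x _; apply: integral_ge0 => t _; rewrite lee_fin; exact: mulr_ge0.
  apply: eq_integral => x _; rewrite integral_rot_rho2// [RHS]muleCA muleA.
  by rewrite EFinM -!muleA; congr (_ * _)%E; rewrite muleCA.
rewrite (avg m _ m0 mA A0) (avg N D (ltW N0) mD D0).
have mI (c : R) (h : T3 -> R) : measurable_fun [set: T3] h -> measurable_fun [set: T3]
   (fun x => (rho2 x)^-1%:E *
      (c%:E * ((2 * pi)^-1%:E * \int[mu]_(t in @per R) (h (flow 1 0 t x))%:E)))%E.
  move=> mh; apply: emeasurable_funM; first exact/measurable_EFinP.
  apply: emeasurable_funM => //; apply: emeasurable_funM => //.
  exact: measurable_integral_rot.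
have I0 (c : R) (h : T3 -> R) x : 0 <= c -> (forall x, 0 <= h x) -> (0 <= (rho2 x)^-1%:E *
      (c%:E * ((2 * pi)^-1%:E * \int[mu]_(t in @per R) (h (flow 1 0 t x))%:E)))%E.
  move=> c0 h0; apply: mule_ge0; first by rewrite lee_fin.
  apply: mule_ge0; first by rewrite lee_fin.
  apply: mule_ge0; first by rewrite lee_fin ltW.
  by apply: integral_ge0 => t _; rewrite lee_fin.
apply: ae_ge0_le_integral => //.
- by move=> x _; exact: (I0 m _ x m0 A0).
- exact: (mI m _ mA).
- by move=> x _; exact: (I0 N _ x (ltW N0) D0).
- exact: (mI N _ mD).
- apply: ae_imply (ae_angular_inequality m0 adm N0 LN) => x h _.
  by apply: lee_wpmul2l h; rewrite lee_fin.
Qed.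

End angular_inequality.

(** * Local integrability of square integrable functions *)

Section square_integrable.
Context {R : realType}.
Local Notation mu := (@lebesgue_measure R).
Local Notation leb := (lebesgue3 R).
Let T3 := (R * R * R)%type.

Lemma shell_lty (d M : R) : (leb (shell d M) < +oo)%E.
Proof.
set c := `|M| + 1.
pose I : set (measurableTypeR R) := `[- c, c]%classic.
have c0 : 0 <= c by rewrite addr_ge0.
have mI : measurable I by exact: measurable_itv.
apply: (@le_lt_trans _ _ (leb ((I `*` I) `*` I))).
  apply: le_measure; rewrite ?inE.
  - exact: measurable_shell.
  - by apply: measurableX => //; exact: measurableX.
  - move=> x [_]; rewrite /norm2 /rho2 => H.
    have bd (r : R) : r ^+ 2 <= M -> I r.
      move=> rM; rewrite /I/= in_itv/= -ler_norml -ler_sqr ?nnegrE// real_normK ?num_real//.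
      rewrite (le_trans rM)// (le_trans (ler_norm M))// /c; have := normr_ge0 M; nra.
    have := sqr_ge0 (x1 x); have := sqr_ge0 (x2 x); have := sqr_ge0 (x3 x) => h3 h2 h1.
    by split; [split|]; apply: bd; lra.
have mIfin : (mu I < +oo)%E.
  by rewrite /I lebesgue_measure_itv/=; case: ifP => _; rewrite ?ltry// -EFinB ltry.
have m2 : measurable (I `*` I) by exact: measurableX.
have E2 : (product_sf mu mu (I `*` I) = mu I * mu I)%E.
  exact: (@product_measure1E _ _ _ _ _ mu mu I I mI mI).
have -> : (leb ((I `*` I) `*` I) = product_sf mu mu (I `*` I) * mu I)%E.
  exact: (@product_measure1E _ _ _ _ _ (product_sf mu mu) mu _ I m2 mI).
by rewrite E2 !lte_mul_pinfty// ?mule_ge0// ge0_fin_numE// ?mule_ge0// lte_mul_pinfty// ge0_fin_numE.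
Qed.

Lemma integrable_shell_sq (w : T3 -> R) : measurable_fun [set: T3] w ->
  (\int[leb]_x (w x ^+ 2)%:E < +oo)%E ->
  forall d M, 0 < d -> leb.-integrable (shell d M) (EFin \o w).
Proof.
move=> mw w2 d M _; have mS := @measurable_shell R d M.
have mE (f : T3 -> R) : measurable_fun [set: T3] f ->
    measurable_fun (shell d M) (fun x => (f x)%:E).
  by move=> mf; apply: (measurable_funS measurableT) => //; exact/measurable_EFinP.
have i2 : leb.-integrable (shell d M) (fun x => (w x ^+ 2)%:E).
  apply: (integrableS measurableT) => //; apply/integrableP; split.
    by apply/measurable_EFinP; exact: measurable_funX.
  under eq_integral do rewrite abse_EFin ger0_norm ?sqr_ge0//.
  by [].
have i1 : leb.-integrable (shell d M) (fun x => (1 : R)%:E).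
  apply/integrableP; split; first exact: measurable_cst.
  under eq_integral do rewrite abse1.
  by rewrite integral_cst// mul1e; exact: shell_lty.
have i12 : leb.-integrable (shell d M) (fun x => (w x ^+ 2)%:E + (1 : R)%:E)%E.
  exact: integrableD.
apply: le_integrable i12 => //; first exact: mE.
move=> x _; rewrite -EFinD !abse_EFin lee_fin [leRHS]ger0_norm; last first.
  by rewrite addr_ge0// sqr_ge0.
have := sqr_ge0 (`|w x| - 1); rewrite -[w x ^+ 2]real_normK ?num_real//.
by have := normr_ge0 (w x); nra.
Qed.

End square_integrable.

(** * Radial and angular parts of the magnetic gradient *)

Section magnetic_density.
Context {R : realType}.
Let T3 := (R * R * R)%type.

(** Bessel's inequality for the orthonormal radial and angular directions at (X, Y, Z). The defect
    is the squared component along the third vector of the spherical frame, proportional to (XZ, YZ,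
    -X^2 - Y^2). *)
Lemma radial_angular_le (X Y Z A B C : R) : 0 < X ^+ 2 + Y ^+ 2 ->
  (X * A + (Y * B + Z * C)) ^+ 2 / (X ^+ 2 + Y ^+ 2 + Z ^+ 2)
  + (X * B - Y * A) ^+ 2 / (X ^+ 2 + Y ^+ 2) <= A ^+ 2 + (B ^+ 2 + C ^+ 2).
Proof.
move=> r0; have n0 : 0 < X ^+ 2 + Y ^+ 2 + Z ^+ 2 by rewrite ltr_wpDr// sqr_ge0.
rewrite -subr_ge0.
have -> : A ^+ 2 + (B ^+ 2 + C ^+ 2) -
    ((X * A + (Y * B + Z * C)) ^+ 2 / (X ^+ 2 + Y ^+ 2 + Z ^+ 2)
     + (X * B - Y * A) ^+ 2 / (X ^+ 2 + Y ^+ 2)) =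
    ((X * A + Y * B) * Z - C * (X ^+ 2 + Y ^+ 2)) ^+ 2 /
    ((X ^+ 2 + Y ^+ 2) * (X ^+ 2 + Y ^+ 2 + Z ^+ 2)).
  by field; rewrite !gt_eqF.
by rewrite divr_ge0 ?sqr_ge0// ltW// mulr_gt0.
Qed.

Lemma magn_density_ge (a : R) (u v : T3 -> R) (gu gv : 'I_3 -> T3 -> R) x :
  Omega x ->
  (dflow 0 1 gu x ^+ 2 + dflow 0 1 gv x ^+ 2) / norm2 x +
  ((dflow 1 0 gu x + a * v x) ^+ 2 + (dflow 1 0 gv x - a * u x) ^+ 2) / rho2 x
  <= magn_density a u v gu gv x.
Proof.
move=> Ox; have r0 : 0 < rho2 x.
  by rewrite lt_neqAle eq_sym Ox addr_ge0// sqr_ge0.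
have Hu := @radial_angular_le (x1 x) (x2 x) (x3 x) (gu 0 x - Apot a 0 x * v x)
  (gu 1 x - Apot a 1 x * v x) (gu 2 x - Apot a 2 x * v x) r0.
have Hv := @radial_angular_le (x1 x) (x2 x) (x3 x) (gv 0 x + Apot a 0 x * u x)
  (gv 1 x + Apot a 1 x * u x) (gv 2 x + Apot a 2 x * u x) r0.
rewrite -/(rho2 x) -/(norm2 x) in Hu Hv.
have E1 (g : 'I_3 -> T3 -> R) : dflow 0 1 g x = x1 x * g 0 x + (x2 x * g 1 x + x3 x * g 2 x).
  by rewrite /dflow sum_ord3 /coord /field /x1 /x2 /x3/=; ring.
have E2 (g : 'I_3 -> T3 -> R) : dflow 1 0 g x = x1 x * g 1 x - x2 x * g 0 x.
  by rewrite /dflow sum_ord3 /coord /field /x1 /x2 /x3/=; ring.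
have A0 : Apot a 0 x = a / rho2 x * x2 x by [].
have A1 : Apot a 1 x = - (a / rho2 x * x1 x) by [].
have A2 : Apot a 2 x = 0 by [].
have rE : rho2 x = x1 x ^+ 2 + x2 x ^+ 2 by [].
rewrite /magn_density sum_ord3 !E1 !E2.
rewrite A0 A1 A2 in Hu Hv *.
have ru : x1 x * (gu 0 x - a / rho2 x * x2 x * v x) +
    (x2 x * (gu 1 x - - (a / rho2 x * x1 x) * v x) + x3 x * (gu 2 x - 0 * v x)) =
    x1 x * gu 0 x + (x2 x * gu 1 x + x3 x * gu 2 x) by ring.
have rv : x1 x * (gv 0 x + a / rho2 x * x2 x * u x) +
    (x2 x * (gv 1 x + - (a / rho2 x * x1 x) * u x) + x3 x * (gv 2 x + 0 * u x)) =
    x1 x * gv 0 x + (x2 x * gv 1 x + x3 x * gv 2 x) by ring.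
have arho w : a / rho2 x * w * (x1 x ^+ 2 + x2 x ^+ 2) = a * w.
  by rewrite -rE; field.
have su : x1 x * (gu 1 x - - (a / rho2 x * x1 x) * v x) -
    x2 x * (gu 0 x - a / rho2 x * x2 x * v x) =
    x1 x * gu 1 x - x2 x * gu 0 x + a * v x.
  by rewrite -(arho (v x)); ring.
have sv : x1 x * (gv 1 x + - (a / rho2 x * x1 x) * u x) -
    x2 x * (gv 0 x + a / rho2 x * x2 x * u x) =
    x1 x * gv 1 x - x2 x * gv 0 x - a * u x.
  by rewrite -(arho (u x)); ring.
rewrite ru su in Hu; rewrite rv sv in Hv.
rewrite !mulrDl; lra.
Qed.

End magnetic_density.

(** Both the supremum and [J] may be infinite. For finite positive [J] one divides; if [J] is
    infinite and the supremum positive, a single positive m in [S] already forces [B] to be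
    infinite. The zero cases rest on the convention 0 * oo = 0. *)
Lemma mule_ereal_sup_le (R : realType) (S : set R) (J B : \bar R) : (0 <= J)%E -> (0 <= B)%E ->
  (forall m, S m -> 0 <= m -> (m%:E * J <= B)%E) ->
  S 0 -> (ereal_sup [set m%:E | m in S] * J <= B)%E.
Proof.
move=> J0 B0 H S00.
have mu0 : (0 <= ereal_sup [set m%:E | m in S])%E by apply: ereal_sup_ubound; exists 0.
have [->|Jn0] := eqVneq J 0%E; first by rewrite mule0.
have Jgt0 : (0 < J)%E by rewrite lt_neqAle eq_sym Jn0.
case: J J0 H Jn0 Jgt0 => [r| |]// J0 H _ Jgt0.
  rewrite lte_fin in Jgt0.
  rewrite -lee_pdivlMr//; apply: ge_ereal_sup => _ [m Sm <-].
  rewrite lee_pdivlMr//; have [m0|m0] := leP 0 m; first exact: H.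
  by apply: le_trans B0; rewrite -EFinM lee_fin nmulr_rle0// ltW.
have [->|mun0] := eqVneq (ereal_sup [set m%:E | m in S]) 0%E; first by rewrite mul0e.
have : (0 < ereal_sup [set m%:E | m in S])%E by rewrite lt_neqAle eq_sym mun0.
move=> /ereal_sup_gt[_ [m Sm <-] m0].
by have := H m Sm (ltW m0); rewrite gt0_muley// leye_eq => /eqP ->; rewrite leey.
Qed.

(** * Assembling the radial and the angular inequality *)

Section magnetic_hardy.
Context {R : realType}.
Local Notation mu := (@lebesgue_measure R).
Local Notation leb := (lebesgue3 R).
Let T3 := (R * R * R)%type.
Variables (a p : R) (phi : R -> R) (u v : T3 -> R) (gu gv : 'I_3 -> T3 -> R).
Hypotheses (p2 : 2 < p) (mphi : measurable_fun (@per R) phi).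
Hypothesis phiq :
  (\int[mu]_(t in @per R) (powR `|phi t| (p / (p - 2)))%:E < +oo)%E.
Hypotheses (mu_ : measurable_fun [set: T3] u) (mv_ : measurable_fun [set: T3] v).
Hypothesis wu : forall j, weak_partial3 j u (gu j).
Hypothesis wv : forall j, weak_partial3 j v (gv j).
Hypothesis uv2 : (\int[leb]_x (u x ^+ 2 + v x ^+ 2)%:E < +oo)%E.

Let mE (f : T3 -> R) : measurable_fun [set: T3] f ->
  measurable_fun [set: T3] (fun x => (f x)%:E).
Proof. by move=> mf; exact/measurable_EFinP. Qed.

Let u2 : (\int[leb]_x (u x ^+ 2)%:E < +oo)%E.
Proof.
apply: le_lt_trans uv2; apply: ge0_le_integral => //.
- by move=> x _; rewrite lee_fin sqr_ge0.
- by apply: mE; exact: measurable_funX.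
- by apply: mE; apply: measurable_funD; exact: measurable_funX.
- by move=> x _; rewrite lee_fin lerDl sqr_ge0.
Qed.

Let v2 : (\int[leb]_x (v x ^+ 2)%:E < +oo)%E.
Proof.
apply: le_lt_trans uv2; apply: ge0_le_integral => //.
- by move=> x _; rewrite lee_fin sqr_ge0.
- by apply: mE; exact: measurable_funX.
- by apply: mE; apply: measurable_funD; exact: measurable_funX.
- by move=> x _; rewrite lee_fin lerDr sqr_ge0.
Qed.

Let iu := integrable_shell_sq mu_ u2.
Let iv := integrable_shell_sq mv_ v2.

Let mdu b c : measurable_fun [set: T3] (dflow b c gu).
Proof. by apply: measurable_dflow => j; case: (wu j). Qed.

Let mdv b c : measurable_fun [set: T3] (dflow b c gv).
Proof. by apply: measurable_dflow => j; case: (wv j). Qed.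

Local Notation S := (fun x => u x ^+ 2 + v x ^+ 2).
Local Notation D := (fun x => (dflow 1 0 gu x + a * v x) ^+ 2 + (dflow 1 0 gv x - a * u x) ^+ 2).
Local Notation Q := (fun x => dflow 0 1 gu x ^+ 2 + dflow 0 1 gv x ^+ 2).

Let mrho : measurable_fun [set: T3] (fun x : T3 => (rho2 x)^-1).
Proof. by apply: measurable_funVr; exact: measurable_rho2. Qed.

Let mnorm : measurable_fun [set: T3] (fun x : T3 => (norm2 x)^-1).
Proof. by apply: measurable_funVr; exact: measurable_norm2. Qed.

Let rho0 (x : T3) : 0 <= (rho2 x)^-1.
Proof. by rewrite invr_ge0 addr_ge0// sqr_ge0. Qed.

Let norm0 (x : T3) : 0 <= (norm2 x)^-1.
Proof. by rewrite invr_ge0 addr_ge0 ?sqr_ge0// addr_ge0// sqr_ge0. Qed.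

Lemma radial_hardy :
  ((1 / 4)%:E * \int[leb]_x (S x / norm2 x)%:E <= \int[leb]_x (Q x / norm2 x)%:E)%E.
Proof.
have split2 (f g : T3 -> R) : measurable_fun [set: T3] f -> measurable_fun [set: T3] g ->
    (\int[leb]_x ((f x ^+ 2 + g x ^+ 2) / norm2 x)%:E =
     \int[leb]_x (f x ^+ 2 / norm2 x)%:E + \int[leb]_x (g x ^+ 2 / norm2 x)%:E)%E.
  move=> mf mg; rewrite -ge0_integralD//.
  - by apply: eq_integral => x _; rewrite -EFinD mulrDl.
  - by move=> x _; rewrite lee_fin; apply: mulr_ge0 => //; exact: sqr_ge0.
  - by apply: mE; apply: measurable_funM => //; exact: measurable_funX.
  - by move=> x _; rewrite lee_fin; apply: mulr_ge0 => //; exact: sqr_ge0.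
  - by apply: mE; apply: measurable_funM => //; exact: measurable_funX.
rewrite (split2 u v)// (split2 (dflow 0 1 gu) (dflow 0 1 gv))//.
have I0 (f : T3 -> R) : (0 <= \int[leb]_x (f x ^+ 2 / norm2 x)%:E)%E.
  by apply: integral_ge0 => x _; rewrite lee_fin; apply: mulr_ge0 => //; exact: sqr_ge0.
have q4 : (0 <= (1 / 4 : R)%:E)%E by rewrite lee_fin divr_ge0.
rewrite ge0_muleDr//; apply: leeD.
  apply: (le_trans (lee_wpmul2l q4 (hardy mu_ iu wu u2))).
  by rewrite muleA -EFinM div1r mulVf ?mul1e.
apply: (le_trans (lee_wpmul2l q4 (hardy mv_ iv wv v2))).
by rewrite muleA -EFinM div1r mulVf ?mul1e.
Qed.

Lemma angular_hardy :
  (mu_ap a p * ((fine (Lqcirc (p / (p - 2)) phi))^-1)%:E *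
     \int[leb]_x (phi (angle (x1 x) (x2 x)) / rho2 x * S x)%:E <=
   \int[leb]_x (D x / rho2 x)%:E)%E.
Proof.
have k0 : 0 < (2 * pi)^-1 :> R by rewrite invr_gt0 mulr_gt0// pi_gt0.
set L := Lqcirc _ _; set N := fine L; set B := (\int[leb]_x (D x / rho2 x)%:E)%E.
have L0 : (0 <= L)%E by exact: poweR_ge0.
have LN : L = N%:E.
  rewrite fineK// ge0_fin_numE//; apply: poweR_lty; apply: lte_mul_pinfty => //.
  by rewrite lee_fin ltW.
have N0 : 0 <= N by exact: fine_ge0.
have D0 x : 0 <= D x by rewrite addr_ge0// sqr_ge0.
have B0 : (0 <= B)%E.
  by apply: integral_ge0 => x _; rewrite lee_fin; exact: (mulr_ge0 (D0 x) (rho0 x)).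
(* With the convention 0^-1 = 0 the left side is 0 in this case. *)
have [N00|Nn0] := eqVneq N 0; first by rewrite N00 invr0 mule0 mul0e.
have Ngt0 : 0 < N by rewrite lt_neqAle eq_sym Nn0.
(* Admissibility of 0 makes [mu_ap] nonnegative, so that the left side is monotone in the weighted
   integral. *)
have adm0 : circle_admissible a p 0.
  move=> f f' g g' _ _; rewrite mul0e; apply: mule_ge0; first by rewrite lee_fin ltW.
  by apply: integral_ge0 => t _; rewrite lee_fin addr_ge0// sqr_ge0.
set X := (\int[leb]_x _)%E.
(* [phi] may change sign; passing to its absolute value keeps the norm and can only raise the
   weighted integral. *)
pose J := (\int[leb]_x (`|phi (angle (x1 x) (x2 x))| * S x / rho2 x)%:E)%E.
have S0 x : 0 <= S x by rewrite addr_ge0// sqr_ge0.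
have J0 : (0 <= J)%E.
  apply: integral_ge0 => x _; rewrite lee_fin.
  exact: (mulr_ge0 (mulr_ge0 (normr_ge0 _) (S0 x)) (rho0 x)).
have XJ : (X <= J)%E.
  apply: (le_trans (lee_abs _)); apply: (le_trans (le_abse_integral _ _ _)) => //.
    apply: mE; apply: measurable_funM.
      by apply: measurable_funM => //; exact: measurable_phi_angle.
    by apply: measurable_funD; exact: measurable_funX.
  rewrite le_eqVlt; apply/predU1P; left; apply: eq_integral => x _.
  rewrite abse_EFin; congr EFin.
  by rewrite normrM normrM (ger0_norm (rho0 x)) (ger0_norm (S0 x)) mulrAC.
have Ni0 : (0 <= (N^-1)%:E)%E by rewrite lee_fin invr_ge0.
have mu0 : (0 <= mu_ap a p)%E by apply: ereal_sup_ubound; exists 0.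
apply: (@le_trans _ _ (mu_ap a p * ((N^-1)%:E * J))%E).
  by rewrite -muleA; apply: lee_wpmul2l => //; exact: lee_wpmul2l.
apply: (@mule_ereal_sup_le R (circle_admissible a p)) => //; first exact: mule_ge0.
move=> m adm m0.
have := angular_inequality p2 mphi mu_ mv_ iu iv wu wv uv2 m0 adm Ngt0 LN.
rewrite -/J -/B => /(lee_wpmul2l Ni0).
by rewrite muleCA [X in (_ <= X)%E]muleA -EFinM mulVf// mul1e.
Qed.

Lemma magn_density_split :
  (\int[leb]_x (Q x / norm2 x)%:E + \int[leb]_x (D x / rho2 x)%:E <=
   \int[leb]_x (magn_density a u v gu gv x)%:E)%E.
Proof.
have mD : measurable_fun [set: T3] D.
  apply: measurable_funD; apply: measurable_funX.
    by apply: measurable_funD => //; exact: measurable_funM.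
  by apply: measurable_funB => //; exact: measurable_funM.
have mQ : measurable_fun [set: T3] Q by apply: measurable_funD; exact: measurable_funX.
have D0 x : 0 <= D x by rewrite addr_ge0// sqr_ge0.
have Q0 x : 0 <= Q x by rewrite addr_ge0// sqr_ge0.
have mA j : measurable_fun [set: T3] (Apot a j).
  have mx1 : measurable_fun [set: T3] (@x1 R) by exact: (measurable_coord 0).
  have mx2 : measurable_fun [set: T3] (@x2 R) by exact: (measurable_coord 1).
  case: j => [[|[|[|//]]] hj].
  - by apply: measurable_funM => //; exact: measurable_funM.
  - have m1 : measurable_fun [set: T3] (fun x => a / rho2 x * x1 x).
      by apply: measurable_funM => //; exact: measurable_funM.
    exact: (measurableT_comp _ m1).
  - exact: measurable_cst.
rewrite -ge0_integralD//.
- apply: ae_ge0_le_integral => //.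
  + move=> x _; rewrite -EFinD lee_fin.
    exact: (addr_ge0 (mulr_ge0 (Q0 x) (norm0 x)) (mulr_ge0 (D0 x) (rho0 x))).
  + by apply: emeasurable_funD; apply: mE; exact: measurable_funM.
  + by move=> x _; rewrite lee_fin sumr_ge0// => j _; rewrite addr_ge0// sqr_ge0.
  + apply: mE; apply: measurable_sum => j.
    have mgu : measurable_fun [set: T3] (gu j) by case: (wu j).
    have mgv : measurable_fun [set: T3] (gv j) by case: (wv j).
    by apply: measurable_funD; apply: measurable_funX;
      [apply: measurable_funB|apply: measurable_funD] => //; exact: measurable_funM.
  + apply: ae_imply (@ae_Omega R) => x Ox _.
    by rewrite -EFinD lee_fin; exact: magn_density_ge.
- by move=> x _; rewrite lee_fin; exact: (mulr_ge0 (Q0 x) (norm0 x)).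
- by apply: mE; exact: measurable_funM.
- by move=> x _; rewrite lee_fin; exact: (mulr_ge0 (D0 x) (rho0 x)).
- by apply: mE; exact: measurable_funM.
Qed.

End magnetic_hardy.

Unset Implicit Arguments.

Theorem theorem5p2 (R : realType) (a p : R) (phi : R -> R)
  (u v : R * R * R -> R) (gu gv : 'I_3 -> R * R * R -> R) :
  0 <= a <= 1 / 2 -> 2 < p ->
  measurable_fun (@per R) phi ->
  (\int[lebesgue_measure]_(t in @per R) (powR `|phi t| (p / (p - 2)))%:E
     < +oo)%E ->
  ~ {ae lebesgue_measure, forall t, per t -> phi t = 0} ->
  H1A a u v gu gv ->
  ((1 / 4)%:E * \int[@leb3 R]_x ((u x ^+ 2 + v x ^+ 2) / norm2 x)%:E
   + mu_ap a p * ((fine (Lqcirc (p / (p - 2)) phi))^-1)%:E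
     * \int[@leb3 R]_x (phi (angle (x1 x) (x2 x)) / rho2 x
                         * (u x ^+ 2 + v x ^+ 2))%:E
   <= \int[@leb3 R]_x (magn_density a u v gu gv x)%:E)%E.
Proof.
move=> _ p2 mphi phiq _ [mu_ mv_ uv2 w _].
have wu j : weak_partial3 j u (gu j) by case: (w j).
have wv j : weak_partial3 j v (gv j) by case: (w j).
apply: le_trans (magn_density_split a mu_ mv_ wu wv).
exact: (leeD (radial_hardy mu_ mv_ wu wv uv2)
  (angular_hardy a p2 mphi phiq mu_ mv_ wu wv uv2)).
Qed.
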